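(* Assume the multilattice setting, potentials and notation fixed in the context. Suppose that: (1a) the reference configuration is an equilibrium of the defect-free energy: $\sum_{\xi\in\mathcal L}\sum_{(\rho\alpha\beta)\in\mathcal R}\hat V_{,(\rho\alpha\beta)}(D\mathbf y(\xi))\cdot D_{(\rho\alpha\beta)}\mathbf v(\xi)=0$ for all $\mathbf v\in\boldsymbol{\mathcal U}_0$; (1b) there exists $\gamma_{\rm a}>0$ such that $\langle\delta^2\mathcal E^{\rm a}_{\rm hom}(0)\mathbf v,\mathbf v\rangle\ge\gamma_{\rm a}\|\mathbf v\|_{{\rm a}_1}^2$ for all $\mathbf v\in\boldsymbol{\mathcal U}_0$; (2) $\mathbf u^\infty=(u^\infty_\alpha)_{\alpha=0}^{S-1}\in\boldsymbol{\mathcal U}$ satisfies $\langle\delta\mathcal E^{\rm a}(\mathbf u^\infty),\mathbf v\rangle=0$ for all $\mathbf v\in\boldsymbol{\mathcal U}_0$. Set $U^\infty:=u^\infty_0$ and $p^\infty_\alpha:=u^\infty_\alpha-u^\infty_0$. Then there exists a constant $C>0$, depending only on the interatomic potential (the site potentials), the interaction range and the stability constant $\gamma_{\rm a}$, such that for all $\xi\in\mathcal L$ and all $\alpha\in\{0,\dots,S-1\}$, $$|D_{\boldsymbol\rho}U^\infty(\xi)|\le C(1+|\xi|)^{1-d-j}\qquad\text{for all }\boldsymbol\rho\in(\mathcal R_1)^j,\ 1\le j\le 3,$$ $$|D_{\boldsymbol\rho}p^\infty_\alpha(\xi)|\le C(1+|\xi|)^{-d-j}\qquad\text{for all }\boldsymbol\rho\in(\mathcal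 R_1)^j,\ 0\le j\le 2.$$
   Context: Lattice. Let $d\in\{2,3\}$ and let $n=d$, or $n=3$ if $d=2$. Fix $\mathsf F\in\mathbb R^{d\times d}$ with $\det\mathsf F=1$, an integer $S\ge1$, $\mathcal S=\{0,\dots,S-1\}$, shifts $p_0=0,p_1,\dots,p_{S-1}\in\mathbb R^d$, and $\mathcal L=\mathsf F\mathbb Z^d$. When $d=2,n=3$, vectors of $\mathbb R^2$ are regarded as vectors of $\mathbb R^3$ by appending a zero component. A displacement is a tuple $\mathbf u=(u_\alpha)_{\alpha=0}^{S-1}$ of functions $u_\alpha:\mathcal L\to\mathbb R^n$. Finite differences. $D_{(\rho\alpha\beta)}\mathbf u(\xi)=u_\beta(\xi+\rho)-u_\alpha(\xi)$ for $(\rho\alpha\beta)\in\mathcal L\times\mathcal S\times\mathcal S$. The interaction range $\mathcal R\subset(\mathcal L\times\mathcal S\times\mathcal S)\setminus\{(0\alpha\alpha):\alpha\in\mathcal S\}$ is finite; $D\mathbf u(\xi)=(D_{(\rho\alpha\beta)}\mathbf u(\xi))_{(\rho\alpha\beta)\in\mathcal R}$; $\mathcal R_1=\{\rho\in\mathcal L:\exists\,\alpha,\beta,\ (\rho\alpha\beta)\in\mathcal R\}$. For $w:\mathcal L\to\mathbb R^n$, $D_\rho w(\xi)=w(\xi+\rho)-w(\xi)$, $Dw(\xi)=(D_\rho w(\xi))_{\rho\in\mathcal R_1}$, and for $\boldsymbol\rho=(\rho_1,\dots,\rho_j)$, $D_{\boldsymbol\rho}w=D_{\rho_1}\cdots D_{\rho_j}w$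 (with $D_{\boldsymbol\rho}w=w$ if $j=0$). Standing assumptions on $\mathcal R$: (i) $\operatorname{span}\{\rho:(\rho\alpha\alpha)\in\mathcal R\}=\mathbb R^d$ for every $\alpha\in\mathcal S$; (ii) $(0\alpha\beta)\in\mathcal R$ for all $\alpha\ne\beta$; (iii) fix a regular (conforming) simplicial decomposition $\mathcal T_{\rm a}$ of $\mathbb R^d$ obtained by dividing $\mathsf F[0,1]^d$ into simplices whose vertices are vertices of $\mathsf F[0,1]^d$ and translating by $\mathcal L$; whenever the segment from $\xi$ to $\xi+\rho$ is an edge of $\mathcal T_{\rm a}$, $\rho\in\mathcal R_1$. Spaces. $\|\mathbf u\|_{{\rm a}_1}^2=\sum_{\xi\in\mathcal L}\sum_{(\rho\alpha\beta)\in\mathcal R}|D_{(\rho\alpha\beta)}\mathbf u(\xi)|^2$; $\mathcal U=\{\mathbf u:\|\mathbf u\|_{{\rm a}_1}<\infty\}$; $\mathcal U_0=\{\mathbf u\in\mathcal U: Du_0\text{ and }u_\alpha-u_0\text{ have compact support for each }\alpha\}$; $\boldsymbol{\mathcal U}=\mathcal U/\mathbb R^n$ and $\boldsymbol{\mathcal U}_0=\mathcal U_0/\mathbb R^n$ (identifying displacements that differ by adding one constant vector to all $u_\alpha$). Energies. Site potentials $\hat V_\xi:(\mathbb R^n)^{\mathcal R}\to\mathbb R$, $\xi\in\mathcal L$, are $C^4$ with uniformly bounded derivatives, and there are $R_{\rm def}>0$ and $\hat V$ with $\hat V_\xi=\hat V$ for $|\xi|\ge R_{\rm def}$ ($\hat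 V$ has the same regularity). The reference configuration is $y_\alpha(\xi)=\xi+p_\alpha$, so $D_{(\rho\alpha\beta)}\mathbf y(\xi)=\rho+p_\beta-p_\alpha$. Put $V_\xi(\mathbf g)=\hat V_\xi(D\mathbf y+\mathbf g)-\hat V(D\mathbf y)$, $V(\mathbf g)=\hat V(D\mathbf y+\mathbf g)-\hat V(D\mathbf y)$, $\mathcal E^{\rm a}(\mathbf u)=\sum_{\xi}V_\xi(D\mathbf u(\xi))$, $\mathcal E^{\rm a}_{\rm hom}(\mathbf u)=\sum_\xi V(D\mathbf u(\xi))$ (on $\boldsymbol{\mathcal U}$ these are understood as the continuous extensions from $\boldsymbol{\mathcal U}_0$). Subscripts $,(\rho\alpha\beta)$ denote partial gradients with respect to the component $\mathbf g_{(\rho\alpha\beta)}\in\mathbb R^n$. For $\mathbf u\in\boldsymbol{\mathcal U}$, $\mathbf v\in\boldsymbol{\mathcal U}_0$, $\langle\delta\mathcal E^{\rm a}(\mathbf u),\mathbf v\rangle=\sum_\xi\sum_{(\rho\alpha\beta)\in\mathcal R}V_{\xi,(\rho\alpha\beta)}(D\mathbf u(\xi))\cdot D_{(\rho\alpha\beta)}\mathbf v(\xi)$, and $\langle\delta^2\mathcal E^{\rm a}_{\rm hom}(0)\mathbf u,\mathbf v\rangle=\sum_\xi\delta^2V(0)[D\mathbf u(\xi),D\mathbf v(\xi)]$, where $\delta^2V(0)$ is the second derivative of $V$ at $0$ as a bilinear form on $(\mathbb R^n)^{\mathcal R}$.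
   Formalization: The constant C is allowed to depend also on the equilibrium u^∞; a constant depending only on the potentials, range and γ_a fails, e.g. for V̂ = Σ(1−cos(g−Dy)), where every finitely supported 2πZ-valued displacement is an equilibrium. *)

(* Defs.v *)
From HB Require Import structures.
From mathcomp Require Import all_boot all_order all_algebra.
From mathcomp Require Import finmap.
From mathcomp Require Import all_classical all_reals all_analysis.

Set Implicit Arguments.
Unset Strict Implicit.
Unset Printing Implicit Defensive.

Import Order.TTheory GRing.Theory Num.Theory.
Import numFieldNormedType.Exports.

Local Open Scope classical_set_scope.
Local Open Scope ring_scope.

(* Conventions.
   - A site xi of the lattice F Z^d is represented by its integer coordinates
     k : 'cV[int]_d; its position is F k ([site]).  As F is invertible this is
     a bijection, and it turns addition of sites into addition of coordinates.
   - The S species are 'I_N.+1, that is S = N + 1.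
   - The interaction range is a finite set of triples, enumerated without
     repetition by rng : 'I_m -> triple; a stencil (g_r)_r in (R^n)^m is the
     n x m matrix whose i-th column is the component of index rng i.
   - The norm that the library puts on matrices is the sup norm; lengths of
     vectors below are Euclidean ([enorm]).
   - In the decay estimates the constant C is chosen after the equilibrium u: no
     constant serves all the equilibria of given site potentials.  For instance,
     let Vhat_xi (g) = Vhat (g) be the sum over all entries of
     1 - cos (g_ki - (Dy)_ki); then every u with values in 2 pi Z^n and finite
     support is an equilibrium, and |D_rho u_0 (0)| can be arbitrarily large. *)

Notation Zsite d := 'cV[int]_d.

Definition enorm (R : realType) (n : nat) (x : 'cV[R]_n) : R :=
  Num.sqrt (\sum_(k < n) x k 0 ^+ 2).

Definition edot (R : realType) (n : nat) (x y : 'cV[R]_n) : R :=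
  \sum_(k < n) x k 0 * y k 0.

Definition site (R : realType) (d : nat) (F : 'M[R]_d) (k : Zsite d) : 'cV[R]_d :=
  F *m map_mx (fun z : int => z%:~R) k.

(* The inclusion of R^d in R^n that appends zeros, used for d <= n. *)
Definition embed (R : realType) (d n : nat) (x : 'cV[R]_d) : 'cV[R]_n :=
  \col_(k < n) (if insub (val k) is Some i then x i 0 else 0).

Definition triple (d N : nat) : Type := (Zsite d * 'I_N.+1 * 'I_N.+1)%type.

Definition displacement (R : realType) (d n N : nat) : Type :=
  'I_N.+1 -> Zsite d -> 'cV[R]_n.

(** ** Finite differences *)

Definition Dtriple (R : realType) (d n N : nat) (r : triple d N)
    (u : displacement R d n N) (xi : Zsite d) : 'cV[R]_n :=
  let: (rho, alpha, beta) := r in u beta (xi + rho) - u alpha xi.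

Definition Dstencil (R : realType) (d n N m : nat) (rng : 'I_m -> triple d N)
    (u : displacement R d n N) (xi : Zsite d) : 'M[R]_(n, m) :=
  \matrix_(k < n, i < m) Dtriple (rng i) u xi k 0.

Definition in_R1 (d N m : nat) (rng : 'I_m -> triple d N) (rho : Zsite d) : Prop :=
  exists alpha beta : 'I_N.+1, exists i : 'I_m, rng i = (rho, alpha, beta).

Definition Dsite (R : realType) (d n : nat) (rho : Zsite d)
    (w : Zsite d -> 'cV[R]_n) : Zsite d -> 'cV[R]_n :=
  fun xi => w (xi + rho) - w xi.

Definition Dsites (R : realType) (d n : nat) (rhos : seq (Zsite d))
    (w : Zsite d -> 'cV[R]_n) : Zsite d -> 'cV[R]_n :=
  foldr (@Dsite R d n) w rhos.

(** ** The atomistic triangulation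

    A simplex is given by its finite set of vertices, which are sites, and the
    triangulation by the finite set T of the simplices in the unit cell. *)

Definition hull (R : realType) (d : nat) (F : 'M[R]_d) (s : {fset Zsite d}) :
    set 'cV[R]_d :=
  [set x | exists w : Zsite d -> R,
    [/\ forall v, v \in s -> 0 <= w v,
        \sum_(v <- s) w v = 1
      & x = \sum_(v <- s) w v *: site F v]].

Definition affinely_independent (R : realType) (d : nat) (F : 'M[R]_d)
    (s : {fset Zsite d}) : Prop :=
  forall w : Zsite d -> R, \sum_(v <- s) w v = 0 ->
    \sum_(v <- s) w v *: site F v = 0 -> forall v, v \in s -> w v = 0.

Definition unit_cell (R : realType) (d : nat) (F : 'M[R]_d) : set 'cV[R]_d :=
  [set F *m t | t in [set t : 'cV[R]_d | forall i, 0 <= t i 0 <= 1]].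

Definition translate (d : nat) (a : Zsite d) (s : {fset Zsite d}) : {fset Zsite d} :=
  [fset (v + a)%R | v in s]%fset.

Definition cell_triangulation (R : realType) (d : nat) (F : 'M[R]_d)
    (T : {fset {fset Zsite d}}) : Prop :=
  [/\ (forall s, s \in T ->
        [/\ #|` s| = d.+1,
            affinely_independent F s
          & forall v, v \in s -> forall i, v i 0 = 0 \/ v i 0 = 1]),
      unit_cell F = \bigcup_(s in [set` T]) hull F s
    & forall s t, s \in T -> t \in T -> forall a : Zsite d,
        hull F s `&` hull F (translate a t) = hull F (s `&` translate a t)%fset].

(** ** Standing assumptions on the interaction range *)

Definition admissible_range (R : realType) (d N m : nat) (F : 'M[R]_d)
    (rng : 'I_m -> triple d N) (T : {fset {fset Zsite d}}) : Prop :=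
  [/\ injective rng /\ (forall i alpha, rng i <> (0, alpha, alpha)),
      (forall alpha : 'I_N.+1,
        <<[seq site F (rng i).1.1 |
             i <- enum 'I_m & ((rng i).1.2 == alpha) && ((rng i).2 == alpha)]>>%VS
        = fullv),
      (forall alpha beta : 'I_N.+1, alpha != beta ->
        exists i, rng i = (0, alpha, beta))
    & forall s, s \in T -> forall v w, v \in s -> w \in s -> v != w ->
        in_R1 rng (w - v)].

(** ** Function spaces

    Displacements are not quotiented by constants: every notion below is
    invariant under the addition of one constant vector to all the u_alpha. *)

Definition a1_normsq (R : realType) (d n N m : nat) (rng : 'I_m -> triple d N)
    (u : displacement R d n N) : \bar R :=
  (\esum_(xi in [set: Zsite d]) (\sum_(i < m) enorm (Dtriple (rng i) u xi) ^+ 2)%:E)%E.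

Definition in_U (R : realType) (d n N m : nat) (rng : 'I_m -> triple d N)
    (u : displacement R d n N) : Prop :=
  (a1_normsq rng u < +oo)%E.

(* A subset of the lattice is relatively compact iff it is finite. *)
Definition in_U0 (R : realType) (d n N m : nat) (rng : 'I_m -> triple d N)
    (u : displacement R d n N) : Prop :=
  [/\ in_U rng u,
      finite_set [set xi | exists2 rho, in_R1 rng rho & Dsite rho (u ord0) xi != 0]
    & forall alpha, finite_set [set xi | u alpha xi - u ord0 xi != 0]].

(** ** Regularity of the potentials *)

Fixpoint Ck (R : realType) (n m k : nat) (f : 'M[R]_(n, m) -> R) : Prop :=
  if k is k'.+1 then
    (forall g, differentiable f g) /\ (forall h, Ck k' (fun g => 'D_h f g))
  else continuous f.

Definition iter_deriv (R : realType) (n m : nat) (hs : seq 'M[R]_(n, m))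
    (f : 'M[R]_(n, m) -> R) : 'M[R]_(n, m) -> R :=
  foldr (fun h f' => fun g => 'D_h f' g) f hs.

(* M bounds the multilinear forms given by the derivatives of orders 1, ..., 4. *)
Definition derivs_bounded_by (R : realType) (n m : nat) (M : R)
    (f : 'M[R]_(n, m) -> R) : Prop :=
  forall hs : seq 'M[R]_(n, m), (1 <= size hs <= 4)%N ->
    forall g, `|iter_deriv hs f g| <= M * \prod_(h <- hs) `|h|.

Definition site_potentials (R : realType) (d n m : nat) (F : 'M[R]_d) (Rdef : R)
    (Vhat_ : Zsite d -> 'M[R]_(n, m) -> R) (Vhat : 'M[R]_(n, m) -> R) : Prop :=
  [/\ (forall xi, Ck 4 (Vhat_ xi)) /\ Ck 4 Vhat,
      (exists M, (forall xi, derivs_bounded_by M (Vhat_ xi)) /\ derivs_bounded_by M Vhat)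
    & forall xi, Rdef <= enorm (site F xi) -> Vhat_ xi = Vhat].

(** ** Energies *)

Definition ref_config (R : realType) (d n N : nat) (F : 'M[R]_d)
    (p : 'I_N.+1 -> 'cV[R]_d) : displacement R d n N :=
  fun alpha xi => embed n (site F xi + p alpha).

Definition Dref (R : realType) (d n N m : nat) (F : 'M[R]_d)
    (p : 'I_N.+1 -> 'cV[R]_d) (rng : 'I_m -> triple d N) : 'M[R]_(n, m) :=
  Dstencil rng (ref_config n F p) 0.

Lemma Dref_const (R : realType) (d n N m : nat) (F : 'M[R]_d)
    (p : 'I_N.+1 -> 'cV[R]_d) (rng : 'I_m -> triple d N) (xi : Zsite d) :
  Dstencil rng (ref_config n F p) xi = Dref n F p rng.
Proof.
have embedB (x y : 'cV[R]_d) : embed n x - embed n y = embed n (x - y).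
  by apply/colP => k; rewrite !mxE; case: insub => [j|]; rewrite ?mxE ?subrr.
have siteD (k l : Zsite d) : site F (k + l) = site F k + site F l.
  by rewrite /site -mulmxDr; congr (_ *m _); apply/matrixP => i j; rewrite !mxE rmorphD.
apply/matrixP => k i; rewrite 2!mxE /Dtriple; case: (rng i) => -[rho a] b.
rewrite /ref_config !embedB add0r siteD; congr (embed n _ k 0).
have -> : site F (0 : Zsite d) = 0 by apply: (addrI (site F 0)); rewrite -siteD !addr0.
by rewrite add0r -(addrA (site F xi)) opprD addrACA subrr !add0r.
Qed.

Definition partial_grad (R : realType) (n m : nat) (W : 'M[R]_(n, m) -> R)
    (i : 'I_m) (g : 'M[R]_(n, m)) : 'cV[R]_n :=
  \col_(k < n) 'D_(delta_mx k i) W g.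

(* Below, \sum_(xi \in setT) is the sum over the (finite) support: the summand
   vanishes for all but finitely many xi when v is in U_0. *)

Definition Vdef (R : realType) (n m : nat) (Dy : 'M[R]_(n, m))
    (Vhat_xi Vhat : 'M[R]_(n, m) -> R) : 'M[R]_(n, m) -> R :=
  fun g => Vhat_xi (Dy + g) - Vhat Dy.

Definition Vhom (R : realType) (n m : nat) (Dy : 'M[R]_(n, m))
    (Vhat : 'M[R]_(n, m) -> R) : 'M[R]_(n, m) -> R :=
  Vdef Dy Vhat Vhat.

(* <delta E(u), v> for the energy with site potentials W_ xi *)
Definition first_variation (R : realType) (d n N m : nat) (rng : 'I_m -> triple d N)
    (W_ : Zsite d -> 'M[R]_(n, m) -> R) (u v : displacement R d n N) : R :=
  \sum_(xi \in [set: Zsite d]) \sum_(i < m)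
    edot (partial_grad (W_ xi) i (Dstencil rng u xi)) (Dtriple (rng i) v xi).

(* <delta^2 E(0) u, v> for the energy with the same site potential W everywhere *)
Definition second_variation0 (R : realType) (d n N m : nat) (rng : 'I_m -> triple d N)
    (W : 'M[R]_(n, m) -> R) (u v : displacement R d n N) : R :=
  \sum_(xi \in [set: Zsite d])
    'D_(Dstencil rng u xi) (fun g => 'D_(Dstencil rng v xi) W g) 0.

(* Main.v *)
Require Import Defs.
From mathcomp Require Import all_boot all_order all_algebra.
From mathcomp Require Import finmap.
From mathcomp Require Import all_classical all_reals all_analysis.
From mathcomp Require Import zify ring lra.

(** The far field solves a perturbed linear problem: writing A for the Hessian
    of the potential at the reference state, u satisfies
    sum A(Du, Dv) = sum g . Dv with |g| <= C |Du|^2 away from the defect, so g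
    is summable.  No Fourier analysis is needed for the linear theory.  The
    Caccioppoli inequality applied to repeated differences of a discrete
    harmonic displacement, together with a discrete Sobolev inequality, gives
    |D^j Dw(x)| <= C t^(-j-d/2) ||Dw||_2 when w is harmonic on a ball of radius
    of order t about x.  By duality the same estimate bounds the response to a
    point load at 0 by ||Dw||_2 <= C t^(-d/2) on balls at distance of order t,
    hence |D^j Dw(x)| <= C (1 + |x|)^(-d-j) for this response.  Superposition
    gives |D^j Du(xi)| <= C sum_x |g(x)| (1 + |x - xi|)^(-d-j); for j = 0 the
    smallness of the tail of Du in l^2 turns this into |Du| <= C |xi|^(-d), and
    then |g| <= C |xi|^(-2d) gives the decay for j <= d.  Since Du contains the
    differences of u_0 and the shifts u_alpha - u_0, this is the claim.

    Solutions are replaced by finitely supported displacements that solve the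
    equation up to an error [E] in the squared dual norm, obtained by
    minimising the energy; [E] tends to 0 at the end of each estimate.  This
    avoids completing the space, and every test function is admissible in the
    hypotheses. *)

Set Implicit Arguments.
Unset Strict Implicit.
Unset Printing Implicit Defensive.

Import Order.TTheory GRing.Theory Num.Theory.
Import numFieldNormedType.Exports.

Local Open Scope classical_set_scope.
Local Open Scope ring_scope.

(** * Finite sums and lattice balls *)

Section FiniteSums.
Variable R : realType.

(** Coercivity is known only for the form summed over the lattice, not site by site, so local
    estimates test with a finitely supported cutoff of the displacement. No Poincare inequality on
    balls appears: the zero-order term produced by a cutoff is taken for a displacement already
    differenced once, and such a difference is bounded by the stencil nearby. Each difference gains
    a factor 1/t. The Sobolev inequality consumes up to d further differences, so orders up to 2d
    occur. The obstacle is that the kernel (1 + |x|)^(-d) just fails to be summable, while g is at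
    first merely summable. The square of the kernel is summable, and |g| <= C |Du| |Du| leaves one
    factor |Du| to pair with the kernel by Cauchy-Schwarz. The radius beyond which this contracts
    depends on the tail of u, one reason why the final constant depends on u. The error E enters the
    interior estimate multiplied by t^(d+2), so it has to go to 0 while t is fixed. Most
    inequalities are kept in squared form, in which dual norms and energies are polynomial. *)

Lemma sum_le_sub (T : eqType) (s s' : seq T) (F : T -> R) :
  uniq s -> {subset s <= s'} -> (forall x, 0 <= F x) ->
  \sum_(x <- s) F x <= \sum_(x <- s') F x.
Proof.
move=> us ss F0; rewrite [leRHS](bigID (mem s)) /= -[leLHS]addr0.
apply: lerD; last exact: sumr_ge0.
elim: s us ss => [|x s IH] /=; first by move=> _ _; rewrite big_nil sumr_ge0.
move=> /andP[xs us] ss.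
have xs' : x \in s' by apply: ss; rewrite mem_head.
have ss' : {subset s <= s'} by move=> y ys; apply: ss; rewrite inE ys orbT.
rewrite big_cons.
have -> : \sum_(i <- s' | i \in x :: s) F i =
    \sum_(i <- s' | i == x) F i + \sum_(i <- s' | i \in s) F i.
  rewrite -big_filter -(big_filter _ (pred1 x)) -(big_filter _ (mem s)) -big_cat.
  apply: perm_big; rewrite perm_sym; apply/permP => P; rewrite count_cat.
  elim: s' {IH ss xs' ss'} => //= y s' IH'; rewrite inE.
  by case: eqP => [->|] /=; [rewrite (negbTE xs) /= -IH' addnA
    | case: (y \in s) => //= _; rewrite -IH' addnCA].
apply: lerD; last exact: IH.
rewrite -big_filter (perm_big (x :: rem x [seq i <- s' | i == x])); last first.
  by apply: perm_to_rem; rewrite mem_filter eqxx.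
by rewrite big_cons lerDl sumr_ge0.
Qed.

Lemma sum_sub_eq (T : eqType) (s s' : seq T) (F : T -> R) :
  uniq s -> uniq s' -> {subset s <= s'} -> (forall x, x \notin s -> F x = 0) ->
  \sum_(x <- s) F x = \sum_(x <- s') F x.
Proof.
move=> us us' ss F0; rewrite [RHS](bigID (mem s)) /= [X in _ = _ + X]big1 ?addr0 //.
rewrite -[RHS]big_filter; apply: perm_big; apply: uniq_perm => //.
  exact: filter_uniq.
by move=> x; rewrite mem_filter; case: (boolP (x \in s)) => //= /ss ->.
Qed.

Lemma ler_of_sqr (p q : R) : 0 <= q -> p ^+ 2 <= q ^+ 2 -> p <= q.
Proof. by move=> q0 pq; rewrite leNgt; apply/negP => qp; nra. Qed.

Lemma cauchy_schwarz_sum (T : Type) (s : seq T) (f g : T -> R) :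
  (\sum_(x <- s) f x * g x) ^+ 2 <= (\sum_(x <- s) f x ^+ 2) * \sum_(x <- s) g x ^+ 2.
Proof.
elim: s => [|x s IH]; first by rewrite !big_nil expr0n mul0r.
rewrite !big_cons.
have A0 : 0 <= \sum_(j <- s) f j ^+ 2 by apply: sumr_ge0 => i _; exact: sqr_ge0.
have B0 : 0 <= \sum_(j <- s) g j ^+ 2 by apply: sumr_ge0 => i _; exact: sqr_ge0.
move: A0 B0 IH; move: (\sum_(j <- s) f j ^+ 2) (\sum_(j <- s) g j ^+ 2)
  (\sum_(j <- s) f j * g j) (f x) (g x) => A B a u v A0 B0 IH.
(* The cross term is bounded by the arithmetic-geometric mean: the induction hypothesis gives
   [(a u v)^2 <= (A v^2) (B u^2)]. *)
suff : 2 * (a * (u * v)) <= A * v ^+ 2 + B * u ^+ 2 by nra.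
apply: ler_of_sqr; first by apply: addr_ge0; apply: mulr_ge0 => //; exact: sqr_ge0.
have h : a ^+ 2 * (u * v) ^+ 2 <= A * B * (u * v) ^+ 2 by rewrite ler_wpM2r ?sqr_ge0.
have := sqr_ge0 (A * v ^+ 2 - B * u ^+ 2).
nra.
Qed.

Lemma sqr_sum_le (T : Type) (s : seq T) (f : T -> R) :
  (\sum_(x <- s) f x) ^+ 2 <= (size s)%:R * \sum_(x <- s) f x ^+ 2.
Proof.
have := cauchy_schwarz_sum s (fun=> 1) f.
under eq_bigr do rewrite mul1r.
move=> /le_trans; apply; rewrite ler_wpM2r //; first by apply: sumr_ge0 => i _; exact: sqr_ge0.
by under eq_bigr do rewrite expr1n; rewrite big_const_seq count_predT iter_addr_0.
Qed.

(** Takes a maximum over a finite list; it serves to choose one constant for all offsets of bounded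
    length and for all orders of differences up to 2d. *)
Lemma uniform_bound (T : eqType) (s : seq T) (P : T -> R -> Prop) :
  (forall x C C', P x C -> C <= C' -> P x C') ->
  (forall x, x \in s -> exists C, P x C) ->
  exists2 C, 0 < C & forall x, x \in s -> P x C.
Proof.
move=> mono; elim: s => [|x s IH] h; first by exists 1.
have [] := IH; first by move=> y ys; apply: h; rewrite inE ys orbT.
move=> C C0 hC; have [C' hC'] := h x (mem_head _ _).
exists (Num.max C C') => [|y]; first by rewrite lt_max C0.
rewrite inE => /orP[/eqP->|ys]; first by apply: mono hC' _; rewrite le_max lexx orbT.
by apply: mono (hC y ys) _; rewrite le_max lexx.
Qed.

End FiniteSums.

Section Lattice.
Variables (R : realType) (d : nat).
Implicit Types (x y c a : Zsite d) (r : nat).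

(** The sup norm of the integer coordinates has boxes as balls and natural numbers as radii. It is
    compared with the Euclidean length of the site only at the end. *)
Definition nrm x : nat := \max_(i < d) `|x i 0%R|%N.

Lemma nrm_leP x r : reflect (forall i, (`|x i 0%R| <= r)%N) (nrm x <= r)%N.
Proof.
apply: (iffP (bigmax_leqP _ _ _)) => h i; first exact: h.
by move=> _; exact: h.
Qed.

Lemma absz_le_nrm x i : (`|x i 0%R| <= nrm x)%N.
Proof. by move: i; apply/nrm_leP. Qed.

Lemma nrm0 : nrm 0 = 0%N.
Proof. by apply/eqP; rewrite -leqn0; apply/nrm_leP => i; rewrite mxE. Qed.

Lemma nrmD x y : (nrm (x + y) <= nrm x + nrm y)%N.
Proof.
apply/nrm_leP => i; rewrite mxE.
apply: leq_trans (leq_add (absz_le_nrm x i) (absz_le_nrm y i)).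
by move: (x i 0) (y i 0) => a b; lia.
Qed.

Lemma nrmN x : nrm (- x) = nrm x.
Proof.
suff h y : (nrm (- y) <= nrm y)%N by apply/eqP; rewrite eqn_leq h -{1}(opprK x) h.
by apply/nrm_leP => i; rewrite mxE abszN absz_le_nrm.
Qed.

Lemma nrmBC x y : nrm (x - y) = nrm (y - x).
Proof. by rewrite -nrmN opprB. Qed.

Lemma nrm_sub_leD x y c : (nrm (x - c) <= nrm (x - y) + nrm (y - c))%N.
Proof. by rewrite -{1}(subrK y x) -addrA nrmD. Qed.

Lemma nrm_leB x c : (nrm x <= nrm (x - c) + nrm c)%N.
Proof. by rewrite -{1}(subrK c x) nrmD. Qed.

Lemma nrm_le_shift x a c : (nrm (x - c) <= nrm (x + a - c) + nrm a)%N.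
Proof. by rewrite -{1}(addrK a x) addrAC -(nrmN a) nrmD. Qed.

Lemma nrm_shift_le x a c : (nrm (x + a - c) <= nrm (x - c) + nrm a)%N.
Proof. by rewrite addrAC nrmD. Qed.

Lemma nrm_leD x a : (nrm x <= nrm (x + a) + nrm a)%N.
Proof. by have := nrm_le_shift x a 0; rewrite !subr0. Qed.

(** Enumerating a box by functions on the coordinates lets a sum of products of one-coordinate
    factors become a product of one-dimensional sums. *)
Definition ball_pt c r (f : {ffun 'I_d -> 'I_(r + r).+1}) : Zsite d :=
  c + \col_i ((f i)%:Z - r%:Z).

Definition zball c r : seq (Zsite d) := [seq ball_pt c f | f <- enum {ffun 'I_d -> 'I_(r + r).+1}].

Lemma ball_pt_inj c r : injective (@ball_pt c r).
Proof.
move=> f g /addrI /matrixP h; apply/ffunP => i; apply: val_inj.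
have := h i 0; rewrite !mxE; move: (f i) (g i) => a b /= e.
suff : (a%:Z = b%:Z) by case.
by move: e; move: (a%:Z) (b%:Z) (r%:Z) => u v w; lia.
Qed.

Lemma zball_uniq c r : uniq (zball c r).
Proof. by rewrite map_inj_uniq ?enum_uniq //; exact: ball_pt_inj. Qed.

Lemma mem_zball c r x : (x \in zball c r) = (nrm (x - c) <= r)%N.
Proof.
apply/mapP/idP => [[f _ ->]|/nrm_leP h].
  apply/nrm_leP => i; rewrite /ball_pt addrAC subrr add0r mxE.
  by have := ltn_ord (f i); move: (f i : nat) => k; lia.
pose f := [ffun i : 'I_d => inord (absz ((x - c) i 0 + r%:Z)) : 'I_(r + r).+1].
exists f; first by rewrite mem_enum.
apply/matrixP => i j; rewrite ord1 !mxE ffunE.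
have := h i; rewrite !mxE; move: (x i 0) (c i 0) => a b hab.
by rewrite inordK; lia.
Qed.

Lemma mem_zball_self c r : c \in zball c r.
Proof. by rewrite mem_zball subrr nrm0. Qed.

Lemma sum_zball_sub (c c' : Zsite d) r r' (F : Zsite d -> R) : (forall x, 0 <= F x) ->
  (nrm (c - c') + r <= r')%N ->
  \sum_(x <- zball c r) F x <= \sum_(x <- zball c' r') F x.
Proof.
move=> F0 h; apply: sum_le_sub => //; first exact: zball_uniq.
by move=> x; rewrite !mem_zball; have := nrm_sub_leD x c c'; lia.
Qed.

Lemma sum_zball_shift c a r q (F : Zsite d -> R) : (forall x, 0 <= F x) ->
  (nrm a <= q)%N ->
  \sum_(x <- zball c r) F (x + a) <= \sum_(x <- zball c (r + q)) F x.
Proof.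
move=> F0 h; rewrite -(big_map (fun x => x + a) predT F); apply: sum_le_sub => //.
  by rewrite map_inj_uniq ?zball_uniq //; exact: addIr.
move=> _ /mapP[x + ->]; rewrite !mem_zball addrAC => hx.
by apply: leq_trans (nrmD _ _) _; exact: leq_add.
Qed.

(** The value is 0 by convention when the support is infinite, so linearity and monotonicity carry
    hypotheses [fsupp]. *)
Definition tot (f : Zsite d -> R) : R := \sum_(x \in [set: Zsite d]) f x.

Definition fsupp (f : Zsite d -> R) := exists r, forall x, (r < nrm x)%N -> f x = 0.

Lemma tot_seq (s : seq (Zsite d)) (f : Zsite d -> R) : uniq s ->
  (forall x, x \notin s -> f x = 0) -> tot f = \sum_(x <- s) f x.
Proof.
move=> us f0; rewrite (fsbig_seq _ _ us) /tot; apply/esym/fsbig_widen => //.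
by move=> x [_ /= /negP]; exact: f0.
Qed.

Lemma totE r (f : Zsite d -> R) : (forall x, (r < nrm x)%N -> f x = 0) ->
  tot f = \sum_(x <- zball 0 r) f x.
Proof.
move=> f0; apply: tot_seq; first exact: zball_uniq.
by move=> x; rewrite mem_zball subr0 -ltnNge; exact: f0.
Qed.

Lemma totD f g : fsupp f -> fsupp g -> tot (fun x => f x + g x) = tot f + tot g.
Proof.
move=> [r hr] [r' hr']; rewrite !(@totE (maxn r r')) ?big_split //.
- by move=> x; rewrite gtn_max => /andP[_ /hr'].
- by move=> x; rewrite gtn_max => /andP[/hr].
- by move=> x; rewrite gtn_max => /andP[/hr -> /hr' ->]; rewrite addr0.
Qed.

Lemma totZ k f : fsupp f -> tot (fun x => k * f x) = k * tot f.
Proof.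
move=> [r hr]; rewrite !(@totE r) ?mulr_sumr //.
by move=> x /hr ->; rewrite mulr0.
Qed.

Lemma tot_le f g : fsupp f -> fsupp g -> (forall x, f x <= g x) -> tot f <= tot g.
Proof.
move=> [r hr] [r' hr'] fg; rewrite !(@totE (maxn r r')) ?ler_sum //.
- by move=> x; rewrite gtn_max => /andP[_ /hr'].
- by move=> x; rewrite gtn_max => /andP[/hr].
Qed.

Lemma tot_ge0 f : (forall x, 0 <= f x) -> 0 <= tot f.
Proof. by move=> f0; apply: fsumr_ge0 => x _. Qed.

Lemma sum_le_tot (s : seq (Zsite d)) f : uniq s -> fsupp f -> (forall x, 0 <= f x) ->
  \sum_(x <- s) f x <= tot f.
Proof.
move=> us [r hr] f0; rewrite (@tot_seq (undup (s ++ zball 0 r))) ?undup_uniq //.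
  by apply: sum_le_sub => // x xs; rewrite mem_undup mem_cat xs.
move=> x; rewrite mem_undup mem_cat negb_or mem_zball subr0 -ltnNge => /andP[_].
exact: hr.
Qed.

Lemma tot_shift a f : tot (fun x => f (x + a)) = tot f.
Proof.
rewrite /tot [RHS](reindex_fsbigT (fun x => x + a)) //.
by exists (fun x => x - a) => x; rewrite ?addrK ?subrK.
Qed.

End Lattice.

(** * Frobenius product and norm *)

Section MatrixNorm.
Variables (R : realType) (p q : nat).
Implicit Types x y z : 'M[R]_(p, q).

Definition mdot x y : R := \sum_(e : 'I_p * 'I_q) x e.1 e.2 * y e.1 e.2.
Definition nsq x : R := \sum_(e : 'I_p * 'I_q) x e.1 e.2 ^+ 2.

Lemma nsq_ge0 x : 0 <= nsq x.
Proof. by apply: sumr_ge0 => e _; exact: sqr_ge0. Qed.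

Lemma nsq0 : nsq 0 = 0.
Proof. by rewrite /nsq big1 // => e _; rewrite mxE expr0n. Qed.

Lemma nsqN x : nsq (- x) = nsq x.
Proof. by apply: eq_bigr => e _; rewrite mxE sqrrN. Qed.

Lemma nsqZ k x : nsq (k *: x) = k ^+ 2 * nsq x.
Proof. by rewrite /nsq mulr_sumr; apply: eq_bigr => e _; rewrite mxE exprMn. Qed.

Lemma nsqD x y : nsq (x + y) <= 2 * nsq x + 2 * nsq y.
Proof.
rewrite /nsq !mulr_sumr -big_split /=; apply: ler_sum => e _; rewrite mxE.
by have := sqr_ge0 (x e.1 e.2 - y e.1 e.2); nra.
Qed.

Lemma nsqB x y : nsq (x - y) <= 2 * nsq x + 2 * nsq y.
Proof. by rewrite -(nsqN y) nsqD. Qed.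

Lemma sqr_entry_le x k i : x k i ^+ 2 <= nsq x.
Proof.
rewrite /nsq (bigD1 (k, i)) //= lerDl; apply: sumr_ge0 => e _; exact: sqr_ge0.
Qed.

Lemma mdotC x y : mdot x y = mdot y x.
Proof. by apply: eq_bigr => e _; rewrite mulrC. Qed.

Lemma mdotDr x y z : mdot x (y + z) = mdot x y + mdot x z.
Proof. by rewrite /mdot -big_split /=; apply: eq_bigr => e _; rewrite mxE mulrDr. Qed.

Lemma mdotZr k x y : mdot x (k *: y) = k * mdot x y.
Proof. by rewrite /mdot mulr_sumr; apply: eq_bigr => e _; rewrite mxE mulrCA. Qed.

Lemma mdot0r x : mdot x 0 = 0.
Proof. by rewrite -(scale0r 0) mdotZr mul0r. Qed.

Lemma mdotxx x : mdot x x = nsq x.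
Proof. by apply: eq_bigr => e _; rewrite expr2. Qed.

Lemma mdot_sqr_le x y : mdot x y ^+ 2 <= nsq x * nsq y.
Proof. exact: cauchy_schwarz_sum. Qed.

Lemma mdot_le x y : `|mdot x y| <= Num.sqrt (nsq x) * Num.sqrt (nsq y).
Proof.
rewrite -sqrtrM ?nsq_ge0 // -sqrtr_sqr ler_sqrt ?mdot_sqr_le //.
by rewrite mulr_ge0 ?nsq_ge0.
Qed.

End MatrixNorm.

(** * Differences of lattice functions *)

Section Differences.
Variables (d : nat).

(** The values lie in an arbitrary additive group, so that the same operator acts on displacements,
    on stencils and on single real entries. On column vectors it is convertible to [Dsite]. *)
Definition df (V : zmodType) (rho : Zsite d) (f : Zsite d -> V) : Zsite d -> V :=
  fun x => f (x + rho) - f x.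

Definition diffs (V : zmodType) (J : seq (Zsite d)) (f : Zsite d -> V) : Zsite d -> V :=
  foldr (@df V) f J.

Lemma dfC (V : zmodType) rho sigma (f : Zsite d -> V) :
  df rho (df sigma f) = df sigma (df rho f).
Proof.
apply/funext => x; rewrite /df (addrAC x sigma rho).
by rewrite !opprB addrACA [RHS]addrACA (addrC (- f (x + sigma))).
Qed.

Lemma diffs_df (V : zmodType) J rho (f : Zsite d -> V) : diffs J (df rho f) = df rho (diffs J f).
Proof. by elim: J => //= sigma J ->; rewrite dfC. Qed.

Lemma eq_diffs (V : zmodType) J (f g : Zsite d -> V) : f =1 g -> diffs J f = diffs J g.
Proof. by move=> /funext ->. Qed.

Lemma diffs_shift (V : zmodType) J (f : Zsite d -> V) a x :
  diffs J (fun y => f (y + a)) x = diffs J f (x + a).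
Proof. by elim: J x => //= rho J IH x; rewrite /df !IH addrAC. Qed.

Lemma diffs_morph (V W : zmodType) (h : V -> W) J (f : Zsite d -> V) x :
  {morph h : y z / y - z} -> diffs J (fun y => h (f y)) x = h (diffs J f x).
Proof. by move=> hB; elim: J x => //= rho J IH x; rewrite /df !IH hB. Qed.

Lemma diffs_cat (V : zmodType) J K (f : Zsite d -> V) : diffs (J ++ K) f = diffs J (diffs K f).
Proof. by rewrite /diffs foldr_cat. Qed.

End Differences.

(** * Stencils of displacements and their supports *)

Section Stencil.
Variables (R : realType) (d n N m : nat) (rng : 'I_m -> triple d N).
Let disp := displacement R d n N.
Implicit Types (u v w : disp) (x c : Zsite d) (r : nat).

Local Notation D := (@Dstencil R d n N m rng).

Lemma DtripleE (t : triple d N) u x : Dtriple t u x = u t.2 (x + t.1.1) - u t.1.2 x.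
Proof. by case: t => -[]. Qed.

Lemma DE u x k i : D u x k i = u (rng i).2 (x + (rng i).1.1) k 0 - u (rng i).1.2 x k 0.
Proof. by rewrite mxE DtripleE !mxE. Qed.

Definition axpy u (t : R) v : disp := fun alpha x => u alpha x + t *: v alpha x.
Definition trd a u : disp := fun alpha x => u alpha (x + a).
Definition dfd rho u : disp := fun alpha => df rho (u alpha).
Definition diffsd J u : disp := fun alpha => diffs J (u alpha).

Lemma D_axpy u t v x : D (axpy u t v) x = D u x + t *: D v x.
Proof. by apply/matrixP => k i; rewrite !mxE !DtripleE !mxE; ring. Qed.

Lemma D_trd a u x : D (trd a u) x = D u (x + a).
Proof. by apply/matrixP => k i; rewrite !DE /trd (addrAC x). Qed.

Lemma D_dfd rho u x : D (dfd rho u) x = df rho (D u) x.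
Proof.
apply/matrixP => k i; rewrite /df [RHS]mxE [X in _ + X]mxE !DE /dfd /df !mxE.
by rewrite (addrAC x rho); ring.
Qed.

Lemma D_diffsd J u x : D (diffsd J u) x = diffs J (D u) x.
Proof.
elim: J x => //= rho J IH x.
have -> : diffsd (rho :: J) u = dfd rho (diffsd J u) by [].
by rewrite D_dfd /df !IH.
Qed.

Lemma diffs_axpy J u t v x : diffs J (D (axpy u t v)) x = diffs J (D u) x + t *: diffs J (D v) x.
Proof.
elim: J x => [|rho J IH] x /=; first by rewrite D_axpy.
by rewrite /df !IH scalerBr opprD addrACA.
Qed.

Definition vsq v x : R := \sum_alpha nsq (v alpha x).

Lemma vsq_ge0 v x : 0 <= vsq v x.
Proof. by apply: sumr_ge0 => a _; exact: nsq_ge0. Qed.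

Lemma nsq_le_vsq v alpha x : nsq (v alpha x) <= vsq v x.
Proof. by rewrite /vsq (bigD1 alpha) //= lerDl sumr_ge0 // => a _; exact: nsq_ge0. Qed.

Definition supin c r v := forall alpha x, (r < nrm (x - c))%N -> v alpha x = 0.
(** This class is smaller than [in_U0], whose members may be a nonzero constant at infinity; all
    test functions below belong to it. *)
Definition fsd v := exists r, supin 0 r v.
Definition fsm (X : Zsite d -> 'M[R]_(n, m)) := exists r, forall x, (r < nrm x)%N -> X x = 0.

Lemma supin_fsd c r v : supin c r v -> fsd v.
Proof.
move=> h; exists (r + nrm c)%N => a x; rewrite subr0 => hx; apply: h.
by have := nrm_leB x c; lia.
Qed.

Lemma supin_le c c' r r' v : (nrm (c - c') + r <= r')%N -> supin c r v -> supin c' r' v.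
Proof. by move=> hr h a x hx; apply: h; have := nrm_sub_leD x c c'; lia. Qed.

Lemma fsd_axpy u t v : fsd u -> fsd v -> fsd (axpy u t v).
Proof.
move=> [r hr] [r' hr']; exists (maxn r r') => a x; rewrite gtn_max => /andP[h h'].
by rewrite /axpy hr // hr' // scaler0 addr0.
Qed.

Lemma supin_dfd c r rho v : supin c r v -> supin c (r + nrm rho) (dfd rho v).
Proof.
move=> h a x hx; rewrite /dfd /df !h ?subrr //; first by lia.
have := nrm_le_shift x rho c; lia.
Qed.

Lemma fsd_dfd rho v : fsd v -> fsd (dfd rho v).
Proof. by move=> [r h]; eexists; apply: (supin_dfd (rho := rho) h). Qed.

Lemma fsd_diffsd J v : fsd v -> fsd (diffsd J v).
Proof. by move=> h; elim: J => //= rho J /(fsd_dfd rho). Qed.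

Lemma fsd_trd a v : fsd v -> fsd (trd a v).
Proof.
move=> [r h]; exists (r + nrm a)%N => b x; rewrite subr0 => hx.
rewrite /trd h // subr0.
by have := nrm_leD x a; lia.
Qed.

Lemma fsm_fsupp X (f : 'M[R]_(n, m) -> Zsite d -> R) : (forall x, f 0 x = 0) ->
  fsm X -> fsupp (fun x => f (X x) x).
Proof. by move=> f0 [r h]; exists r => x /h ->. Qed.

Variable R0 : nat.
Hypothesis HR0 : forall i, (nrm (rng i).1.1 <= R0)%N.

Lemma D_supin c r v x : supin c r v -> (r + R0 < nrm (x - c))%N -> D v x = 0.
Proof.
move=> h hx; apply/matrixP => k i; rewrite DE [RHS]mxE !h ?mxE ?subrr //; first by lia.
have := nrm_le_shift x (rng i).1.1 c; have := HR0 i; lia.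
Qed.

Lemma fsd_fsm v : fsd v -> fsm (D v).
Proof.
move=> [r h]; exists (r + R0)%N => x hx; apply: (D_supin h); by rewrite subr0.
Qed.

Lemma nsq_D_le v x : nsq (D v x) <= 2 * \sum_(i < m) (vsq v (x + (rng i).1.1) + vsq v x).
Proof.
rewrite /nsq; rewrite -(pair_bigA _ (fun k i => D v x k i ^+ 2)) /=.
rewrite exchange_big mulr_sumr; apply: ler_sum => i _.
have h (a b : 'cV[R]_n) : \sum_k (a k 0 - b k 0) ^+ 2 <= 2 * (nsq a + nsq b).
  apply: le_trans (_ : nsq (a - b) <= _); last by rewrite mulrDr nsqB.
  rewrite /nsq -(pair_bigA _ (fun k j => (a - b) k j ^+ 2)) /=.
  by apply: ler_sum => k _; rewrite big_ord1 !mxE.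
under eq_bigr do rewrite DE.
apply: le_trans (h _ _) _; rewrite ler_pM2l // lerD //; exact: nsq_le_vsq.
Qed.

End Stencil.

(** The unit vectors generate the group, so a property closed under sums and opposites spreads from
    them to all offsets. *)
Lemma int_lattice_ind (d : nat) (P : Zsite d -> Prop) :
  (forall j, P (delta_mx j 0)) -> P 0 -> (forall x y, P x -> P y -> P (x + y)) ->
  (forall x, P x -> P (- x)) -> forall x, P x.
Proof.
move=> Pe P0 PD PN x.
have -> : x = \sum_j delta_mx j 0 *~ x j 0.
  apply/matrixP => i j; rewrite ord1 summxE (bigD1 i) //= big1 ?addr0 => [|k ki].
    have h (z : int) : ((delta_mx i 0 : Zsite d) *~ z) i 0 = z.
      rewrite -scaler_int !mxE !eqxx /= mulr1. rewrite intz //.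
    by rewrite h.
  by rewrite -scaler_int !mxE (eq_sym i) (negbTE ki) /= mulr0.
apply: (big_ind P) => // j _.
have Pn k : P (delta_mx j 0 *+ k) by elim: k => [|k IH]; rewrite ?mulr0n // mulrS; apply: PD.
case: (x j 0) => k; first by rewrite -pmulrn.
by rewrite NegzE mulrNz; apply: PN; rewrite -pmulrn.
Qed.

(** * Control of all differences by the stencil *)

Section PathControl.
Variables (R : realType) (d n N m : nat) (rng : 'I_m -> triple d N).
Hypothesis rng_basis : forall j : 'I_d, in_R1 rng (delta_mx j 0).
Hypothesis rng_species : forall a b : 'I_N.+1, a != b -> exists i, rng i = (0, a, b).

Let disp := displacement R d n N.
Local Notation D := (@Dstencil R d n N m rng).

Lemma nsq_Dtriple_le (w : disp) x i : nsq (Dtriple (rng i) w x) <= nsq (D w x).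
Proof.
rewrite /nsq -(pair_bigA _ (fun k j => Dtriple (rng i) w x k j ^+ 2)) /=.
rewrite -(pair_bigA _ (fun k j => D w x k j ^+ 2)) /=.
apply: ler_sum => k _; rewrite big_ord1 (bigD1 i) //= DtripleE DE !mxE lerDl.
by apply: sumr_ge0 => j _; exact: sqr_ge0.
Qed.

Lemma nsq_species_le (w : disp) x a b : nsq (w b x - w a x) <= nsq (D w x).
Proof.
have [->|ab] := eqVneq a b; first by rewrite subrr nsq0 nsq_ge0.
have [i hi] := rng_species ab.
by have := nsq_Dtriple_le w x i; rewrite hi DtripleE /= addr0.
Qed.

(** The range may contain a bond of offset [e_j] only between two other species [b] and [c]. The
    path changes from [a] to [b] at [x], follows this bond, and changes from [c] back to [a] at
    [x + e_j]. *)
Lemma nsq_basis_le (w : disp) x a j :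
  nsq (df (delta_mx j 0) (w a) x) <= 8 * nsq (D w x) + 2 * nsq (D w (x + delta_mx j 0)).
Proof.
have [b [c [i hi]]] := rng_basis j.
have := nsq_Dtriple_le w x i; rewrite hi DtripleE /df /=.
set e := delta_mx j 0; set X := D w x; set Y := D w (x + e) => h1.
have h2 := nsq_species_le w x a b; have h3 := nsq_species_le w (x + e) c a.
have -> : w a (x + e) - w a x =
    (w a (x + e) - w c (x + e)) + ((w c (x + e) - w b x) + (w b x - w a x)).
  by rewrite !subrKA.
apply: le_trans (nsqD _ _) _.
have := nsqD (w c (x + e) - w b x) (w b x - w a x).
rewrite -/X -/Y in h2 h3; lra.
Qed.

(* [C] is both the constant and a lower bound for the radius, which makes the
   predicate monotone in [C]. *)
Definition path_bound rho (C : R) := forall Q : nat, C <= Q%:R ->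
  forall (w : disp) x, vsq (dfd rho w) x <= C * \sum_(y <- zball x Q) nsq (D w y).

Lemma sum_nsqD_ge0 (w : disp) s : 0 <= \sum_(y <- s) nsq (D w y).
Proof. by apply: sumr_ge0 => y _; exact: nsq_ge0. Qed.

Lemma path_bound_mono rho C C' : path_bound rho C -> C <= C' -> path_bound rho C'.
Proof.
move=> h CC' Q hQ w x; apply: le_trans (h Q _ w x) _; first exact: le_trans hQ.
by rewrite ler_wpM2r // sum_nsqD_ge0.
Qed.

Lemma vsq_le_const (v : disp) x (B : R) : (forall a, nsq (v a x) <= B) -> vsq v x <= N.+1%:R * B.
Proof.
move=> h; apply: le_trans (ler_sum _ (fun a _ => h a)) _.
by rewrite sumr_const card_ord mulr_natl.
Qed.

(** Differences telescope along a lattice path. For [x + y] the difference in [x] is read at the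
    point moved by [y], so the ball has to grow by [nrm y]; this number is therefore added to the
    constant, which also bounds the radius from below. *)
Lemma exists_path_bound rho : exists C, path_bound rho C.
Proof.
suff [C _ h] : exists2 C, 0 <= C & path_bound rho C by exists C.
move: rho; apply: int_lattice_ind => [j||x y [C C0 hx] [C' C'0 hy]|x [C C0 hx]].
- exists (N.+1%:R * 10) => // Q hQ w x; rewrite -mulrA; apply: vsq_le_const => a.
  apply: le_trans (nsq_basis_le w x a j) _.
  set S := \sum_(y <- _) _.
  have inS y : y \in zball x Q -> nsq (D w y) <= S.
    move=> yQ; rewrite /S -(big_seq1 +%R y (fun y => nsq (D w y))).
    by apply: sum_le_sub => // [z|z]; [rewrite inE => /eqP-> | exact: nsq_ge0].
  have Q1 : (1 <= Q)%N.
    rewrite -(ler_nat R); apply: le_trans hQ; rewrite -natrM ler_nat; lia.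
  have h1 := inS _ (mem_zball_self x Q).
  have h2 : nsq (D w (x + delta_mx j 0)) <= S.
    apply: inS; rewrite mem_zball addrAC subrr add0r.
    apply: leq_trans Q1; apply/nrm_leP => i; rewrite mxE.
    by case: (_ && _).
  lra.
- exists 0 => // Q _ w x; rewrite mul0r.
  apply: le_trans (vsq_le_const (B := 0) _) _; last by rewrite mulr0.
  by move=> a; rewrite /dfd /df addr0 subrr nsq0.
- exists (2 * C + 2 * C' + (nrm y)%:R); first by rewrite !addr_ge0 // mulr_ge0.
  move=> Q hQ w z.
  have [Q' hQ'] : exists Q', (Q = Q' + nrm y)%N.
    exists (Q - nrm y)%N; rewrite subnK // -(ler_nat R).
    have := mulr_ge0 (ler0n R 2) C0; have := mulr_ge0 (ler0n R 2) C'0.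
    lra.
  move: hQ; rewrite hQ' natrD => hQ; have y0 := ler0n R (nrm y).
  have hC : C <= Q'%:R by lra.
  have hC' : C' <= Q'%:R by lra.
  have h1 := hx Q' hC w (z + y); have h2 := hy Q' hC' w z.
  have s1 : \sum_(t <- zball (z + y) Q') nsq (D w t) <= \sum_(t <- zball z (Q' + nrm y)) nsq (D w t).
    by apply: sum_zball_sub => [t|]; [exact: nsq_ge0 | rewrite addrAC subrr add0r addnC].
  have s2 : \sum_(t <- zball z Q') nsq (D w t) <= \sum_(t <- zball z (Q' + nrm y)) nsq (D w t).
    by apply: sum_zball_sub => [t|]; [exact: nsq_ge0 | rewrite subrr nrm0 leq_addr].
  set S := \sum_(t <- zball z (Q' + _)) _ in s1 s2 *.
  have S0 : 0 <= S by exact: sum_nsqD_ge0.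
  apply: le_trans (_ : 2 * vsq (dfd x w) (z + y) + 2 * vsq (dfd y w) z <= _).
    rewrite /vsq !mulr_sumr -big_split /=; apply: ler_sum => a _.
    apply: le_trans (nsqD _ _); rewrite /dfd /df.
    by rewrite (_ : _ + _ = w a (z + (x + y)) - w a z) // subrKA -addrA (addrC y x).
  have := ler_wpM2l C0 s1; have := ler_wpM2l C'0 s2.
  have := mulr_ge0 y0 S0.
  nra.
- exists (C + (nrm x)%:R); first by rewrite addr_ge0.
  move=> Q hQ w z.
  have [Q' hQ'] : exists Q', (Q = Q' + nrm x)%N.
    exists (Q - nrm x)%N; rewrite subnK // -(ler_nat R); lra.
  move: hQ; rewrite hQ' natrD => hQ; have y0 := ler0n R (nrm x).
  have hC : C <= Q'%:R by lra.
  have h1 := hx Q' hC w (z - x).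
  have s1 : \sum_(t <- zball (z - x) Q') nsq (D w t) <= \sum_(t <- zball z (Q' + nrm x)) nsq (D w t).
    by apply: sum_zball_sub => [t|]; [exact: nsq_ge0 | rewrite addrAC subrr add0r nrmN addnC].
  set S := \sum_(t <- zball z (Q' + _)) _ in s1 *.
  have S0 : 0 <= S by exact: sum_nsqD_ge0.
  have -> : vsq (dfd (- x) w) z = vsq (dfd x w) (z - x).
    apply: eq_bigr => a _; rewrite /dfd /df subrK -(nsqN (w a (z - x) - _)) opprB //.
  have := ler_wpM2l C0 s1; have := mulr_ge0 y0 S0.
  nra.
Qed.

(** This replaces a Poincare inequality: the zero-order term in the Caccioppoli inequality of a
    differenced displacement is bounded by stencils of the displacement itself, at a distance
    independent of the scale. *)
Lemma vsq_dfd_le R0 : exists2 C : R, 0 < C & exists Q : nat, forall rho (w : disp) x,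
  (nrm rho <= R0)%N -> vsq (dfd rho w) x <= C * \sum_(y <- zball x Q) nsq (D w y).
Proof.
have [||C C0 hC] := @uniform_bound R _ (zball 0 R0) path_bound.
- exact: path_bound_mono.
- by move=> rho _; exact: exists_path_bound.
exists C => //; exists (Num.truncn C).+1 => rho w x hrho.
apply: hC; first by rewrite mem_zball subr0.
by apply: ltW; exact: truncnS_gt.
Qed.

End PathControl.

(** * The energy form and approximate equilibria *)

Definition energy (R : realType) (d n N m : nat) (rng : 'I_m -> triple d N)
  (v : displacement R d n N) : R := tot (fun x => nsq (Dstencil rng v x)).

Definition load (R : realType) (d n N m : nat) (rng : 'I_m -> triple d N)
  (g : Zsite d -> 'M[R]_(n, m)) (v : displacement R d n N) : R :=
  tot (fun x => mdot (g x) (Dstencil rng v x)).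

Definition eform (R : realType) (d n N m : nat) (rng : 'I_m -> triple d N)
  (A : 'M[R]_(n, m) -> 'M[R]_(n, m) -> R) (u v : displacement R d n N) : R :=
  tot (fun x => A (Dstencil rng u x) (Dstencil rng v x)).

(** For nonnegative [f] this expresses that the sum over the lattice is at most [B], without forming
    an infinite sum. *)
Definition summable_by (R : realType) (d : nat) (f : Zsite d -> R) (B : R) :=
  forall s : seq (Zsite d), uniq s -> \sum_(x <- s) f x <= B.

Section EnergyForm.
Variables (R : realType) (d n N m : nat) (rng : 'I_m -> triple d N).
Variables (A : 'M[R]_(n, m) -> 'M[R]_(n, m) -> R) (K gamma : R) (R0 : nat).
Hypothesis HR0 : forall i, (nrm (rng i).1.1 <= R0)%N.
Hypothesis A_linear : forall x t y z, A (x + t *: y) z = A x z + t * A y z.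
Hypothesis A_sym : forall x y, A x y = A y x.
Hypothesis A_bound : forall x y, `|A x y| <= K * (nsq x + nsq y).
Hypothesis K_gt0 : 0 < K.

Let disp := displacement R d n N.
Local Notation D := (@Dstencil R d n N m rng).
Local Notation en := (@energy R d n N m rng).
Local Notation pr := (@load R d n N m rng).
Local Notation frm := (@eform R d n N m rng A).
Implicit Types (u v w psi : disp) (g : Zsite d -> 'M[R]_(n, m)).

Hypothesis gamma_gt0 : 0 < gamma.
Hypothesis coercive : forall v, fsd v -> gamma * en v <= frm v v.

Lemma A0l z : A 0 z = 0.
Proof. by have := A_linear 0 1 0 z; rewrite scale1r addr0 mul1r; lra. Qed.

Lemma A0r z : A z 0 = 0.
Proof. by rewrite A_sym A0l. Qed.

Lemma A_linear_r x y t z : A x (y + t *: z) = A x y + t * A x z.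
Proof. by rewrite A_sym A_linear ![A _ x]A_sym. Qed.

Lemma AZl t x y : A (t *: x) y = t * A x y.
Proof. by rewrite -[t *: x]add0r A_linear A0l add0r. Qed.

Lemma fsupp_en v : fsd v -> fsupp (fun x => nsq (D v x)).
Proof.
move=> /(fsd_fsm HR0); apply: (fsm_fsupp (f := fun X _ => nsq X)) => _.
exact: nsq0.
Qed.

Lemma fsupp_pr g v : fsd v -> fsupp (fun x => mdot (g x) (D v x)).
Proof.
move=> /(fsd_fsm HR0); apply: (fsm_fsupp (f := fun X x => mdot (g x) X)) => x.
exact: mdot0r.
Qed.

Lemma fsupp_frm u v : fsd v -> fsupp (fun x => A (D u x) (D v x)).
Proof.
move=> /(fsd_fsm HR0); apply: (fsm_fsupp (f := fun X x => A (D u x) X)) => x.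
exact: A0r.
Qed.

Lemma fsuppZ (f : Zsite d -> R) k : fsupp f -> fsupp (fun x => k * f x).
Proof. by move=> [r h]; exists r => x /h ->; rewrite mulr0. Qed.

Lemma fsuppD (f f' : Zsite d -> R) : fsupp f -> fsupp f' -> fsupp (fun x => f x + f' x).
Proof.
move=> [r h] [r' h']; exists (maxn r r') => x; rewrite gtn_max => /andP[hx hx'].
by rewrite h // h' // addr0.
Qed.

Lemma en_ge0 v : 0 <= en v.
Proof. by apply: tot_ge0 => x; exact: nsq_ge0. Qed.

Lemma frm_sym u v : frm u v = frm v u.
Proof. by apply: eq_fsbigr => x _; rewrite A_sym. Qed.

Lemma frm_axpyr u v t w : fsd v -> fsd w -> frm u (axpy v t w) = frm u v + t * frm u w.
Proof.
move=> hv hw; rewrite /eform -totZ; last exact: fsupp_frm.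
rewrite -totD; [|exact: fsupp_frm|exact/fsuppZ/fsupp_frm].
by apply: eq_fsbigr => x _; rewrite D_axpy A_linear_r.
Qed.

Lemma frm_axpyl u t u' v : fsd v -> frm (axpy u t u') v = frm u v + t * frm u' v.
Proof.
move=> hv; rewrite /eform -totZ; last exact: fsupp_frm.
rewrite -totD; [|exact: fsupp_frm|exact/fsuppZ/fsupp_frm].
by apply: eq_fsbigr => x _; rewrite D_axpy A_linear.
Qed.

Lemma pr_axpy g v t w : fsd v -> fsd w -> pr g (axpy v t w) = pr g v + t * pr g w.
Proof.
move=> hv hw; rewrite /load -totZ; last exact: fsupp_pr.
rewrite -totD; [|exact: fsupp_pr|exact/fsuppZ/fsupp_pr].
by apply: eq_fsbigr => x _; rewrite D_axpy mdotDr mdotZr.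
Qed.

Lemma en_axpy u t v : fsd u -> fsd v -> en (axpy u t v) <= 2 * en u + (2 * t ^+ 2) * en v.
Proof.
move=> hu hv; rewrite /energy -!totZ; try exact: fsupp_en.
rewrite -totD; try exact/fsuppZ/fsupp_en.
apply: tot_le; [exact/fsupp_en/fsd_axpy|apply: fsuppD; exact/fsuppZ/fsupp_en|] => x.
by rewrite D_axpy; apply: le_trans (nsqD _ _) _; rewrite nsqZ mulrA.
Qed.

Lemma en_trd a v : en (trd a v) = en v.
Proof.
rewrite /energy -[RHS](tot_shift a); apply: eq_fsbigr => x _; by rewrite D_trd.
Qed.

Lemma en_dfd rho v : fsd v -> en (dfd rho v) <= 4 * en v.
Proof.
move=> hv.
have -> : en (dfd rho v) = en (axpy (trd rho v) (-1) v).
  by apply: eq_fsbigr => x _; rewrite D_dfd D_axpy D_trd scaleN1r.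
by apply: le_trans (en_axpy _ _ _) _; rewrite ?en_trd //; [exact: fsd_trd|lra].
Qed.

Lemma en_diffsd J v : fsd v -> en (diffsd J v) <= 4 ^+ size J * en v.
Proof.
move=> hv; elim: J => [|rho J IH]; first by rewrite expr0 mul1r.
apply: le_trans (en_dfd rho (fsd_diffsd J hv)) _.
by rewrite exprS -mulrA ler_pM2l.
Qed.

Lemma frm_dfd rho u v : fsd v -> frm (dfd rho u) v = frm u (dfd (- rho) v).
Proof.
move=> hv.
have -> : frm u (dfd (- rho) v) = frm u (axpy (trd (- rho) v) (-1) v).
  by apply: eq_fsbigr => x _; rewrite D_dfd D_axpy D_trd scaleN1r.
have -> : frm (dfd rho u) v = frm (axpy (trd rho u) (-1) u) v.
  by apply: eq_fsbigr => x _; rewrite D_dfd D_axpy D_trd scaleN1r.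
rewrite frm_axpyl // frm_axpyr //; last exact: fsd_trd.
congr (_ + _); rewrite /eform -[RHS](tot_shift rho); apply: eq_fsbigr => x _.
by rewrite !D_trd addrK.
Qed.

Lemma frm_trd a u v : frm (trd a u) (trd a v) = frm u v.
Proof. by rewrite /eform -[RHS](tot_shift a); apply: eq_fsbigr => x _; rewrite !D_trd. Qed.

Lemma frm_le v : fsd v -> frm v v <= 2 * K * en v.
Proof.
move=> hv; rewrite /energy -totZ; last exact: fsupp_en.
apply: tot_le; [exact: fsupp_frm|exact/fsuppZ/fsupp_en|] => x.
by apply: le_trans (ler_norm _) (le_trans (A_bound _ _) _); lra.
Qed.

Lemma frm_ge0 v : fsd v -> 0 <= frm v v.
Proof. by move=> hv; apply: le_trans (coercive hv); rewrite mulr_ge0 ?en_ge0 // ltW. Qed.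

(** The squared form of the Lax-Milgram estimate: [(gamma * en v)^2 <= B * en v], and one factor
    [en v] cancels unless it is zero. *)
Lemma coercive_bound v B : fsd v -> 0 <= B -> frm v v ^+ 2 <= B * en v ->
  en v <= B / gamma ^+ 2.
Proof.
move=> hv B0 h; have e0 := en_ge0 v; have hc := coercive hv.
rewrite ler_pdivlMr ?exprn_gt0 //.
have h1 : (gamma * en v) ^+ 2 <= B * en v.
  apply: le_trans h; rewrite ler_sqr ?nnegrE ?frm_ge0 //.
  by rewrite mulr_ge0 // ltW.
have [->|] := eqVneq (en v) 0; first by rewrite mul0r.
move=> ne; have {}e0 : 0 < en v by rewrite lt_def ne.
rewrite -(ler_pM2r e0); apply: le_trans h1.
by rewrite exprMn expr2 expr2; lra.
Qed.

Lemma sum_mdot_sqr_le (s : seq (Zsite d)) (X Y : Zsite d -> 'M[R]_(n, m)) :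
  (\sum_(x <- s) mdot (X x) (Y x)) ^+ 2 <=
  (\sum_(x <- s) nsq (X x)) * \sum_(x <- s) nsq (Y x).
Proof.
have := cauchy_schwarz_sum s (fun x => Num.sqrt (nsq (X x))) (fun x => Num.sqrt (nsq (Y x))).
have e (p q : nat) (Z : Zsite d -> 'M[R]_(p, q)) : \sum_(x <- s) Num.sqrt (nsq (Z x)) ^+ 2 = \sum_(x <- s) nsq (Z x).
  by apply: eq_bigr => x _; rewrite sqr_sqrtr ?nsq_ge0.
rewrite !e.
apply: le_trans; rewrite -(real_normK (num_real (\sum_(x <- s) mdot _ _))) ler_sqr ?nnegrE //; last first.
  by apply: sumr_ge0 => x _; rewrite mulr_ge0 ?sqrtr_ge0.
apply: le_trans (ler_norm_sum _ _ _) _; apply: ler_sum => x _; exact: mdot_le.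
Qed.

Lemma pr_sqr_le g G v : summable_by (fun x => nsq (g x)) G -> fsd v ->
  pr g v ^+ 2 <= G * en v.
Proof.
move=> hg hv; have [r hr] := fsupp_en hv; have [r' hr'] := fsupp_pr g hv.
rewrite /load /energy !(@totE _ _ (maxn r r')); first last.
- by move=> x; rewrite gtn_max => /andP[hx hx']; first [exact: hr | exact: hr'].
- by move=> x; rewrite gtn_max => /andP[hx hx']; first [exact: hr | exact: hr'].
apply: le_trans (sum_mdot_sqr_le _ _ _) _; rewrite ler_wpM2r //.
  by apply: sumr_ge0 => x _; exact: nsq_ge0.
by apply: hg; exact: zball_uniq.
Qed.

Definition near_solution w g (E : R) :=
  forall psi, fsd psi -> (frm w psi - pr g psi) ^+ 2 <= E * en psi.

(** The ball contains the support of the test function; its stencil reaches [R0] further, whence the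
    margins [R0] in the radii below. *)
Definition harm w c r (E : R) :=
  forall psi, supin c r psi -> frm w psi ^+ 2 <= E * en psi.

(** An almost minimiser of [J] is almost critical: adding [t *: psi] lowers [J] by at most [del], so
    a quadratic polynomial in [t] is nonnegative and its discriminant bounds the residual. *)
Lemma exists_approx g G E : summable_by (fun x => nsq (g x)) G -> 0 < E ->
  exists2 w, fsd w & near_solution w g E.
Proof.
move=> hg E0.
have G0 : 0 <= G by have := hg [::] isT; rewrite big_nil.
pose J v := frm v v / 2 - pr g v.
pose S : set R := [set J v | v in [set v | fsd v]].
have J_ge v : fsd v -> - (G / (2 * gamma)) <= J v.
  move=> hv; have h1 := coercive hv; have h2 := pr_sqr_le hg hv; have e0 := en_ge0 v.
  suff : pr g v <= gamma * en v / 2 + G / (2 * gamma) by rewrite /J; lra.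
  have t0 : 0 <= G / (2 * gamma) by rewrite divr_ge0 // mulr_ge0 // ltW.
  have s0 : 0 <= gamma * en v / 2 by rewrite divr_ge0 // mulr_ge0 // ltW.
  apply: ler_of_sqr; first exact: addr_ge0.
  apply: le_trans h2 _.
  have -> : G * en v = 4 * (gamma * en v / 2) * (G / (2 * gamma)).
    by field; rewrite gt_eqF.
  by have := sqr_ge0 (gamma * en v / 2 - G / (2 * gamma)); nra.
pose z : disp := fun _ _ => 0.
have hz : fsd z by exists 0%N.
have hS : has_inf S.
  split; first by exists (J z); exists z.
  by exists (- (G / (2 * gamma))) => _ [v hv <-]; exact: J_ge.
(* The discriminant gives [2 * c * del], and [c <= 2 * K * en psi]; this choice turns the product
   into [E * en psi]. *)
pose del := E / (4 * K).
have del0 : 0 < del by rewrite divr_gt0 // mulr_gt0.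
have [_ [w hw <-] hJ] := inf_adherent del0 hS.
exists w => // psi hp.
set b := _ - _; set c := frm psi psi.
have c0 : 0 <= c by exact: frm_ge0.
have cK : c <= 2 * K * en psi by exact: frm_le.
have hq t : 0 <= t * b + t ^+ 2 / 2 * c + del.
  have hwt : fsd (axpy w t psi) by exact: fsd_axpy.
  have : inf S <= J (axpy w t psi) by apply: ge_inf; [exact: hS.2|exists (axpy w t psi)].
  rewrite /J frm_axpyr // frm_axpyl // frm_axpyl // pr_axpy // (frm_sym psi w) => h.
  have := lt_le_trans hJ (lerD h (lexx del)).
  by rewrite /J /b /c => h'; nra.
apply: le_trans (_ : 2 * c * del <= _); last first.
  have -> : E * en psi = 2 * (2 * K * en psi) * del.
    by rewrite /del; field; rewrite gt_eqF.
  by rewrite ler_pM2r // ler_pM2l.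
(* Without quadratic term the polynomial is affine, and an affine function bounded below has slope
   0. *)
have [c00|cn] := eqVneq c 0.
  rewrite c00 mulr0 mul0r; have [->|bn] := eqVneq b 0; first by rewrite expr0n.
  have := hq (- (del + 1) / b); rewrite c00 mulr0 addr0 divfK //; lra.
have {}c0 : 0 < c by rewrite lt_def cn.
have := hq (- b / c).
have -> : - b / c * b + (- b / c) ^+ 2 / 2 * c + del = (2 * c * del - b ^+ 2) / (2 * c).
  by field.
by rewrite pmulr_lge0 ?subr_ge0 // invr_gt0 mulr_gt0.
Qed.

Lemma approx_energy w g G E : summable_by (fun x => nsq (g x)) G -> 0 <= E ->
  fsd w -> near_solution w g E -> en w <= 2 * (G + E) / gamma ^+ 2.
Proof.
move=> hg E0 hw ha.
have G0 : 0 <= G by have := hg [::] isT; rewrite big_nil.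
apply: coercive_bound => //; first by rewrite mulr_ge0 // addr_ge0.
have h1 := ha w hw; have h2 := pr_sqr_le hg hw.
move: h1 h2; set p := pr g w; set f := frm w w => h1 h2.
have := sqr_ge0 (f - p - p); nra.
Qed.

Lemma approx_diff w w' g E E' : 0 <= E -> 0 <= E' -> fsd w -> fsd w' ->
  near_solution w g E -> near_solution w' g E' ->
  en (axpy w (-1) w') <= 2 * (E + E') / gamma ^+ 2.
Proof.
move=> E0 E'0 hw hw' ha ha'.
have hd := fsd_axpy (-1) hw hw'.
apply: coercive_bound => //; first by rewrite mulr_ge0 // addr_ge0.
have h1 := ha _ hd; have h2 := ha' _ hd.
rewrite frm_axpyl //; move: h1 h2.
set p := pr g _; set f := frm w _; set f' := frm w' _ => h1 h2.
have := sqr_ge0 ((f - p) + (f' - p)); nra.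
Qed.

(** The form has constant coefficients, so the difference moves to the test function with the offset
    reversed. This widens its support by [nrm rho] and multiplies its energy by at most 4. *)
Lemma harm_dfd rho w c r E : 0 <= E -> harm w c (r + nrm rho) E -> harm (dfd rho w) c r (4 * E).
Proof.
move=> E0 h psi hp; have hf := supin_fsd hp.
rewrite frm_dfd //; apply: le_trans (h _ _) _.
  by rewrite -nrmN; exact: supin_dfd.
by rewrite (mulrC 4) -mulrA ler_wpM2l // en_dfd.
Qed.

Lemma harm_sub w c r c' r' E : (nrm (c' - c) + r' <= r)%N -> harm w c r E -> harm w c' r' E.
Proof. by move=> hr h psi hp; apply: h; exact: supin_le hp. Qed.

Lemma harm_diffsd J w c r E : 0 <= E -> all (fun rho => nrm rho <= R0)%N J ->
  harm w c (r + size J * R0) E -> harm (diffsd J w) c r (4 ^+ size J * E).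
Proof.
move=> E0; elim: J r => [|rho J IH] r /=; first by rewrite mul0n addn0 expr0 mul1r.
move=> /andP[hr hJ] h; rewrite exprS -mulrA.
apply: harm_dfd; first by rewrite mulr_ge0 // exprn_ge0.
apply: IH => //; apply: harm_sub h.
by rewrite subrr nrm0 mulSn; lia.
Qed.

End EnergyForm.

(** * Interior regularity *)

Section Caccioppoli.
Variables (R : realType) (d n N m : nat) (rng : 'I_m -> triple d N).
Variables (A : 'M[R]_(n, m) -> 'M[R]_(n, m) -> R) (K gamma : R) (R0 : nat).
Hypothesis HR0 : forall i, (nrm (rng i).1.1 <= R0)%N.
Hypothesis A_linear : forall x t y z, A (x + t *: y) z = A x z + t * A y z.
Hypothesis A_sym : forall x y, A x y = A y x.
Hypothesis A_bound : forall x y, `|A x y| <= K * (nsq x + nsq y).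
Hypothesis K_gt0 : 0 < K.

Let disp := displacement R d n N.
Local Notation D := (@Dstencil R d n N m rng).
Local Notation en := (@energy R d n N m rng).
Local Notation frm := (@eform R d n N m rng A).
Implicit Types (u v w psi : disp) (x c rho : Zsite d).

Hypothesis gamma_gt0 : 0 < gamma.
Hypothesis coercive : forall v, fsd v -> gamma * en v <= frm v v.

(** A piecewise linear cutoff of slope [1 / t], equal to 1 where [nrm (x - c) + t <= s]; the
    truncated subtraction makes it vanish beyond radius [s]. *)
Definition cutoff (c : Zsite d) (s t : nat) (x : Zsite d) : R :=
  (minn t (s - nrm (x - c)))%:R / t%:R.

Definition mulv (chi : Zsite d -> R) v : disp := fun a x => chi x *: v a x.

Lemma cutoff_itv c s t x : (0 < t)%N -> 0 <= cutoff c s t x <= 1.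
Proof.
move=> t0; rewrite divr_ge0 ?ler0n //= ler_pdivrMr ?ltr0n // mul1r ler_nat.
exact: geq_minl.
Qed.

Lemma cutoff_eq1 c s t x : (0 < t)%N -> (nrm (x - c) + t <= s)%N -> cutoff c s t x = 1.
Proof.
move=> t0 h; rewrite /cutoff (minn_idPl _); last by lia.
by rewrite divff // pnatr_eq0 -lt0n.
Qed.

Lemma cutoff_eq0 c s t x : (s <= nrm (x - c))%N -> cutoff c s t x = 0.
Proof. by rewrite /cutoff -subn_eq0 => /eqP ->; rewrite minn0 mul0r. Qed.

Lemma cutoff_lip c s t x rho : (0 < t)%N -> (nrm rho <= R0)%N ->
  (cutoff c s t (x + rho) - cutoff c s t x) ^+ 2 <= (R0%:R / t%:R) ^+ 2.
Proof.
move=> t0 hr; rewrite -mulrBl !exprMn ler_wpM2r ?sqr_ge0 //.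
have h1 := nrm_le_shift x rho c; have h2 := nrm_shift_le x rho c.
have ha : (minn t (s - nrm (x + rho - c)) <= minn t (s - nrm (x - c)) + R0)%N.
  by move: (nrm (x - c)) (nrm (x + rho - c)) h1 h2 => p q *; lia.
have hb : (minn t (s - nrm (x - c)) <= minn t (s - nrm (x + rho - c)) + R0)%N.
  by move: (nrm (x - c)) (nrm (x + rho - c)) h1 h2 => p q *; lia.
move: ha hb; rewrite -!(ler_nat R) !natrD => ha hb; nra.
Qed.

Definition local_vsq v x : R := \sum_(i < m) (vsq v (x + (rng i).1.1) + vsq v x).

Lemma local_vsq_ge0 v x : 0 <= local_vsq v x.
Proof. by apply: sumr_ge0 => i _; rewrite addr_ge0 ?vsq_ge0. Qed.

Lemma sum_local_vsq v c r :
  \sum_(x <- zball c r) local_vsq v x <= 2 * m%:R * \sum_(x <- zball c (r + R0)) vsq v x.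
Proof.
rewrite /local_vsq exchange_big /=; set B := \sum_(x <- _) vsq v x.
apply: le_trans (_ : \sum_(i < m) (B + B) <= _).
  apply: ler_sum => i _; rewrite big_split /= lerD //.
    by apply: sum_zball_shift (HR0 i) => x; exact: vsq_ge0.
  by apply: sum_zball_sub; [move=> x; exact: vsq_ge0 | rewrite subrr nrm0; lia].
by rewrite sumr_const card_ord -mulr_natl; lra.
Qed.

Lemma nsq_columns_le (P : 'M[R]_(n, m)) v x (C : R) : 0 <= C ->
  (forall k i, P k i ^+ 2 <= C * v (rng i).2 (x + (rng i).1.1) k 0 ^+ 2) ->
  nsq P <= C * local_vsq v x.
Proof.
move=> C0 h; rewrite /nsq -(pair_bigA _ (fun k i => P k i ^+ 2)) /= exchange_big /=.
rewrite /local_vsq mulr_sumr; apply: ler_sum => i _.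
apply: le_trans (ler_sum _ (fun k _ => h k i)) _; rewrite -mulr_sumr ler_wpM2l //.
rewrite -[leLHS]addr0 lerD ?vsq_ge0 //; apply: le_trans (nsq_le_vsq v (rng i).2 _).
rewrite /nsq -(pair_bigA _ (fun k j => v (rng i).2 (x + (rng i).1.1) k j ^+ 2)) /=.
by apply: ler_sum => k _; rewrite big_ord1.
Qed.

Lemma vsq_mulv_le (chi : Zsite d -> R) v x : chi x ^+ 2 <= 1 -> vsq (mulv chi v) x <= vsq v x.
Proof.
move=> h; apply: ler_sum => a _; rewrite /mulv nsqZ.
by rewrite -[leRHS]mul1r ler_wpM2r // nsq_ge0.
Qed.

(* With X = Dv and chi0 = chi(x), the stencils of chi v and chi^2 v are
   chi0 X + P and chi0^2 X + 2 chi0 P + P', where P and P' carry one and two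
   differences of chi; so the two forms differ by A(P,P) - A(X,P'). *)
Lemma cutoff_form_le v c s t x : (0 < t)%N ->
  A (D (mulv (cutoff c s t) v) x) (D (mulv (cutoff c s t) v) x) <=
  A (D v x) (D (mulv (fun y => cutoff c s t y ^+ 2) v) x)
  + (t%:R^-1) ^+ 2 * (K * (2 * R0%:R ^+ 2 + 2 + R0%:R ^+ 4)) * local_vsq v x.
Proof.
move=> t0; set chi := cutoff c s t; set T : R := t%:R^-1; set W := local_vsq v x.
have W0 : 0 <= W := local_vsq_ge0 v x.
have T0 : 0 < T by rewrite invr_gt0 ltr0n.
pose X := D v x.
pose P := \matrix_(k < n, i < m)
  ((chi (x + (rng i).1.1) - chi x) * v (rng i).2 (x + (rng i).1.1) k 0).
(* The bound on [A] is a sum of squares, not a product of norms. The term with two differences of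
   the cutoff is therefore rescaled to size of order 1, so that [T ^+ 2] multiplies the whole bound
   on [A X P2]. *)
pose P2 := \matrix_(k < n, i < m)
  (T^-1 ^+ 2 * (chi (x + (rng i).1.1) - chi x) ^+ 2 * v (rng i).2 (x + (rng i).1.1) k 0).
have lip i : (chi (x + (rng i).1.1) - chi x) ^+ 2 <= (R0%:R * T) ^+ 2.
  exact: cutoff_lip.
have hP : nsq P <= (R0%:R * T) ^+ 2 * W.
  apply: nsq_columns_le; first exact: sqr_ge0.
  by move=> k i; rewrite mxE exprMn ler_wpM2r ?sqr_ge0.
have hP2 : nsq P2 <= R0%:R ^+ 4 * W.
  apply: nsq_columns_le; first by rewrite exprn_ge0.
  move=> k i; rewrite mxE exprMn ler_wpM2r ?sqr_ge0 //.
  have q0 : 0 <= T^-1 ^+ 2 * (chi (x + (rng i).1.1) - chi x) ^+ 2 by rewrite mulr_ge0 ?sqr_ge0.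
  have q1 : T^-1 ^+ 2 * (chi (x + (rng i).1.1) - chi x) ^+ 2 <= R0%:R ^+ 2.
    rewrite exprVn mulrC ler_pdivrMr ?exprn_gt0 // -exprMn; exact: lip.
  have -> : R0%:R ^+ 4 = (R0%:R ^+ 2) ^+ 2 :> R by rewrite -exprM.
  by rewrite lerXn2r // nnegrE exprn_ge0.
have hX : nsq X <= 2 * W by exact: nsq_D_le.
have e1 : D (mulv chi v) x = P + chi x *: X.
  by apply/matrixP => k i; rewrite DE !mxE DtripleE !mxE; ring.
have e2 : D (mulv (fun y => chi y ^+ 2) v) x = (T ^+ 2 *: P2 + (2 * chi x) *: P) + (chi x ^+ 2) *: X.
  apply/matrixP => k i; rewrite DE !mxE DtripleE !mxE.
  by field; rewrite gt_eqF.
have hlr := A_linear_r A_linear A_sym.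
rewrite e1 e2 !hlr A_linear A_linear (A_sym X P) (A_sym X (T ^+ 2 *: P2)) (AZl A_linear).
rewrite (A_sym P2 X).
have h1 : A P P <= K * (2 * R0%:R ^+ 2) * T ^+ 2 * W.
  apply: le_trans (ler_norm _) (le_trans (A_bound _ _) _).
  rewrite -!mulrA ler_pM2l //.
  by have := hP; rewrite exprMn; lra.
have h2 : - (T ^+ 2 * A X P2) <= T ^+ 2 * (K * (2 + R0%:R ^+ 4) * W).
  rewrite -mulrN ler_wpM2l ?sqr_ge0 //.
  apply: le_trans (_ : `|A X P2| <= _); first by rewrite -normrN ler_norm.
  apply: le_trans (A_bound _ _) _; rewrite -mulrA ler_pM2l //; lra.
nra.
Qed.

(** The equation is tested with [chi^2 v], while coercivity is applied to [chi v]. The two forms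
    differ by terms with two differences of the cutoff, which give the factor [t^-2]. *)
Lemma caccioppoli : exists2 C : R, 0 < C &
  forall v c r t E, (0 < t)%N -> 0 <= E -> harm rng A v c (r + R0 + t) E ->
  \sum_(x <- zball c r) nsq (D v x) <=
  C * (t%:R^-1 ^+ 2 * \sum_(x <- zball c (r + t + 3 * R0)) vsq v x + t%:R ^+ 2 * E).
Proof.
pose C1 := K * (2 * R0%:R ^+ 2 + 2 + R0%:R ^+ 4).
have C10 : 0 <= C1.
  by rewrite mulr_ge0 ?(ltW K_gt0) // !addr_ge0 // ?mulr_ge0 // exprn_ge0.
exists ((C1 * (2 * m%:R) + 1 + 4 * m%:R) / gamma).
  apply: divr_gt0 => //; have m0 : 0 <= m%:R :> R by exact: ler0n.
  by have := mulr_ge0 C10 m0; lra.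
move=> v c r t E t0 E0 hv.
(* The cutoff must equal 1 at every site that a stencil based in the ball of radius [r] can reach,
   which takes the additional [R0]. *)
set s := (r + R0 + t)%N in hv.
set chi := cutoff c s t; set V := \sum_(x <- zball c _) vsq v x.
have V0 : 0 <= V by apply: sumr_ge0 => x _; exact: vsq_ge0.
have T0 : 0 < t%:R :> R by rewrite ltr0n.
pose v1 := mulv chi v; pose v2 := mulv (fun y => chi y ^+ 2) v.
have chi01 x : 0 <= chi x <= 1 := cutoff_itv c s x t0.
have sup1 : supin c s v1.
  by move=> a x hx; rewrite /v1 /mulv /chi cutoff_eq0 ?scale0r // ltnW.
have sup2 : supin c s v2.
  by move=> a x hx; rewrite /v2 /mulv /chi cutoff_eq0 ?expr0n ?scale0r // ltnW.
have fs1 := supin_fsd sup1; have fs2 := supin_fsd sup2.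
have out1 x : x \notin zball c (s + R0) -> D v1 x = 0.
  by rewrite mem_zball -ltnNge; exact: D_supin.
have out2 x : x \notin zball c (s + R0) -> D v2 x = 0.
  by rewrite mem_zball -ltnNge; exact: D_supin.
have locW : \sum_(x <- zball c (s + R0)) local_vsq v x <= 2 * m%:R * V.
  by have := sum_local_vsq v c (s + R0); rewrite (_ : (s + R0 + R0 = r + t + 3 * R0)%N) // /s; clear; lia.
have hform : frm v1 v1 <= frm v v2 + t%:R^-1 ^+ 2 * (C1 * (2 * m%:R * V)).
  rewrite /eform (tot_seq (zball_uniq c (s + R0))); last first.
    by move=> x /out1 ->; rewrite (A0r A_linear A_sym).
  rewrite (tot_seq (zball_uniq c (s + R0))); last first.
    by move=> x /out2 ->; rewrite (A0r A_linear A_sym).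
  apply: le_trans (ler_sum _ (fun x _ => cutoff_form_le v c s x t0)) _.
  rewrite big_split /= lerD // -mulr_sumr -/C1.
  by rewrite [leRHS]mulrA ler_wpM2l // mulr_ge0 ?sqr_ge0.
have hen2 : en v2 <= 4 * m%:R * V.
  rewrite /energy (tot_seq (zball_uniq c (s + R0))); last by move=> x /out2 ->; rewrite nsq0.
  apply: le_trans (_ : 2 * \sum_(x <- zball c (s + R0)) local_vsq v x <= _); last lra.
  rewrite mulr_sumr; apply: ler_sum => x _; apply: le_trans (nsq_D_le _ _ _) _.
  rewrite ler_pM2l //; apply: ler_sum => i _.
  by rewrite lerD //; apply: vsq_mulv_le; rewrite -exprM; have /andP[h0 h1] := chi01 (x + (rng i).1.1);
    have /andP[h2 h3] := chi01 x; exact: exprn_ile1.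
have hres : frm v v2 <= t%:R^-1 ^+ 2 * V + 4 * m%:R * (t%:R ^+ 2 * E).
  have a0 : 0 <= t%:R^-1 ^+ 2 * V by rewrite mulr_ge0 ?sqr_ge0.
  have b0 : 0 <= 4 * m%:R * (t%:R ^+ 2 * E) by rewrite !mulr_ge0 // sqr_ge0.
  apply: ler_of_sqr; first exact: addr_ge0.
  apply: le_trans (hv _ sup2) _.
  apply: le_trans (ler_wpM2l E0 hen2) _.
  (* The residual is split by the arithmetic-geometric mean, with weights [t^-2] and [t^2] chosen to
     match the scaling of the zero-order term. *)
  have -> : E * (4 * m%:R * V) = (t%:R^-1 ^+ 2 * V) * (4 * m%:R * (t%:R ^+ 2 * E)).
    by field; rewrite gt_eqF.
  move: a0 b0; set p := t%:R^-1 ^+ 2 * V; set q := _ * (_ * E) => a0 b0; nra.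
have hleft : gamma * \sum_(x <- zball c r) nsq (D v x) <= frm v1 v1.
  apply: le_trans (coercive fs1); rewrite ler_pM2l //.
  have -> : \sum_(x <- zball c r) nsq (D v x) = \sum_(x <- zball c r) nsq (D v1 x).
    rewrite big_seq [RHS]big_seq; apply: eq_bigr => x; rewrite mem_zball => hx; congr nsq.
    apply/matrixP => k i; rewrite !DE /v1 /mulv /chi !cutoff_eq1 ?scale1r // /s; first by move: hx; clear; lia.
    by move: hx (nrm_shift_le x (rng i).1.1 c) (HR0 i); clear; lia.
  apply: sum_le_tot; [exact: zball_uniq|exact: (fsupp_en HR0)|by move=> x; exact: nsq_ge0].
rewrite mulrAC ler_pdivlMr // mulrC; apply: le_trans hleft (le_trans hform _).
have a0 : 0 <= t%:R^-1 ^+ 2 * V by rewrite mulr_ge0 ?sqr_ge0.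
have b0 : 0 <= t%:R ^+ 2 * E by rewrite mulr_ge0 ?sqr_ge0.
have m0 : 0 <= m%:R :> R by exact: ler0n.
have c0 : 0 <= C1 * (2 * m%:R) by apply: mulr_ge0 => //; apply: mulr_ge0.
move: hres; rewrite (_ : t%:R^-1 ^+ 2 * (C1 * (2 * m%:R * V)) = C1 * (2 * m%:R) * (t%:R^-1 ^+ 2 * V)); last by ring.
move: a0 b0 c0; move: (t%:R^-1 ^+ 2 * V) (t%:R ^+ 2 * E) (C1 * (2 * m%:R)) => p q e p0 q0 e0 hres.
have h1 := mulr_ge0 m0 p0; have h2 := mulr_ge0 e0 q0. lra.
Qed.

End Caccioppoli.

(** * A discrete Sobolev inequality on boxes *)

Section Sobolev.
Variables (R : realType) (d : nat).
Implicit Types (x c : Zsite d) (X : seq (Zsite d)).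

Definition evec (j : 'I_d) : Zsite d := delta_mx j 0.

(** The sites swept by [X] in [t] positions along direction [j]; sweeping a point in all directions
    produces a box of side [t]. *)
Definition extend (t : nat) (j : 'I_d) X : seq (Zsite d) :=
  [seq x + evec j *+ s | x <- X, s <- iota 0 t].

Definition extends (t : nat) (l : seq 'I_d) X : seq (Zsite d) := foldl (fun X j => extend t j X) X l.

(** The value at [x] is compared, by telescoping, with each of the [t] values on a segment starting
    at [x]; the squared comparisons are then averaged. *)
Lemma line_bound (f : Zsite d -> R) x j t : (0 < t)%N ->
  f x ^+ 2 <= 2 / t%:R * \sum_(s <- iota 0 t) f (x + evec j *+ s) ^+ 2
    + 2 * t%:R * \sum_(s <- iota 0 t) df (evec j) f (x + evec j *+ s) ^+ 2.
Proof.
move=> t0; have T0 : 0 < t%:R :> R by rewrite ltr0n.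
set S1 := \sum_(s <- _) _; set S2 := \sum_(s <- _) _.
have tele s : f (x + evec j *+ s) = f x + \sum_(r <- iota 0 s) df (evec j) f (x + evec j *+ r).
  elim: s => [|s IH]; first by rewrite big_nil mulr0n !addr0.
  rewrite -[in iota 0 _]addn1 iotaD big_cat big_seq1 /= addrA -IH /df add0n.
  by rewrite [RHS]addrC subrK mulrSr addrA.
have one s : (s < t)%N -> f x ^+ 2 <= 2 * f (x + evec j *+ s) ^+ 2 + 2 * t%:R * S2.
  move=> st; set G := \sum_(r <- iota 0 s) df (evec j) f (x + evec j *+ r).
  have hG : G ^+ 2 <= t%:R * S2.
    apply: le_trans (sqr_sum_le _ _) _; rewrite size_iota.
    have h0 (q : seq nat) : 0 <= \sum_(r <- q) df (evec j) f (x + evec j *+ r) ^+ 2.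
      by apply: sumr_ge0 => r _; exact: sqr_ge0.
    apply: le_trans (_ : t%:R * \sum_(r <- iota 0 s) df (evec j) f (x + evec j *+ r) ^+ 2 <= _).
      by rewrite ler_wpM2r // ler_nat ltnW.
    rewrite ler_pM2l //; apply: sum_le_sub; first exact: iota_uniq.
      by move=> r; rewrite !mem_iota !add0n /= => /ltn_trans; apply.
    by move=> r; exact: sqr_ge0.
  have := tele s; rewrite -/G; move: (f (x + _)) (f x) => p q e.
  have := sqr_ge0 (p + G); rewrite e; nra.
have : \sum_(s <- iota 0 t) f x ^+ 2 <= \sum_(s <- iota 0 t) (2 * f (x + evec j *+ s) ^+ 2 + 2 * t%:R * S2).
  rewrite big_seq [leRHS]big_seq; apply: ler_sum => s; rewrite mem_iota => /andP[_ hs].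
  by apply: one; rewrite add0n in hs.
have cst (k : R) : \sum_(s <- iota 0 t) k = t%:R * k.
  by rewrite big_const_seq count_predT size_iota iter_addr_0 mulr_natl.
rewrite big_split /= !cst -mulr_sumr -/S1 => h.
rewrite -(@ler_pM2l _ t%:R) //. apply: le_trans h _.
by rewrite le_eqVlt; apply/orP; left; apply/eqP; field; rewrite gt_eqF.
Qed.

(** Each direction replaces a sum of squares by a larger sum for [f] and one for its difference, the
    latter weighted by [t^2] relative to the former. Both contribute [2 / t], hence the factor
    [4 / t] per direction. *)
Lemma box_sobolev (t : nat) (l : seq 'I_d) : (0 < t)%N -> forall X (f : Zsite d -> R) B,
  (forall I : seq 'I_d, (size I <= size l)%N ->
     t%:R ^+ (2 * size I) * \sum_(y <- extends t l X) diffs [seq evec j | j <- I] f y ^+ 2 <= B) ->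
  \sum_(x <- X) f x ^+ 2 <= (4 / t%:R) ^+ size l * B.
Proof.
move=> t0; have T0 : 0 < t%:R :> R by rewrite ltr0n.
elim: l => [|j l IH] X f B h.
  by have := h [::] isT; rewrite /= muln0 !expr0 !mul1r.
have h1 := IH (extend t j X) f B (fun I hI => h I (leqW hI)).
have h2 : \sum_(x <- extend t j X) df (evec j) f x ^+ 2 <= (4 / t%:R) ^+ size l * (B / t%:R ^+ 2).
  apply: IH => I hI.
  have := h (rcons I j); rewrite size_rcons ltnS => /(_ hI).
  rewrite map_rcons -cats1 diffs_cat /= mulnS exprD -mulrA => hB.
  rewrite ler_pdivlMr ?exprn_gt0 // mulrC; exact: hB.
have step : \sum_(x <- X) f x ^+ 2 <= 2 / t%:R * \sum_(x <- extend t j X) f x ^+ 2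
     + 2 * t%:R * \sum_(x <- extend t j X) df (evec j) f x ^+ 2.
  rewrite /extend !big_allpairs_dep /= !mulr_sumr -big_split /=; apply: ler_sum => x _.
  exact: line_bound.
apply: le_trans step _; rewrite /= exprS.
set Q := (4 / t%:R) ^+ size l in h1 h2 *.
have g1 : 2 / t%:R * \sum_(x <- extend t j X) f x ^+ 2 <= 2 / t%:R * (Q * B).
  by rewrite ler_wpM2l // divr_ge0.
have g2 : 2 * t%:R * \sum_(x <- extend t j X) df (evec j) f x ^+ 2 <= 2 * t%:R * (Q * (B / t%:R ^+ 2)).
  by rewrite ler_wpM2l // mulr_ge0.
apply: le_trans (lerD g1 g2) _.
by rewrite le_eqVlt; apply/orP; left; apply/eqP; field; rewrite gt_eqF.
Qed.

Lemma extends_subset t l x c r X : (0 < t)%N -> {subset X <= zball c r} ->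
  {subset extends t l X <= zball c (r + size l * t)}.
Proof.
move=> t0; elim: l r X => [|j l IH] r X h; first by rewrite mul0n addn0.
rewrite mulSn addnA; apply: IH => y /allpairsP[[z s] /= [zX + ->]].
rewrite mem_iota add0n => /andP[_ hs]; rewrite mem_zball.
apply: leq_trans (nrm_shift_le _ _ _) _; apply: leq_add; first by have := h _ zX; rewrite mem_zball.
apply: leq_trans (ltnW hs); apply/nrm_leP => i; rewrite -scaler_nat !mxE.
by case: (_ && _); rewrite ?mulr1 ?mulr0 // natz.
Qed.

(** Sweeping in distinct directions meets each site once, as long as [X] has a single coordinate in
    every direction still to come. Hence a sum over the swept sites is at most the sum over a ball
    containing them. *)
Lemma extends_uniq t l X : uniq l -> uniq X ->
  (forall j, j \in l -> forall x y, x \in X -> y \in X -> x j 0 = y j 0) ->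
  uniq (extends t l X).
Proof.
have evecE (j i : 'I_d) s : (evec j *+ s) i 0 = if i == j then s%:Z else 0.
  rewrite -scaler_nat !mxE eqxx andbT; case: (i == j); rewrite ?mulr0 // mulr1 natz //.
elim: l X => [|j l IH] X //= /andP[jl ul] uX hX; apply: IH => //.
  apply: allpairs_uniq => //; first exact: iota_uniq.
  move=> _ _ /allpairsP[[x s] /= [xX _ ->]] /allpairsP[[y s'] /= [yX _ ->]] /= e.
  have ss : s = s'.
    have : (x + evec j *+ s) j 0 = (y + evec j *+ s') j 0 by rewrite e.
    rewrite !mxE !evecE eqxx (hX j (mem_head _ _) x y xX yX).
    by move=> /addrI [].
  by move: e; rewrite ss => /addIr ->.
move=> i il _ _ /allpairsP[[x s] /= [xX _ ->]] /allpairsP[[y s'] /= [yX _ ->]].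
have ij : i != j by apply: contraNneq jl => <-.
rewrite !mxE !evecE (negbTE ij) !addr0; apply: hX => //.
by rewrite inE il orbT.
Qed.

Lemma sobolev (f : Zsite d -> R) x t B : (0 < t)%N ->
  (forall I : seq 'I_d, (size I <= d)%N ->
     t%:R ^+ (2 * size I) * \sum_(y <- zball x (d * t)) diffs [seq evec j | j <- I] f y ^+ 2 <= B) ->
  f x ^+ 2 <= (4 / t%:R) ^+ d * B.
Proof.
move=> t0 h; have T0 : 0 < t%:R :> R by rewrite ltr0n.
have := @box_sobolev t (enum 'I_d) t0 [:: x] f B; rewrite big_seq1 size_enum_ord; apply.
move=> I hI; apply: le_trans (h I hI); rewrite ler_pM2l ?exprn_gt0 //.
apply: sum_le_sub; last by move=> y; exact: sqr_ge0.
  apply: extends_uniq => //; first exact: enum_uniq.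
  by move=> j _ y z; rewrite !inE => /eqP -> /eqP ->.
have := @extends_subset t (enum 'I_d) x x 0 [:: x] t0; rewrite size_enum_ord; apply.
by move=> y; rewrite inE => /eqP ->; exact: mem_zball_self.
Qed.

End Sobolev.

(** * Interior estimates for differences of all orders *)

Section InteriorEstimate.
Variables (R : realType) (d n N m : nat) (rng : 'I_m -> triple d N).
Variables (A : 'M[R]_(n, m) -> 'M[R]_(n, m) -> R) (K gamma : R) (R0 : nat).
Hypothesis HR0 : forall i, (nrm (rng i).1.1 <= R0)%N.
Hypothesis R0_gt0 : (0 < R0)%N.
Hypothesis rng_basis : forall j : 'I_d, in_R1 rng (delta_mx j 0).
Hypothesis rng_species : forall a b : 'I_N.+1, a != b -> exists i, rng i = (0, a, b).
Hypothesis A_linear : forall x t y z, A (x + t *: y) z = A x z + t * A y z.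
Hypothesis A_sym : forall x y, A x y = A y x.
Hypothesis A_bound : forall x y, `|A x y| <= K * (nsq x + nsq y).
Hypothesis K_gt0 : 0 < K.

Let disp := displacement R d n N.
Local Notation D := (@Dstencil R d n N m rng).
Local Notation en := (@energy R d n N m rng).
Local Notation frm := (@eform R d n N m rng A).
Local Notation harmonic := (@harm R d n N m rng A).
Implicit Types (u v w psi : disp) (x c rho : Zsite d) (J : seq (Zsite d)).

Hypothesis gamma_gt0 : 0 < gamma.
Hypothesis coercive : forall v, fsd v -> gamma * en v <= frm v v.

Definition short J := all (fun rho => nrm rho <= R0)%N J.

Lemma sum_sum_zball c r Q (F : Zsite d -> R) : (forall x, 0 <= F x) ->
  \sum_(x <- zball c r) \sum_(y <- zball x Q) F y <=
  (size (zball (0 : Zsite d) Q))%:R * \sum_(x <- zball c (r + Q)) F x.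
Proof.
move=> F0.
have e x : \sum_(y <- zball x Q) F y = \sum_(z <- zball 0 Q) F (x + z).
  by rewrite /zball !big_map; apply: eq_bigr => f _; rewrite /ball_pt add0r.
under eq_bigr do rewrite e.
rewrite exchange_big /=; set S := \sum_(x <- zball c (r + Q)) F x.
apply: le_trans (_ : \sum_(z <- zball (0 : Zsite d) Q) S <= _).
  rewrite big_seq [leRHS]big_seq; apply: ler_sum => z; rewrite mem_zball subr0 => hz.
  exact: sum_zball_shift.
by rewrite big_const_seq count_predT iter_addr_0 mulr_natl.
Qed.

(** One application of the Caccioppoli inequality gains [t^-2] and leaves the sum of squares of a
    difference, which [vsq_dfd_le] bounds by stencils with one difference fewer. The number [B]
    collects the margins that do not scale with [t]. *)
Lemma iterated_caccioppoli : exists B : nat, forall k, exists2 C : R, 0 < C &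
  forall J w c r t E, size J = k -> short J -> (0 < t)%N -> 0 <= E ->
  harmonic w c (r + k * (t + B)) E ->
  \sum_(x <- zball c r) nsq (diffs J (D w) x) <=
  C * (t%:R^-1 ^+ (2 * k) * \sum_(x <- zball c (r + k * (t + B))) nsq (D w x) + t%:R ^+ 2 * E).
Proof.
have [C1 C10 hC1] := caccioppoli HR0 A_linear A_sym A_bound K_gt0 gamma_gt0 coercive.
have [C2 C20 [Q hQ]] := vsq_dfd_le R n rng_basis rng_species R0.
pose B := (3 * R0 + Q)%N; exists B; elim => [|k [C C0 IH]].
  exists 1 => // -[|//] w c r t E _ _ t0 E0 _.
  by rewrite mul0n addn0 muln0 expr0 !mul1r lerDl mulr_ge0 ?sqr_ge0.
pose M : R := (size (zball (0 : Zsite d) Q))%:R.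
have M0 : 0 <= M by exact: ler0n.
exists (C1 * (C2 * (M * C) + 4 ^+ k.+1)).
  rewrite mulr_gt0 // ltr_wpDl ?exprn_gt0 //.
  by rewrite mulr_ge0 ?(ltW C20) // mulr_ge0 // ltW.
move=> [//|rho J] w c r t E [hJ] /= /andP[hrho sJ] t0 E0 hw.
have T0 : 0 < t%:R :> R by rewrite ltr0n.
have hv : harmonic (dfd rho (diffsd J w)) c (r + R0 + t) (4 ^+ k.+1 * E).
  have := @harm_diffsd _ _ _ _ _ _ _ _ _ _ HR0 A_linear A_sym K_gt0 gamma_gt0 (rho :: J) w c (r + R0 + t)%N E E0.
  rewrite /= hrho hJ; apply => //.
  apply: harm_sub hw; rewrite subrr nrm0 add0n !mulSn /B !mulnDr; clear; lia.
have E40 : 0 <= 4 ^+ k.+1 * E by rewrite mulr_ge0 // exprn_ge0.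
have := hC1 _ c r t _ t0 E40 hv.
set V := \sum_(x <- _) vsq _ x => hc.
have e x : nsq (D (dfd rho (diffsd J w)) x) = nsq (df rho (diffs J (D w)) x).
  exact: (congr1 (@nsq R n m) (D_diffsd rng (rho :: J) w x)).
rewrite (eq_bigr _ (fun x _ => e x)) in hc.
apply: le_trans hc _; rewrite -mulrA ler_pM2l //.
set r1 := (r + t + 3 * R0 + Q)%N.
have hV : V <= C2 * (M * \sum_(x <- zball c r1) nsq (D (diffsd J w) x)).
  apply: le_trans (ler_sum _ (fun x _ => hQ rho (diffsd J w) x hrho)) _.
  rewrite -mulr_sumr ler_pM2l //; apply: sum_sum_zball => x; exact: nsq_ge0.
rewrite (eq_bigr _ (fun x _ => congr1 (@nsq R n m) (D_diffsd rng J w x))) in hV.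
have er : (r1 + k * (t + B) = r + k.+1 * (t + B))%N by rewrite /r1 mulSn /B; clear; lia.
have hI : harmonic w c (r1 + k * (t + B)) E by rewrite er.
have := IH J w c r1 t E hJ sJ t0 E0 hI; rewrite er.
set S := \sum_(x <- zball c (r + _)) _ => hS.
have S0 : 0 <= S by apply: sumr_ge0 => x _; exact: nsq_ge0.
set T : R := t%:R in T0 hS *.
have T1 : 1 <= T by rewrite /T ler1n.
have hV2 : V <= C2 * (M * C) * (T^-1 ^+ (2 * k) * S + T ^+ 2 * E).
  by apply: le_trans hV _; rewrite -mulrA ler_pM2l // -mulrA ler_wpM2l.
have Ti0 : 0 <= T^-1 ^+ 2 by rewrite exprn_ge0 // invr_ge0 ltW.
have := ler_wpM2l Ti0 hV2.
have -> : T^-1 ^+ 2 * (C2 * (M * C) * (T^-1 ^+ (2 * k) * S + T ^+ 2 * E)) =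
   C2 * (M * C) * (T^-1 ^+ (2 * k.+1) * S + E).
  by rewrite mulnS exprD; field; rewrite gt_eqF // exprn_gt0.
have G0 : 0 <= C2 * (M * C) by rewrite mulr_ge0 ?(ltW C20) // mulr_ge0 // ltW.
have hE : E <= T ^+ 2 * E by rewrite -[leLHS]mul1r ler_wpM2r // exprn_ege1.
have U0 : 0 <= T^-1 ^+ (2 * k.+1) * S by rewrite mulr_ge0 // exprn_ge0 // invr_ge0 ltW.
have F0 : 0 <= 4 ^+ k.+1 :> R by rewrite exprn_ge0.
move: G0 U0 F0 hE (mulr_ge0 (sqr_ge0 T) E0).
rewrite (mulrCA (T ^+ 2)).
move: (C2 * (M * C)) (T^-1 ^+ (2 * k.+1) * S) (4 ^+ k.+1) (T ^+ 2 * E) (T^-1 ^+ 2 * V).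
move=> G U F Y Z G0 U0 F0 hE Y0 hZ.
have := ler_wpM2l G0 hE; have := mulr_ge0 F0 U0; have := mulr_ge0 F0 Y0.
lra.
Qed.

Lemma evec_short (I : seq 'I_d) : short [seq evec j | j <- I].
Proof.
apply/allP => _ /mapP[j _ ->]; apply: leq_trans R0_gt0.
by apply/nrm_leP => i; rewrite mxE; case: (_ && _).
Qed.

(** The Sobolev inequality is applied to each entry of the differenced stencil. Its weights
    [t^(2|I|)] cancel the gain from the differences [I], so the differences [J] and the averaging
    factor [t^-d] remain. *)
Lemma interior_estimate : exists2 C : R, 0 < C & exists2 Kb : nat, (0 < Kb)%N &
  forall J w x t E, (size J <= d)%N -> short J -> (0 < t)%N -> 0 <= E ->
  harmonic w x (Kb * t) E ->
  nsq (diffs J (D w) x) <=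
  C * (t%:R^-1 ^+ (d + 2 * size J) * \sum_(y <- zball x (Kb * t)) nsq (D w y) + t%:R ^+ (d + 2) * E).
Proof.
have [B hB] := iterated_caccioppoli.
have [||C C0 hC] := @uniform_bound R _ (iota 0 (d + d).+1) (fun k C => 0 <= C /\ forall J w c r t E,
  size J = k -> short J -> (0 < t)%N -> 0 <= E -> harmonic w c (r + k * (t + B)) E ->
  \sum_(x <- zball c r) nsq (diffs J (D w) x) <=
  C * (t%:R^-1 ^+ (2 * k) * \sum_(x <- zball c (r + k * (t + B))) nsq (D w x) + t%:R ^+ 2 * E)).
- move=> k C C' [C0 h] CC'; split; first exact: le_trans CC'.
  move=> J w c r t E h1 h2 h3 h4 h5; apply: le_trans (h J w c r t E h1 h2 h3 h4 h5) _.
  rewrite ler_wpM2r // addr_ge0 ?mulr_ge0 ?exprn_ge0 ?invr_ge0 ?ler0n //.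
  by apply: sumr_ge0 => y _; exact: nsq_ge0.
- by move=> k _; have [C C0 h] := hB k; exists C; split; [exact: ltW|].
exists ((n * m)%:R * (4 ^+ d * C) + 1); first by rewrite ltr_wpDl // mulr_ge0 // mulr_ge0 ?exprn_ge0 // ltW.
(* The radius holds the Sobolev box of size [d * t] and at most [d + d] steps of length
   [t + B <= t * (1 + B)]. *)
exists (d + (d + d) * (1 + B)).+1 => // J w x t E sJd sJ t0 E0 hw.
set Kb := (_.+1) in hw *.
set S := \sum_(y <- _) _.
have S0 : 0 <= S by apply: sumr_ge0 => y _; exact: nsq_ge0.
have T0 : 0 < t%:R :> R by rewrite ltr0n.
have T1 : 1 <= t%:R :> R by rewrite ler1n.
set T : R := t%:R in T0 T1 *.
pose Bd := C * (T^-1 ^+ (2 * size J) * S + T ^+ (2 * d + 2) * E).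
have Bd0 : 0 <= Bd.
  by rewrite mulr_ge0 ?(ltW C0) // addr_ge0 // mulr_ge0 // exprn_ge0 ?invr_ge0 // ltW.
have entry k i : diffs J (D w) x k i ^+ 2 <= (4 / T) ^+ d * Bd.
  apply: (@sobolev R d (fun y => diffs J (D w) y k i) x t) => // I hI.
  have -> : diffs [seq evec j | j <- I] (fun y => diffs J (D w) y k i) =
      (fun y => diffs ([seq evec j | j <- I] ++ J) (D w) y k i).
    apply/funext => y; rewrite diffs_cat.
    by apply: (@diffs_morph d _ _ (fun X : 'M[R]_(n, m) => X k i)) => X Y; rewrite !mxE.
  set L := _ ++ J.
  have sL : size L = (size I + size J)%N by rewrite size_cat size_map.
  have shL : short L by rewrite /short all_cat; apply/andP; split; [exact: evec_short|exact: sJ].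
  have hin : size L \in iota 0 (d + d).+1 by rewrite mem_iota add0n ltnS sL leq_add.
  have [_ hL] := hC _ hin.
  have hrad : (d * t + size L * (t + B) <= Kb * t)%N.
    rewrite sL /Kb.
    have h1 : ((size I + size J) * (t + B) <= (d + d) * (t * (1 + B)))%N.
      by apply: leq_mul; [exact: leq_add|move: t0; clear; nia].
    have h2 : ((d + (d + d) * (1 + B)).+1 * t = t + d * t + (d + d) * (t * (1 + B)))%N.
      by rewrite -addn1; ring.
    by move: h1; rewrite h2; clear; lia.
  have hwL : harmonic w x (d * t + size L * (t + B)) E.
    by apply: harm_sub hw; rewrite subrr nrm0.
  have := hL L w x (d * t)%N t E erefl shL t0 E0 hwL.
  set S' := \sum_(y <- zball x (_ + _)) _ => h.
  have SS' : S' <= S.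
    by apply: sum_zball_sub => [y|]; [exact: nsq_ge0|rewrite subrr nrm0].
  apply: le_trans (_ : T ^+ (2 * size I) * (C * (T^-1 ^+ (2 * size L) * S + T ^+ 2 * E)) <= _).
    rewrite ler_pM2l ?exprn_gt0 //.
    apply: le_trans (_ : \sum_(y <- zball x (d * t)) nsq (diffs L (D w) y) <= _).
      by apply: ler_sum => y _; exact: sqr_entry_le.
    apply: le_trans h _; rewrite ler_pM2l // lerD2r ler_wpM2l // exprn_ge0 //.
  rewrite /Bd mulrCA ler_pM2l // mulrDr; apply: lerD.
    rewrite sL mulnDr exprD mulrA mulrA -exprMn divff ?gt_eqF // expr1n mul1r.
    exact: lexx.
  rewrite mulrA -exprD ler_wpM2r // ler_weXn2l //.
  by rewrite leq_add2r leq_mul2l hI orbT.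
apply: le_trans (_ : (n * m)%:R * ((4 / T) ^+ d * Bd) <= _).
  apply: le_trans (ler_sum _ (fun e _ => entry e.1 e.2)) _.
  by rewrite sumr_const card_prod !card_ord [leRHS]mulr_natl.

rewrite [leLHS](_ : _ = (n * m)%:R * (4 ^+ d * C) *
    (T^-1 ^+ (d + 2 * size J) * S + T ^+ (d + 2) * E)); last first.
  rewrite /Bd exprMn.
  have -> : T ^+ (2 * d + 2) = T ^+ d * T ^+ (d + 2) by rewrite -exprD; congr (_ ^+ _); clear; lia.
  rewrite [T^-1 ^+ (d + _)]exprD !exprVn.
  by field; rewrite !expf_neq0 ?gt_eqF.
rewrite ler_wpM2r ?lerDl // addr_ge0 // mulr_ge0 // exprn_ge0 ?invr_ge0 // ltW.
Qed.

End InteriorEstimate.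

(** * Point loads and superposition *)

Section KernelEstimate.
Variables (R : realType) (d n N m : nat) (rng : 'I_m -> triple d N).
Variables (A : 'M[R]_(n, m) -> 'M[R]_(n, m) -> R) (K gamma : R) (R0 : nat).
Hypothesis HR0 : forall i, (nrm (rng i).1.1 <= R0)%N.
Hypothesis R0_gt0 : (0 < R0)%N.
Hypothesis rng_basis : forall j : 'I_d, in_R1 rng (delta_mx j 0).
Hypothesis rng_species : forall a b : 'I_N.+1, a != b -> exists i, rng i = (0, a, b).
Hypothesis A_linear : forall x t y z, A (x + t *: y) z = A x z + t * A y z.
Hypothesis A_sym : forall x y, A x y = A y x.
Hypothesis A_bound : forall x y, `|A x y| <= K * (nsq x + nsq y).
Hypothesis K_gt0 : 0 < K.

Let disp := displacement R d n N.
Local Notation D := (@Dstencil R d n N m rng).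
Local Notation en := (@energy R d n N m rng).
Local Notation pr := (@load R d n N m rng).
Local Notation frm := (@eform R d n N m rng A).
Local Notation harmonic := (@harm R d n N m rng A).
Local Notation approx_sol := (@near_solution R d n N m rng A).
Implicit Types (u v w psi : disp) (x c rho : Zsite d) (J : seq (Zsite d)).

Hypothesis gamma_gt0 : 0 < gamma.
Hypothesis coercive : forall v, fsd v -> gamma * en v <= frm v v.

(** The load acts through the stencil and so is a dipole along one bond: its response is a
    difference of the Green function, and the stencil of the response a second difference, of order
    [|x|^-d]. *)
Definition point_load (k : 'I_n) (i : 'I_m) : Zsite d -> 'M[R]_(n, m) :=
  fun x => if x == 0 then delta_mx k i else 0.

Lemma mdot_delta k i (X : 'M[R]_(n, m)) : mdot (delta_mx k i) X = X k i.
Proof.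
rewrite /mdot (bigD1 (k, i)) //= mxE !eqxx mul1r big1 ?addr0 // => -[a b] /= h.
by rewrite mxE -[(_ && _)]/((a, b) == (k, i)) (negbTE h) mul0r.
Qed.

Lemma pr_point_load k i v : pr (point_load k i) v = D v 0 k i.
Proof.
rewrite /load (tot_seq (s := [:: 0])) //.
  by rewrite big_seq1 /point_load eqxx mdot_delta.
move=> x; rewrite inE /point_load => /negbTE ->.
by rewrite mdotC mdot0r.
Qed.

Lemma summable_point_load k i : summable_by (fun x => nsq (point_load k i x)) 1.
Proof.
move=> s us; apply: le_trans (_ : \sum_(x <- undup (0 :: s)) nsq (point_load k i x) <= _).
  apply: sum_le_sub => // [x xs|x]; last exact: nsq_ge0.
  by rewrite mem_undup inE xs orbT.
rewrite -(@sum_sub_eq _ _ [:: 0]) ?undup_uniq //.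
- rewrite big_seq1 /point_load eqxx -mdotxx mdot_delta mxE !eqxx //.
- by move=> x; rewrite inE mem_undup => /eqP ->; exact: mem_head.
- by move=> x; rewrite inE /point_load => /negbTE ->; rewrite nsq0.
Qed.

Lemma nsq_D_le_en v x : fsd v -> nsq (D v x) <= en v.
Proof.
move=> hv; rewrite -(big_seq1 +%R x (fun x => nsq (D v x))).
by apply: sum_le_tot => // [|y]; [exact: (fsupp_en HR0)|exact: nsq_ge0].
Qed.

Lemma nsq_diffs_le_en J v x : fsd v -> nsq (diffs J (D v) x) <= 4 ^+ size J * en v.
Proof.
move=> hv; rewrite -D_diffsd; apply: le_trans (nsq_D_le_en _ (fsd_diffsd J hv)) _.
exact: (en_diffsd HR0).
Qed.

Lemma le_of_eps (x y b : R) : 0 <= b -> (forall e, 0 < e -> x <= y + b * e) -> x <= y.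
Proof.
move=> b0 h; rewrite leNgt; apply/negP => yx.
have b1 : 0 < b + 1 by rewrite ltr_wpDl.
have := h ((x - y) / (b + 1)) (divr_gt0 _ b1); rewrite subr_gt0 => /(_ yx).
rewrite mulrA -lerBlDl ler_pdivlMr //; nra.
Qed.

Lemma sqr_add3_le (x y z : R) : (x + y + z) ^+ 2 <= 3 * (x ^+ 2 + y ^+ 2 + z ^+ 2).
Proof. by have := sqr_ge0 (x - y); have := sqr_ge0 (y - z); have := sqr_ge0 (x - z); nra. Qed.

(* Duality: the energy of w far from the load is the response at the origin
   to the restriction of Dw to the ball, and this response is small by the
   interior estimate. *)
Lemma far_energy C Kb : 0 < C ->
  (forall J w x t E, (size J <= d)%N -> short R0 J -> (0 < t)%N -> 0 <= E ->
  harmonic w x (Kb * t) E ->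
  nsq (diffs J (D w) x) <=
  C * (t%:R^-1 ^+ (d + 2 * size J) * \sum_(y <- zball x (Kb * t)) nsq (D w y) + t%:R ^+ (d + 2) * E)) ->
  forall k i w c s t E, (0 < t)%N -> 0 <= E -> fsd w -> approx_sol w (point_load k i) E ->
  (s + Kb * t + R0 < nrm c)%N ->
  \sum_(x <- zball c s) nsq (D w x) <= 6 / gamma ^+ 2 * (E + C * t%:R^-1 ^+ d).
Proof.
move=> C0 IE k i w c s t E t0 E0 hw ha hs.
set S := \sum_(x <- _) _; set T : R := t%:R.
have T0 : 0 < T by rewrite ltr0n.
have S0 : 0 <= S by apply: sumr_ge0 => x _; exact: nsq_ge0.
have g2 : 0 < gamma ^+ 2 by rewrite exprn_gt0.
pose h x := if x \in zball c s then D w x else 0.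
have hh : summable_by (fun x => nsq (h x)) S.
  move=> q uq; rewrite (bigID (mem (zball c s))) /= [X in _ + X]big1 ?addr0; last first.
    by move=> x /negbTE hx; rewrite /h hx nsq0.
  rewrite -big_filter; apply: le_trans (_ : \sum_(x <- [seq x <- q | x \in zball c s]) nsq (D w x) <= _).
    rewrite big_seq [leRHS]big_seq; apply: ler_sum => x; rewrite mem_filter => /andP[hx _].
    by rewrite /h hx.
  apply: sum_le_sub; [exact: filter_uniq| |by move=> x; exact: nsq_ge0].
  by move=> x; rewrite mem_filter => /andP[].
have prh v : pr h v = \sum_(x <- zball c s) mdot (D w x) (D v x).
  rewrite /load (tot_seq (zball_uniq c s)); last first.
    by move=> x /negbTE hx; rewrite /h hx mdotC mdot0r.
  by rewrite big_seq [RHS]big_seq; apply: eq_bigr => x hx; rewrite /h hx.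
(* [E'] is the error of the dual solution [w'] with load [h]. It tends to 0 while [E] and [t] are
   fixed, and only the first term survives. *)
have key E' : 0 < E' -> S ^+ 2 <= 6 / gamma ^+ 2 * (E + C * T^-1 ^+ d) * S +
    (6 * (1 + E) / gamma ^+ 2 + 6 / gamma ^+ 2 * (E + C * T^-1 ^+ d) + 3 * C * T ^+ (d + 2)) * E'.
  move=> E'0; have E'00 := ltW E'0.
  have [w' hw' ha'] := exists_approx HR0 A_linear A_sym A_bound K_gt0 gamma_gt0 coercive hh E'0.
  have en' := approx_energy HR0 gamma_gt0 coercive hh E'00 hw' ha'.
  have enw := approx_energy HR0 gamma_gt0 coercive (summable_point_load k i) E0 hw ha.
  (* The ball carrying [h] lies beyond radius [Kb * t + R0], so test functions near the origin do
     not see this load. *)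
  have harm' : harmonic w' 0 (Kb * t) E'.
    move=> psi hp; have := ha' _ (supin_fsd hp); rewrite prh big_seq big1 ?subr0 // => x.
    rewrite mem_zball nrmBC => hx; rewrite (D_supin HR0 hp) ?mdot0r // subr0.
    by move: hx hs (nrm_leB c x); clear; lia.
  have h0 := IE [::] w' 0 t E' isT isT t0 E'00 harm'.
  have h1 := ha' w hw; have h2 := ha w' hw'.
  rewrite prh (eq_bigr _ (fun x _ => mdotxx (D w x))) -/S in h1.
  rewrite pr_point_load (frm_sym rng A_sym w w') in h2.
  have e' := en_ge0 rng w'.
  have h3 : D w' 0 k i ^+ 2 <= C * (T^-1 ^+ d * en w' + T ^+ (d + 2) * E').
    apply: le_trans (sqr_entry_le _ _ _) (le_trans h0 _).
    rewrite /= muln0 addn0 ler_pM2l // lerD2r ler_wpM2l //.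
    by apply: sum_le_tot; [exact: zball_uniq|exact: (fsupp_en HR0)|move=> x; exact: nsq_ge0].
  have Cd0 : 0 <= C * T^-1 ^+ d by rewrite mulr_ge0 ?(ltW C0) // exprn_ge0 // invr_ge0 ltW.
  have h4 : S ^+ 2 <= 3 * (E' * en w + E * en w' + C * (T^-1 ^+ d * en w' + T ^+ (d + 2) * E')).
    (* [S] is the load [h] tested with [w]. Symmetry of the form exchanges it for the point load
       tested with [w'], with one error for each of the two equations. *)
    have := sqr_add3_le (S - frm w' w) (frm w' w - D w' 0 k i) (D w' 0 k i).
    rewrite addrA subrK subrK -(sqrrN (S - _)) opprB; lra.
  apply: le_trans h4 _.
  have k1 := ler_wpM2l E'00 enw.
  have k2 := ler_wpM2l (addr_ge0 E0 Cd0) en'.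
  rewrite -subr_ge0; rewrite -subr_ge0 in k1; rewrite -subr_ge0 in k2.
  set X := (X in 0 <= X).
  have -> : X = 3 * (E' * (2 * (1 + E) / gamma ^+ 2) - E' * en w) +
     3 * ((E + C * T^-1 ^+ d) * (2 * (S + E') / gamma ^+ 2) - (E + C * T^-1 ^+ d) * en w').
    by rewrite /X; field; rewrite ?expf_neq0 ?gt_eqF.
  by rewrite addr_ge0 // mulr_ge0.
have Cd0 : 0 <= C * T^-1 ^+ d by rewrite mulr_ge0 ?(ltW C0) // exprn_ge0 // invr_ge0 ltW.
have h6 : 0 <= 6 / gamma ^+ 2 * (E + C * T^-1 ^+ d) by rewrite mulr_ge0 ?addr_ge0 // divr_ge0 // ltW.
have := le_of_eps _ key.
set a := 6 / gamma ^+ 2 * _ in key h6 *.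
have b0 : 0 <= 6 * (1 + E) / gamma ^+ 2 + a + 3 * C * T ^+ (d + 2).
  rewrite addr_ge0 // ?addr_ge0 //.
    by rewrite divr_ge0 ?mulr_ge0 ?addr_ge0 // ltW.
  by rewrite mulr_ge0 ?exprn_ge0 // ?mulr_ge0 // ltW.
move=> /(_ b0) hS.
have [->//|Sn] := eqVneq S 0.
have Sp : 0 < S by rewrite lt_def Sn.
by rewrite -(ler_pM2r Sp) -expr2.
Qed.

(** With [t] proportional to [nrm c], the energy near [c] is of order [t^-d] by duality, and the
    interior estimate about [c] contributes [t^-(d + 2|J|)]. Near the origin the bound on the total
    energy is enough. *)
Lemma kernel_estimate : exists2 C : R, 0 < C &
  forall k i w E J c, 0 <= E -> fsd w -> approx_sol w (point_load k i) E ->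
  short R0 J -> (size J <= d)%N ->
  nsq (diffs J (D w) c) <= C * ((1 + nrm c)%:R^-1 ^+ (2 * d + 2 * size J) + E).
Proof.
have [C C0 [Kb Kb0 IE]] := interior_estimate HR0 R0_gt0 rng_basis rng_species A_linear A_sym
  A_bound K_gt0 gamma_gt0 coercive.
have g2 : 0 < gamma ^+ 2 by rewrite exprn_gt0.
have gi : 0 < (gamma ^+ 2)^-1 by rewrite invr_gt0.
(* If [M * t <= nrm c], balls of radius [Kb * t] about [c] and about the origin are separated by
   more than [R0]. *)
pose M := (2 * Kb + R0 + 1)%N.
pose Cf := 6 / gamma ^+ 2.
have Cf0 : 0 < Cf by rewrite mulr_gt0.
have trivial k i w E J c : 0 <= E -> fsd w -> approx_sol w (point_load k i) E ->
    (size J <= d)%N -> nsq (diffs J (D w) c) <= 4 ^+ d * (2 * (1 + E) / gamma ^+ 2).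
  move=> E0 hw ha sJ; apply: le_trans (nsq_diffs_le_en J c hw) _.
  apply: ler_pM; [by rewrite exprn_ge0|exact: en_ge0|by rewrite ler_weXn2l // ler1n|].
  exact: (approx_energy HR0 gamma_gt0 coercive (summable_point_load k i) E0 hw ha).
have far k i w E J c t : 0 <= E -> fsd w -> approx_sol w (point_load k i) E ->
    short R0 J -> (size J <= d)%N -> (0 < t)%N -> (M * t <= nrm c)%N ->
    nsq (diffs J (D w) c) <= C * (Cf * C) * t%:R^-1 ^+ (2 * d + 2 * size J)
      + C * (Cf + t%:R ^+ (d + 2)) * E.
  move=> E0 hw ha shJ sJ t0 hM.
  have T0 : 0 < t%:R :> R by rewrite ltr0n.
  have hrad : (Kb * t + Kb * t + R0 < nrm c)%N.
    apply: leq_trans hM; have -> : (M * t = Kb * t + Kb * t + R0 * t + t)%N by rewrite /M; ring.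
    have : (R0 <= R0 * t)%N by rewrite leq_pmulr.
    by move: t0; move: (R0 * t)%N (Kb * t)%N; clear=> p q; lia.
  have hS := far_energy C0 IE t0 E0 hw ha hrad.
  have hh : harmonic w c (Kb * t) E.
    move=> psi hp; have := ha _ (supin_fsd hp); rewrite pr_point_load.
    rewrite (D_supin HR0 hp) ?mxE ?subr0 //.
    by rewrite sub0r nrmN; move: hrad; clear; lia.
  apply: le_trans (IE J w c t E sJ shJ t0 E0 hh) _.
  have Ti0 : 0 <= t%:R^-1 :> R by rewrite invr_ge0 ltW.
  have P0 : 0 <= t%:R^-1 ^+ (d + 2 * size J) :> R by rewrite exprn_ge0.
  have P1 : t%:R^-1 ^+ (d + 2 * size J) <= 1 :> R.
    by rewrite exprn_ile1 // invf_le1 // ler1n.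
  have hS' := ler_wpM2l P0 hS.
  have e : t%:R^-1 ^+ (2 * d + 2 * size J) = t%:R^-1 ^+ (d + 2 * size J) * t%:R^-1 ^+ d :> R.
    by rewrite -exprD; congr (_ ^+ _); clear; lia.
  rewrite e; move: P0 P1 hS'; rewrite -/Cf.
  set P := t%:R^-1 ^+ (d + _); set Q := t%:R^-1 ^+ d; set Z := t%:R ^+ (d + 2).
  move=> P0 P1 hS'.
  rewrite (_ : _ + _ = C * (P * (Cf * (C * Q)) + (Cf + Z) * E)); last by ring.
  rewrite ler_pM2l // mulrDl addrA lerD2r; apply: le_trans hS' _.
  have h1 := ler_wpM2r (mulr_ge0 (ltW Cf0) E0) P1; lra.
pose C1 := 4 ^+ d * (4 / gamma ^+ 2).
have C10 : 0 < C1 by rewrite mulr_gt0 ?exprn_gt0 // divr_gt0.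
have M0 : 0 < M%:R :> R by rewrite ltr0n /M addn1.
(* Rounding in [t = nrm c %/ M] gives [t^-1 <= 2 * M * Y], and the exponent is at most [4 * d]. *)
pose C2 := 2 * (C * (Cf * C)) * (2 * M%:R) ^+ (4 * d).
have C20 : 0 <= C2.
  by rewrite mulr_ge0 // ?exprn_ge0 // ?mulr_ge0 // ltW.
exists (C2 + C1 * M%:R ^+ (4 * d) + C1).
  by rewrite ltr_wpDl // addr_ge0 // mulr_ge0 ?exprn_ge0 // ltW.
move=> k i w E J c E0 hw ha shJ sJ.
set e := (2 * d + 2 * size J)%N; set Y : R := (1 + nrm c)%:R^-1.
have n0 : 0 < (1 + nrm c)%:R :> R by rewrite ltr0n.
have Y0 : 0 < Y by rewrite invr_gt0.
have he : (e <= 4 * d)%N by rewrite /e; move: sJ; clear; lia.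
have M1 : 1 <= M%:R :> R by rewrite ler1n /M addn1.
have CM0 : 0 <= C1 * M%:R ^+ (4 * d) by rewrite mulr_ge0 ?exprn_ge0 // ltW.
have Ye0 : 0 <= Y ^+ e by rewrite exprn_ge0 // ltW.
have [hc|hc] := ltnP (nrm c) M.
  apply: le_trans (trivial k i w E J c E0 hw ha sJ) _.
  have : 1 <= M%:R ^+ (4 * d) * Y ^+ e.
    apply: le_trans (_ : (M%:R * Y) ^+ e <= _).
      by rewrite exprn_ege1 // ler_pdivlMr // mul1r ler_nat.
    by rewrite exprMn ler_wpM2r // ler_weXn2l.
  move=> h; have := ler_wpM2l (ltW C10) h; rewrite mulr1 mulrA => h'.
  rewrite [leLHS](_ : _ = C1 / 2 * (1 + E)); last by rewrite /C1; field; rewrite gt_eqF.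
  have := mulr_ge0 C20 Ye0; have := mulr_ge0 C20 E0; have := mulr_ge0 CM0 E0.
  have := mulr_ge0 (ltW C10) Ye0; have := mulr_ge0 (ltW C10) E0; lra.
pose t := (nrm c %/ M)%N.
have t0 : (0 < t)%N by rewrite divn_gt0 // /M addn1.
have hMt : (M * t <= nrm c)%N by rewrite mulnC leq_divM.
have T0 : 0 < t%:R :> R by rewrite ltr0n.
have tY : t%:R^-1 <= (2 * M%:R) * Y.
  rewrite ler_pdivlMr // mulrC ler_pdivrMr // -natrM -natrM ler_nat.
  have M0n : (0 < M)%N by rewrite /M addn1.
  rewrite add1n; apply: leq_trans (ltn_ceil (nrm c) M0n) _.
  by rewrite mulnAC leq_mul2r -/t; move: t0; clear; lia.
have tYe : t%:R^-1 ^+ e <= (2 * M%:R) ^+ (4 * d) * Y ^+ e.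
  apply: le_trans (_ : (2 * M%:R * Y) ^+ e <= _).
    by rewrite lerXn2r // nnegrE ?invr_ge0 ?mulr_ge0 // ltW.
  by rewrite exprMn ler_wpM2r // ler_weXn2l // -natrM ler1n muln_gt0 /M addn1.
pose b := 2 * (C * (Cf + t%:R ^+ (d + 2))) + C1.
have b0 : 0 <= b.
  apply: addr_ge0; last exact: ltW.
  apply: mulr_ge0 => //; apply: mulr_ge0; first exact: ltW.
  by apply: addr_ge0; [exact: ltW|exact: exprn_ge0].
(* In [far] the error is multiplied by a power of [t], hence not uniformly in [c]. That estimate is
   applied to a better approximation [w'], whose error vanishes in the limit; the difference
   [w - w'] has energy at most a multiple of [E + E']. *)
apply: (le_of_eps b0) => E' E'0.
have [w' hw' ha'] := exists_approx HR0 A_linear A_sym A_bound K_gt0 gamma_gt0 coercive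
  (summable_point_load k i) E'0.
have h1 := far k i w' E' J c t (ltW E'0) hw' ha' shJ sJ t0 hMt.
have h2 := approx_diff HR0 A_linear A_sym gamma_gt0 coercive E0 (ltW E'0) hw hw' ha ha'.
have h3 := nsq_diffs_le_en J c (fsd_axpy (-1) hw hw').
set z := axpy w (-1) w' in h2 h3.
have ez : diffs J (D w) c = diffs J (D w') c + diffs J (D z) c.
  by rewrite diffs_axpy scaleN1r addrC subrK.
rewrite ez; apply: le_trans (nsqD _ _) _.
have h4 : nsq (diffs J (D z) c) <= C1 / 2 * (E + E').
  apply: le_trans h3 _; apply: le_trans (_ : 4 ^+ d * (2 * (E + E') / gamma ^+ 2) <= _).
    apply: ler_pM; [by rewrite exprn_ge0|exact: en_ge0|by rewrite ler_weXn2l // ler1n|exact: h2].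
  rewrite le_eqVlt; apply/orP; left; apply/eqP; rewrite /C1; field; by rewrite gt_eqF.
have h5 : 2 * (C * (Cf * C)) * t%:R^-1 ^+ e <= C2 * Y ^+ e.
  rewrite /C2 -[leRHS]mulrA ler_wpM2l // mulr_ge0 // mulr_ge0 ?(ltW C0) // mulr_ge0 ?(ltW C0) ?(ltW Cf0) //.
have := mulr_ge0 C20 E0; have := mulr_ge0 CM0 E0; have := mulr_ge0 CM0 Ye0.
have := mulr_ge0 (ltW C10) Ye0.
rewrite /b.
move: h1 h4 h5; rewrite -/e; set p := nsq _; set q := nsq _; set Ze := t%:R^-1 ^+ e.
set u := C * (Cf * C); set u' := C * (Cf + _).
lra.
Qed.

End KernelEstimate.

(** * Superposition of point-load responses *)

Section Representation.
Variables (R : realType) (d n N m : nat) (rng : 'I_m -> triple d N).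
Variables (A : 'M[R]_(n, m) -> 'M[R]_(n, m) -> R) (K gamma : R) (R0 : nat).
Hypothesis d_gt0 : (0 < d)%N.
Hypothesis HR0 : forall i, (nrm (rng i).1.1 <= R0)%N.
Hypothesis R0_gt0 : (0 < R0)%N.
Hypothesis rng_basis : forall j : 'I_d, in_R1 rng (delta_mx j 0).
Hypothesis rng_species : forall a b : 'I_N.+1, a != b -> exists i, rng i = (0, a, b).
Hypothesis A_linear : forall x t y z, A (x + t *: y) z = A x z + t * A y z.
Hypothesis A_sym : forall x y, A x y = A y x.
Hypothesis A_bound : forall x y, `|A x y| <= K * (nsq x + nsq y).
Hypothesis K_gt0 : 0 < K.

Let disp := displacement R d n N.
Local Notation D := (@Dstencil R d n N m rng).
Local Notation en := (@energy R d n N m rng).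
Local Notation pr := (@load R d n N m rng).
Local Notation frm := (@eform R d n N m rng A).
Local Notation harmonic := (@harm R d n N m rng A).
Local Notation near_sol := (@near_solution R d n N m rng A).
Implicit Types (u v w psi : disp) (x c rho xi : Zsite d) (J : seq (Zsite d)).
Implicit Types (g : Zsite d -> 'M[R]_(n, m)).

Hypothesis gamma_gt0 : 0 < gamma.
Hypothesis coercive : forall v, fsd v -> gamma * en v <= frm v v.

Lemma frm_diffsd J u v : fsd v -> frm (diffsd J u) v = frm u (diffsd [seq - rho | rho <- J] v).
Proof.
elim: J v => //= rho J IH v hv.
have -> : diffsd (rho :: J) u = dfd rho (diffsd J u) by [].
rewrite (frm_dfd HR0 A_linear A_sym) // IH; last exact: fsd_dfd.
by congr frm; apply/funext => a; rewrite /diffsd /dfd diffs_df.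
Qed.

(* The difference of two solutions with the same load is harmonic on all of
   the lattice, so the interior estimate on large balls makes it vanish. *)
Lemma approximation u g B G J xi del :
  summable_by (fun x => nsq (D u x)) B -> summable_by (fun x => nsq (g x)) G ->
  (forall psi, fsd psi -> frm u psi = pr g psi) ->
  short R0 J -> (size J <= d)%N -> 0 < del ->
  exists2 E0, 0 < E0 & forall E w, 0 < E -> E <= E0 -> fsd w -> near_sol w g E ->
    nsq (diffs J (D (axpy u (-1) w)) xi) <= del.
Proof.
move=> hB hG hu shJ sJ del0.
have [C C0 [Kb Kb0 IE]] := interior_estimate HR0 R0_gt0 rng_basis rng_species A_linear A_sym
  A_bound K_gt0 gamma_gt0 coercive.
have B0 : 0 <= B by have := hB [::] isT; rewrite big_nil.
have G0 : 0 <= G by have := hG [::] isT; rewrite big_nil.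
have g2 : 0 < gamma ^+ 2 by rewrite exprn_gt0.
pose Bz := 2 * B + 2 * (2 * (G + 1) / gamma ^+ 2).
have Bz0 : 0 <= Bz.
  apply: addr_ge0; apply: mulr_ge0 => //; apply: divr_ge0; last exact: ltW.
  by apply: mulr_ge0 => //; apply: addr_ge0.
(* The radius is fixed before the error. As [0 < d], at least one power of [t^-1] multiplies the
   energy, so [t] makes that term at most [del / 2]; the bound on [E] then absorbs
   [t ^+ (d + 2)]. *)
pose t := (Num.truncn (2 * C * Bz / del)).+1.
have T0 : 0 < t%:R :> R by rewrite ltr0n.
have ht : 2 * C * Bz / del <= t%:R by apply: ltW; exact: truncnS_gt.
have Z0 : 0 < 2 * C * t%:R ^+ (d + 2) by rewrite mulr_gt0 ?exprn_gt0 // mulr_gt0.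
exists (Num.min 1 (del / (2 * C * t%:R ^+ (d + 2)))).
  by rewrite lt_min ltr01 divr_gt0.
move=> E w E0; rewrite le_min => /andP[E1 hE] hw ha.
set z := axpy u (-1) w.
have hz c r : harmonic z c r E.
  move=> psi hp; have hf := supin_fsd hp.
  rewrite (frm_axpyl HR0 A_linear A_sym) // hu // mulN1r -sqrrN opprB; exact: ha.
have hsum : \sum_(y <- zball xi (Kb * t)) nsq (D z y) <= Bz.
  apply: le_trans (_ : \sum_(y <- zball xi (Kb * t)) (2 * nsq (D u y) + 2 * nsq (D w y)) <= _).
    by apply: ler_sum => y _; rewrite D_axpy scaleN1r nsqB.
  rewrite big_split /= -!mulr_sumr; apply: lerD; rewrite ler_pM2l //.
    by apply: hB; exact: zball_uniq.
  apply: le_trans (_ : en w <= _).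
    by apply: sum_le_tot; [exact: zball_uniq|exact: (fsupp_en HR0)|move=> y; exact: nsq_ge0].
  apply: le_trans (approx_energy HR0 gamma_gt0 coercive hG (ltW E0) hw ha) _.
  by rewrite ler_pM2r ?invr_gt0 // ler_pM2l // lerD2l.
apply: le_trans (IE J z xi t E sJ shJ isT (ltW E0) (hz _ _)) _.
have P1 : t%:R^-1 ^+ (d + 2 * size J) <= t%:R^-1 :> R.
  rewrite -[leRHS]expr1 ler_wiXn2l ?invr_ge0 ?(ltW T0) //; first by rewrite invf_le1 // ler1n.
  by rewrite ltn_addr.
have h1 : t%:R^-1 ^+ (d + 2 * size J) * \sum_(y <- zball xi (Kb * t)) nsq (D z y) <= t%:R^-1 * Bz.
  apply: ler_pM => //.
  by apply: sumr_ge0 => y _; exact: nsq_ge0.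
have h2 : C * (t%:R^-1 * Bz) <= del / 2.
  rewrite mulrCA ler_pdivrMl // mulrC.
  by move: ht; rewrite ler_pdivrMr //; lra.
have h3 : C * (t%:R ^+ (d + 2) * E) <= del / 2.
  by move: hE; rewrite ler_pdivlMr // mulrC; lra.
rewrite mulrDr; have := ler_wpM2l (ltW C0) h1; lra.
Qed.

Lemma sqrt_add_le (x y : R) : 0 <= x -> 0 <= y ->
  Num.sqrt (x + y) <= Num.sqrt x + Num.sqrt y.
Proof.
move=> x0 y0; apply: ler_of_sqr; first by rewrite addr_ge0 ?sqrtr_ge0.
rewrite sqr_sqrtr ?addr_ge0 // sqrrD !sqr_sqrtr // lerD2r lerDl.
by rewrite mulrn_wge0 // mulr_ge0 ?sqrtr_ge0.
Qed.

(** An entry of the differenced stencil at [xi] is the response to a point load at [xi]; by symmetry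
    of the form it equals, up to errors, the load [g] tested with the kernel. The bounds [B], [G]
    and [G1] enter only terms that vanish with [e], so [C] does not depend on them. *)
Lemma decay_representation : exists2 C : R, 0 < C &
  forall u g B G G1, summable_by (fun x => nsq (D u x)) B ->
  summable_by (fun x => nsq (g x)) G -> summable_by (fun x => Num.sqrt (nsq (g x))) G1 ->
  (forall psi, fsd psi -> frm u psi = pr g psi) ->
  forall J xi Bd, short R0 J -> (size J <= d)%N ->
  summable_by (fun x => Num.sqrt (nsq (g x)) * (1 + nrm (x - xi))%:R^-1 ^+ (d + size J)) Bd ->
  nsq (diffs J (D u) xi) <= C * Bd ^+ 2.
Proof.
have [C C0 KE] := kernel_estimate HR0 R0_gt0 rng_basis rng_species A_linear A_sym
  A_bound K_gt0 gamma_gt0 coercive.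
have g2 : 0 < gamma ^+ 2 by rewrite exprn_gt0.
exists (12 * (n * m)%:R * C + 1); first by rewrite ltr_wpDl // mulr_ge0 ?(ltW C0) // mulr_ge0.
move=> u g B G G1 hB hG hG1 hu J xi Bd shJ sJ hBd.
have G0 : 0 <= G by have := hG [::] isT; rewrite big_nil.
have G10 : 0 <= G1 by have := hG1 [::] isT; rewrite big_nil.
have Bd0 : 0 <= Bd by have := hBd [::] isT; rewrite big_nil.
pose Eg := 2 * (G + 1) / gamma ^+ 2; pose Ek := 2 * (1 + 1) / gamma ^+ 2.
have Eg0 : 0 <= Eg by rewrite divr_ge0 ?(ltW g2) // mulr_ge0 // addr_ge0.
have Ek0 : 0 <= Ek by rewrite divr_ge0 ?(ltW g2).
pose b1 := 3 * (4 ^+ d * Eg + 4 ^+ d * Ek + 2 * C * G1 ^+ 2).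
have b10 : 0 <= b1.
  apply: mulr_ge0 => //; apply: addr_ge0; first by apply: addr_ge0; apply: mulr_ge0.
  by apply: mulr_ge0; [apply: mulr_ge0 => //; exact: ltW|exact: sqr_ge0].
pose b := 2 * ((n * m)%:R * b1) + 2.
have b0 : 0 <= b by apply: addr_ge0 => //; apply: mulr_ge0 => //; apply: mulr_ge0.
suff main e : 0 < e -> e <= 1 -> nsq (diffs J (D u) xi) <= 12 * (n * m)%:R * C * Bd ^+ 2 + b * e.
  apply: le_trans (_ : 12 * (n * m)%:R * C * Bd ^+ 2 <= _); last first.
    by rewrite ler_wpM2r ?sqr_ge0 // lerDl.
  apply: (le_of_eps b0) => e e0.
  apply: le_trans (main (Num.min e 1) _ _) _; first by rewrite lt_min e0 ltr01.
    by rewrite ge_min lexx orbT.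
  by rewrite lerD2l ler_wpM2l // ge_min lexx.
move=> e0 e1.
have [E0 E00 hap] := approximation xi hB hG hu shJ sJ e0.
pose E1 := Num.min e E0.
have E1p : 0 < E1 by rewrite lt_min e0 E00.
have E1e : E1 <= e by rewrite ge_min lexx.
have E1E0 : E1 <= E0 by rewrite ge_min lexx orbT.
have [w hw ha] := exists_approx HR0 A_linear A_sym A_bound K_gt0 gamma_gt0 coercive hG E1p.
have hz := hap E1 w E1p E1E0 hw ha.
have enw : en w <= Eg.
  apply: le_trans (approx_energy HR0 gamma_gt0 coercive hG (ltW E1p) hw ha) _.
  rewrite ler_pM2r ?invr_gt0 // ler_pM2l // lerD2l; exact: le_trans E1e e1.
have pow4 : 4 ^+ size J <= 4 ^+ d :> R by rewrite ler_weXn2l // ler1n.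
have entry k i : diffs J (D w) xi k i ^+ 2 <= 6 * C * Bd ^+ 2 + b1 * e.
  have [w0 hw0 ha0] := exists_approx HR0 A_linear A_sym A_bound K_gt0 gamma_gt0 coercive
    (summable_point_load R k i) e0.
  have enw0 : en w0 <= Ek.
    apply: le_trans (approx_energy HR0 gamma_gt0 coercive (summable_point_load R k i) (ltW e0) hw0 ha0) _.
    by rewrite ler_pM2r ?invr_gt0 // ler_pM2l // lerD2l.
  pose J' := [seq - rho | rho <- J].
  have sJ' : size J' = size J by rewrite size_map.
  have shJ' : short R0 J' by rewrite /short all_map (eq_all (a2 := fun rho => nrm rho <= R0)%N) // => rho /=; rewrite nrmN.
  pose v := diffsd J (trd xi w).
  have hv : fsd v by apply: fsd_diffsd; exact: fsd_trd.
  (* The kernel for the site [xi] and the differences [J]: the translation places the load at [xi],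
     and summation by parts reverses the offsets. *)
  pose phi := trd (- xi) (diffsd J' w0).
  have hphi : fsd phi by apply: fsd_trd; exact: fsd_diffsd.
  have Dv0 : D v 0 = diffs J (D w) xi.
    rewrite /v D_diffsd (@eq_diffs _ _ J _ (fun y => D w (y + xi))); last by move=> y; rewrite D_trd.
    by rewrite diffs_shift add0r.
  have e1' : frm w0 v = frm w phi.
    rewrite (frm_sym rng A_sym) frm_diffsd // -/J' /phi -(frm_trd rng A (- xi) (trd xi w)).
    congr frm; apply/funext => a; apply/funext => x; by rewrite /trd subrK.
  have t1 := ha0 v hv; rewrite pr_point_load Dv0 e1' in t1.
  have t2 := ha phi hphi.
  have env : en v <= 4 ^+ d * Eg.
    apply: le_trans (en_diffsd HR0 J (fsd_trd xi hw)) _; rewrite en_trd.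
    by apply: ler_pM => //; exact: en_ge0.
  have enphi : en phi <= 4 ^+ d * Ek.
    rewrite en_trd; apply: le_trans (en_diffsd HR0 J' hw0) _; rewrite sJ'.
    by apply: ler_pM => //; exact: en_ge0.
  have hDphi x : Num.sqrt (nsq (D phi x)) <=
      Num.sqrt C * ((1 + nrm (x - xi))%:R^-1 ^+ (d + size J) + Num.sqrt e).
    rewrite D_trd D_diffsd.
    have := KE k i w0 e J' (x - xi) (ltW e0) hw0 ha0 shJ'; rewrite sJ' => /(_ sJ) hk.
    set Y : R := (1 + nrm (x - xi))%:R^-1 in hk *.
    have Y0 : 0 <= Y by rewrite invr_ge0.
    apply: le_trans (_ : Num.sqrt (C * (Y ^+ (2 * d + 2 * size J) + e)) <= _).
      by rewrite ler_sqrt // mulr_ge0 ?(ltW C0) // addr_ge0 ?exprn_ge0 // ltW.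
    rewrite sqrtrM ?(ltW C0) // ler_wpM2l ?sqrtr_ge0 //.
    apply: le_trans (sqrt_add_le (exprn_ge0 _ Y0) (ltW e0)) _.
    rewrite lerD2r (_ : (2 * d + 2 * size J = (d + size J) * 2)%N); last by clear; lia.
    by rewrite exprM sqrtr_sqr ger0_norm // exprn_ge0.
  have hpr : pr g phi ^+ 2 <= 2 * C * (Bd ^+ 2 + e * G1 ^+ 2).
    have : `|pr g phi| <= Num.sqrt C * (Bd + Num.sqrt e * G1).
      have [r hr] := fsupp_pr HR0 g hphi; rewrite /load (totE hr).
      apply: le_trans (ler_norm_sum _ _ _) _.
      apply: le_trans (_ : \sum_(x <- zball 0 r) Num.sqrt C * (Num.sqrt (nsq (g x)) *
          (1 + nrm (x - xi))%:R^-1 ^+ (d + size J) + Num.sqrt e * Num.sqrt (nsq (g x))) <= _).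
        apply: ler_sum => x _; apply: le_trans (mdot_le _ _) _.
        rewrite (mulrC (Num.sqrt e)) -mulrDr mulrCA ler_wpM2l ?sqrtr_ge0 //; exact: hDphi.
      rewrite -mulr_sumr ler_wpM2l ?sqrtr_ge0 // big_split /= -mulr_sumr.
      apply: lerD; first by apply: hBd; exact: zball_uniq.
      by rewrite ler_wpM2l ?sqrtr_ge0 //; apply: hG1; exact: zball_uniq.
    move=> h; rewrite -(real_normK (num_real (pr g phi))).
    apply: le_trans (_ : (Num.sqrt C * (Bd + Num.sqrt e * G1)) ^+ 2 <= _).
      by rewrite lerXn2r // nnegrE ?mulr_ge0 ?addr_ge0 ?mulr_ge0 ?sqrtr_ge0.
    rewrite exprMn sqr_sqrtr ?(ltW C0) // (mulrC 2) -mulrA ler_pM2l //.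
    have := sqr_sqrtr (ltW e0); move: (Num.sqrt e) => q hq; rewrite -hq.
    have := sqr_ge0 (Bd - q * G1); nra.
  have := sqr_add3_le (diffs J (D w) xi k i - frm w phi) (frm w phi - pr g phi) (pr g phi).
  rewrite addrA subrK subrK -(sqrrN (_ - frm w phi)) opprB.
  set X := diffs J (D w) xi k i in t1 *.
  have k1 : e * en v <= 4 ^+ d * Eg * e by rewrite mulrC ler_pM2r.
  have k2 : E1 * en phi <= 4 ^+ d * Ek * e.
    by rewrite mulrC; apply: ler_pM => //; [exact: en_ge0|exact: ltW].
  move=> h; apply: le_trans h _; rewrite /b1; lra.
have hw' : nsq (diffs J (D w) xi) <= (n * m)%:R * (6 * C * Bd ^+ 2 + b1 * e).
  apply: le_trans (ler_sum _ (fun q _ => entry q.1 q.2)) _.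
  by rewrite sumr_const card_prod !card_ord [leRHS]mulr_natl.
have -> : diffs J (D u) xi = diffs J (D w) xi + diffs J (D (axpy u (-1) w)) xi.
  by rewrite diffs_axpy scaleN1r addrC subrK.
apply: le_trans (nsqD _ _) _; rewrite /b; lra.
Qed.

End Representation.

(** * From summability to decay *)

Section LatticeSums.
Variables (R : realType) (d : nat).
Implicit Types (x xi : Zsite d).

Definition invn x : R := (1 + nrm x)%:R^-1.

Lemma invn_gt0 x : 0 < invn x.
Proof. by rewrite invr_gt0 ltr0n. Qed.

Lemma invn_ge0 x : 0 <= invn x.
Proof. exact: ltW (invn_gt0 x). Qed.

Lemma invn_le1 x : invn x <= 1.
Proof. by rewrite invf_le1 ?ltr0n // ler1n. Qed.

Lemma invn_near x y : (nrm y <= nrm x + nrm x)%N -> invn x <= 2 * invn y.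
Proof.
move=> h; rewrite /invn ler_pdivlMr ?ltr0n // mulrC ler_pdivrMr ?ltr0n // -natrM ler_nat.
by move: h; clear; lia.
Qed.

(** The subtracted term carries the induction: the two new summands [1/(L+2)^2] are together at most
    [2/(L+1) - 2/(L+2)]. *)
Lemma inv_sq_sum (L : nat) :
  \sum_(0 <= k < (L + L).+1) (1 + absz (k%:Z - L%:Z))%:R^-1 ^+ 2 <= 4 - 2 / L.+1%:R :> R.
Proof.
elim: L => [|L IH]; first by rewrite big_nat1 addn0 invr1 expr1n; lra.
have -> : ((L.+1 + L.+1).+1 = (L + L).+3)%N by lia.
rewrite big_nat_recr //= big_nat_recl //=.
rewrite subn0.
rewrite (_ : absz ((L + L).+2%:Z - L.+1%:Z) = L.+1); last by lia.
have -> : \sum_(0 <= i < (L + L).+1) (1 + absz (i.+1%:Z - L.+1%:Z))%:R^-1 ^+ 2 =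
    \sum_(0 <= k < (L + L).+1) (1 + absz (k%:Z - L%:Z))%:R^-1 ^+ 2 :> R.
  by apply: eq_bigr => i _; congr ((1 + _)%:R^-1 ^+ 2); lia.
have L0 : 0 <= L%:R :> R by exact: ler0n.
have e1 : L.+1%:R = L%:R + 1 :> R by rewrite -natr1.
have e2 : L.+2%:R = L%:R + 1 + 1 :> R by rewrite -natr1 -natr1.
rewrite add1n e2; rewrite e1 in IH.
have h : (L%:R + 1 + 1)^-1 ^+ 2 <= (L%:R + 1)^-1 - (L%:R + 1 + 1)^-1 :> R.
  rewrite -subr_ge0 (_ : _ - _ = (L%:R + 1)^-1 * (L%:R + 1 + 1)^-1 ^+ 2).
    by rewrite mulr_ge0 // ?invr_ge0 ?sqr_ge0 // addr_ge0.
  by field; rewrite !gt_eqF // ltr_wpDl // addr_ge0.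
lra.
Qed.

Lemma invn_pow_le_prod x : invn x ^+ (2 * d) <= \prod_(i < d) (1 + absz (x i 0))%:R^-1 ^+ 2.
Proof.
have -> : invn x ^+ (2 * d) = \prod_(i < d) invn x ^+ 2 by rewrite prodr_const card_ord exprM.
apply: ler_prod => i _; rewrite sqr_ge0 /= lerXn2r ?nnegrE ?invr_ge0 ?ler0n //.
by rewrite lef_pV2 ?posrE ?ltr0n // ler_nat leq_add2l absz_le_nrm.
Qed.

(** The sup norm dominates each coordinate, so the summand is at most a product of inverse squares
    in the coordinates, and the sum over a box factors into [d] sums bounded by 4. *)
Lemma summable_invn xi : summable_by (fun x => invn (x - xi) ^+ (2 * d)) (4 ^+ d).
Proof.
move=> s us; pose L := \max_(x <- s) nrm (x - xi).
apply: le_trans (_ : \sum_(x <- zball xi L) invn (x - xi) ^+ (2 * d) <= _).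
  apply: sum_le_sub => // x; last by rewrite exprn_ge0 // ltW // invn_gt0.
  by move=> xs; rewrite mem_zball; exact: (@leq_bigmax_seq _ _ xpredT (fun x => nrm (x - xi))).
apply: le_trans (ler_sum _ (fun x _ => invn_pow_le_prod (x - xi))) _.
rewrite /zball big_map big_enum /=.
have e (f : {ffun 'I_d -> 'I_(L + L).+1}) :
    \prod_(i < d) (1 + absz ((ball_pt xi f - xi)%R i 0%R))%:R^-1 ^+ 2 =
    \prod_(i < d) (1 + absz ((f i)%:Z - L%:Z))%:R^-1 ^+ 2 :> R.
  apply: eq_bigr => i _; rewrite /ball_pt addrAC subrr add0r mxE //.
rewrite (eq_bigr _ (fun f _ => e f)).
rewrite -(bigA_distr_bigA (fun (i : 'I_d) (k : 'I_(L + L).+1) => (1 + absz (k%:Z - L%:Z))%:R^-1 ^+ 2)) /=.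
have -> : 4 ^+ d = \prod_(i < d) 4 :> R by rewrite prodr_const card_ord.
apply: ler_prod => i _.
rewrite sumr_ge0 => [/=|k _]; last exact: sqr_ge0.
have := inv_sq_sum L; rewrite big_mkord => /le_trans; apply.
by rewrite lerBlDr lerDl divr_ge0.
Qed.

(** A finite list whose sum is within [del] of the supremum lies in some ball; sites outside this
    ball can be appended to it and so contribute at most [del]. *)
Lemma summable_tail (f : Zsite d -> R) B del : (forall x, 0 <= f x) -> summable_by f B ->
  0 < del -> exists r : nat, summable_by (fun x => if (r < nrm x)%N then f x else 0) del.
Proof.
move=> f0 hB del0.
pose S : set R := [set \sum_(x <- s) f x | s in [set s | uniq s]].
have hS : has_sup S.
  split; first by exists (\sum_(x <- [::]) f x); exists [::].
  by exists B => _ [s us <-]; exact: hB.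
have [_ [s0 us0 <-] hs0] := sup_adherent del0 hS.
exists (\max_(x <- s0) nrm x) => s us.
set r := \max_(x <- s0) _ in hs0 *.
rewrite -big_mkcond -big_filter; set s1 := [seq x <- s | _].
have us1 : uniq (s0 ++ s1).
  rewrite cat_uniq us0 filter_uniq // andbT; apply/hasPn => x; rewrite mem_filter => /andP[hx _].
  apply: contraTN hx => xs0; rewrite -leqNgt; exact: leq_bigmax_seq.
have : \sum_(x <- s0 ++ s1) f x <= sup S by apply: ub_le_sup; [exact: hS.2|exists (s0 ++ s1)].
rewrite big_cat /=; move: hs0; rewrite ltrBlDr => h1 h2.
by have := le_lt_trans h2 h1; lra.
Qed.

End LatticeSums.

(** * Decay of the stencil from the quadratic load *)

Section Bootstrap.
Variables (R : realType) (d n m : nat).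
Implicit Types (x xi : Zsite d).
Local Notation Y := (@invn R d).

Variables (U g : Zsite d -> 'M[R]_(n, m)) (C B M0 : R) (r0 : nat).
Hypothesis C_gt0 : 0 < C.
Hypothesis M0_gt0 : 0 < M0.
Hypothesis U_sum : summable_by (fun x => nsq (U x)) B.
Hypothesis g_quadratic : forall x, (r0 <= nrm x)%N -> Num.sqrt (nsq (g x)) <= M0 * nsq (U x).

Local Notation e x := (Num.sqrt (nsq (U x))).
Local Notation ag x := (Num.sqrt (nsq (g x))).

Lemma load_summable : exists2 G1, 0 <= G1 & summable_by (fun x => ag x) G1.
Proof.
have B0 : 0 <= B by have := U_sum (s := [::]) isT; rewrite big_nil.
pose G0 := \sum_(x <- zball 0 r0) ag x.
have G00 : 0 <= G0 by apply: sumr_ge0 => x _; exact: sqrtr_ge0.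
exists (M0 * B + G0); first by rewrite addr_ge0 // mulr_ge0 // ltW.
move=> s us.
rewrite (bigID (fun x => (r0 <= nrm x)%N)) /=; apply: lerD.
  apply: le_trans (_ : \sum_(x <- s | (r0 <= nrm x)%N) M0 * nsq (U x) <= _).
    by apply: ler_sum => x; exact: g_quadratic.
  rewrite -mulr_sumr ler_pM2l // -big_filter; apply: U_sum; exact: filter_uniq.
rewrite -big_filter; apply: sum_le_sub; first exact: filter_uniq.
  by move=> x; rewrite mem_filter mem_zball subr0 -ltnNge => /andP[/ltnW].
by move=> x; exact: sqrtr_ge0.
Qed.

Lemma load_sq_summable G1 : summable_by (fun x => ag x) G1 ->
  summable_by (fun x => nsq (g x)) (G1 * G1).
Proof.
move=> h s us.
have h1 x : ag x <= G1 by have := h [:: x] isT; rewrite big_seq1.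
have G10 : 0 <= G1 by have := h [::] isT; rewrite big_nil.
apply: le_trans (_ : \sum_(x <- s) G1 * ag x <= _).
  apply: ler_sum => x _; rewrite -[leLHS](@sqr_sqrtr R) ?nsq_ge0 // expr2.
  by rewrite ler_wpM2r ?sqrtr_ge0.
by rewrite -mulr_sumr ler_wpM2l // h.
Qed.

Lemma e_le x : e x <= Num.sqrt B.
Proof.
have := U_sum (s := [:: x]) isT; rewrite big_seq1 => h.
by rewrite ler_sqrt //; apply: le_trans h; exact: nsq_ge0.
Qed.

(** In the first case the kernel centred at [xi] is small at [x]; in the second [x] is far from the
    origin, where the load is small. *)
Lemma far_or_near x xi : (nrm xi <= nrm (x - xi) + nrm (x - xi))%N \/
  (nrm xi <= nrm x + nrm x)%N /\ (nrm (x - xi) <= nrm xi)%N.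
Proof.
have h : (nrm xi <= nrm (x - xi) + nrm x)%N by rewrite nrmBC; exact: nrm_leB.
case: (leqP (nrm xi) (nrm (x - xi) + nrm (x - xi))) => h2; first by left.
by right; split; move: h h2; clear; lia.
Qed.

(* Near xi the load is quadratic in e, and one factor e is small in l^2
   because xi is far from the origin: this contracts the constant part tau. *)
Lemma bootstrap_decay :
  (forall xi Bd, summable_by (fun x => ag x * Y (x - xi) ^+ d) Bd -> e xi <= C * Bd) ->
  exists2 Kc, 0 < Kc & forall xi, e xi <= Kc * Y xi ^+ d.
Proof.
move=> rep; have [G1 G10 hG1] := load_summable.
have B0 : 0 <= B by have := U_sum (s := [::]) isT; rewrite big_nil.
pose Sg := Num.sqrt (4 ^+ d : R).
have Sg0 : 0 < Sg by rewrite sqrtr_gt0 exprn_gt0.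
(* The near part becomes [q / (2 ^+ d * 2)]: the factor [2 ^+ d] cancels the one in [q], and the
   last 2 halves both [Kc] and [tau]. *)
pose del := (C * M0 * Sg * 2 ^+ d * 2)^-1.
have del0 : 0 < del by rewrite invr_gt0 !mulr_gt0 // exprn_gt0.
have [r hr] := summable_tail (fun x => nsq_ge0 (U x)) U_sum (exprn_gt0 2 del0).
(* For [nrm xi] at least [r1 + r1], every site at half this distance from the origin is outside both
   the defect and the ball of the tail. *)
pose r1 := (r.+1 + r0)%N.
pose Kc := 2 * (C * 2 ^+ d * G1) + Num.sqrt B * (1 + (r1 + r1))%:R ^+ d + 1.
have K1 : 0 <= 2 * (C * 2 ^+ d * G1).
  by rewrite mulr_ge0 // mulr_ge0 // mulr_ge0 ?exprn_ge0 // ltW.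
have K2 : 0 <= Num.sqrt B * (1 + (r1 + r1))%:R ^+ d by rewrite mulr_ge0 ?sqrtr_ge0 // exprn_ge0.
have Kc0 : 0 < Kc by rewrite ltr_wpDl // addr_ge0.
exists Kc => //.
(* The uniform bound [Num.sqrt B] starts the iteration, and the constant part is halved at each step
   with the same [Kc]. *)
pose P tau := forall xi, e xi <= Kc * Y xi ^+ d + tau.
have step tau : 0 <= tau -> P tau -> P (tau / 2).
  move=> tau0 hP xi; have Yd0 : 0 < Y xi ^+ d by rewrite exprn_gt0 // invn_gt0.
  have [hxi|hxi] := ltnP (nrm xi) (r1 + r1)%N.
    apply: le_trans (e_le xi) _.
    have : Num.sqrt B <= Num.sqrt B * (1 + (r1 + r1))%:R ^+ d * Y xi ^+ d.
      rewrite -mulrA ler_peMr ?sqrtr_ge0 // -exprMn exprn_ege1 // ler_pdivlMr ?ltr0n //.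
      by rewrite mul1r ler_nat leq_add2l ltnW.
    have := mulr_ge0 K1 (ltW Yd0); rewrite /Kc; nra.
  (* By [P tau] this bounds [e x] wherever [nrm xi <= nrm x + nrm x]. *)
  pose q := Kc * 2 ^+ d * Y xi ^+ d + tau.
  have q0 : 0 <= q by rewrite addr_ge0 // mulr_ge0 ?(ltW Yd0) // mulr_ge0 ?exprn_ge0 // ltW.
  have pointwise x : ag x * Y (x - xi) ^+ d <= 2 ^+ d * Y xi ^+ d * ag x +
      M0 * q * ((if (r < nrm x)%N then e x else 0) * Y (x - xi) ^+ d).
    have Yx0 : 0 < Y (x - xi) ^+ d by rewrite exprn_gt0 // invn_gt0.
    have a0 : 0 <= ag x := sqrtr_ge0 _.
    have [hf|[hn hn2]] := far_or_near x xi.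
      apply: le_trans (_ : 2 ^+ d * Y xi ^+ d * ag x <= _).
        rewrite mulrC ler_wpM2r // -exprMn lerXn2r ?nnegrE ?mulr_ge0 ?invn_ge0 //.
        exact: invn_near.
      rewrite lerDl mulr_ge0 // ?mulr_ge0 ?(ltW M0_gt0) ?(ltW Yx0) //.
      by case: ifP => // _; exact: sqrtr_ge0.
    have hx : (r.+1 + r0 <= nrm x)%N by move: hxi hn; rewrite /r1; clear; lia.
    rewrite ifT; last by move: hx; clear; lia.
    apply: le_trans (_ : M0 * q * (e x * Y (x - xi) ^+ d) <= _); last first.
      by rewrite lerDr mulr_ge0 // mulr_ge0 ?exprn_ge0 // ltW // invn_gt0.
    rewrite [leRHS]mulrA ler_wpM2r ?(ltW Yx0) //.
    have hx0 : (r0 <= nrm x)%N by move: hx; clear; lia.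
    apply: le_trans (g_quadratic hx0) _; rewrite -mulrA ler_pM2l //.
    rewrite -[leLHS](@sqr_sqrtr R) ?nsq_ge0 // expr2 ler_wpM2r ?sqrtr_ge0 //.
    apply: le_trans (hP x) _; rewrite lerD2r -mulrA ler_pM2l // -exprMn.
    by rewrite lerXn2r ?nnegrE ?mulr_ge0 ?invn_ge0 // invn_near.
  have hsum : summable_by (fun x => ag x * Y (x - xi) ^+ d)
      (2 ^+ d * Y xi ^+ d * G1 + M0 * q * (del * Sg)).
    move=> s us; apply: le_trans (ler_sum _ (fun x _ => pointwise x)) _.
    rewrite big_split /= -!mulr_sumr; apply: lerD.
      by rewrite ler_wpM2l ?hG1 // mulr_ge0 ?exprn_ge0 // ltW // invn_gt0.
    rewrite ler_wpM2l ?mulr_ge0 ?(ltW M0_gt0) //.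
    (* Cauchy-Schwarz pairs the tail of [e], of square sum at most [del ^+ 2], with the kernel, of
       square sum at most [Sg ^+ 2]. *)
    apply: ler_of_sqr; first by rewrite mulr_ge0 // ltW.
    apply: le_trans (cauchy_schwarz_sum _ _ _) _.
    rewrite exprMn; apply: ler_pM; try by apply: sumr_ge0 => x _; exact: sqr_ge0.
      apply: le_trans (hr s us); apply: ler_sum => x _.
      by case: ifP => _; rewrite ?expr0n // sqr_sqrtr // nsq_ge0.
    rewrite sqr_sqrtr ?exprn_ge0 //; apply: le_trans (summable_invn R xi us).
    by apply: ler_sum => x _; rewrite mulnC exprM.
  apply: le_trans (rep xi _ hsum) _.
  have -> : C * (2 ^+ d * Y xi ^+ d * G1 + M0 * q * (del * Sg)) =
      C * 2 ^+ d * G1 * Y xi ^+ d + q / (2 ^+ d * 2).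
    by rewrite /del; field; rewrite !gt_eqF ?exprn_gt0.
  have D1 : 1 <= 2 ^+ d :> R by rewrite exprn_ege1 // ler1n.
  have D0 : 0 < 2 ^+ d :> R by rewrite exprn_gt0.
  have -> : q / (2 ^+ d * 2) = Kc / 2 * Y xi ^+ d + tau / 2 * (2 ^+ d)^-1.
    by rewrite /q; field; rewrite gt_eqF.
  have t1 : tau / 2 * (2 ^+ d)^-1 <= tau / 2.
    by rewrite ler_piMr ?divr_ge0 // invf_le1.
  have t2 : C * 2 ^+ d * G1 * Y xi ^+ d <= Kc / 2 * Y xi ^+ d.
    by rewrite ler_pM2r // /Kc; lra.
  lra.
have iter k : P (Num.sqrt B / 2 ^+ k).
  elim: k => [|k IH].
    move=> xi; rewrite expr0 divr1; apply: le_trans (e_le xi) _.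
    by rewrite lerDr mulr_ge0 ?exprn_ge0 // ltW // invn_gt0.
  rewrite exprSr invfM mulrA; apply: step IH.
  by apply: divr_ge0; [exact: sqrtr_ge0|exact: exprn_ge0].
move=> xi; apply: (le_of_eps (sqrtr_ge0 B)) => ep ep0.
pose k := (Num.truncn ep^-1).+1.
apply: le_trans (iter k xi) _; rewrite lerD2l ler_wpM2l ?sqrtr_ge0 //.
rewrite invf_ple ?posrE ?exprn_gt0 //.
apply: le_trans (ltW (truncnS_gt _)) _; rewrite -natrX ler_nat.
by apply: ltnW; apply: ltn_expl.
Qed.

(** Far from [xi] the kernel already has the required decay and the load is summable. Near [xi] the
    load is of order [Y xi ^+ (2 * d)]; this exceeds the required [d + j] powers by [d - j], and the
    surplus makes the kernel summable. *)
Lemma bootstrap_derivatives G1 Kc : 0 <= G1 -> summable_by (fun x => ag x) G1 ->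
  0 < Kc -> (forall xi, e xi <= Kc * Y xi ^+ d) ->
  exists2 C', 0 < C' & forall j xi, (j <= d)%N ->
    summable_by (fun x => ag x * Y (x - xi) ^+ (d + j)) (C' * Y xi ^+ (d + j)).
Proof.
move=> G10 hG1 Kc0 he.
pose C1 := G1 * (1 + (r0 + r0))%:R ^+ (2 * d).
pose C2 := 4 ^+ d * G1; pose C3 := M0 * Kc ^+ 2 * 4 ^+ d * 4 ^+ d.
have C10 : 0 <= C1 by rewrite mulr_ge0 ?exprn_ge0.
have C20 : 0 <= C2 by rewrite mulr_ge0 ?exprn_ge0.
have C30 : 0 < C3 by rewrite !mulr_gt0 ?exprn_gt0.
exists (C1 + C2 + C3); first by rewrite ltr_wpDl // addr_ge0.
move=> j xi jd s us.
have Y0 : 0 < Y xi := invn_gt0 R xi.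
have Yp0 : 0 < Y xi ^+ (d + j) by rewrite exprn_gt0.
have dj : (d + j <= 2 * d)%N by move: jd; clear; lia.
have [hxi|hxi] := ltnP (nrm xi) (r0 + r0)%N.
  apply: le_trans (_ : G1 <= _).
    apply: le_trans (hG1 s us); apply: ler_sum => x _.
    by rewrite ler_piMr ?sqrtr_ge0 // exprn_ile1 ?invn_le1 // ltW // invn_gt0.
  have : 1 <= (1 + (r0 + r0))%:R ^+ (2 * d) * Y xi ^+ (d + j).
    apply: le_trans (_ : ((1 + (r0 + r0))%:R * Y xi) ^+ (d + j) <= _).
      by rewrite exprn_ege1 // ler_pdivlMr ?ltr0n // mul1r ler_nat leq_add2l ltnW.
    by rewrite exprMn ler_wpM2r ?(ltW Yp0) // ler_weXn2l // ler1n.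
  move=> h; have := ler_wpM2l G10 h; rewrite mulr1 mulrA -/C1.
  have := mulr_ge0 C20 (ltW Yp0); have := mulr_gt0 C30 Yp0; lra.
have pointwise x : ag x * Y (x - xi) ^+ (d + j) <= 4 ^+ d * Y xi ^+ (d + j) * ag x +
    M0 * Kc ^+ 2 * 4 ^+ d * Y xi ^+ (d + j) * Y (x - xi) ^+ (2 * d).
  have Yx0 : 0 < Y (x - xi) := invn_gt0 R _.
  have a0 : 0 <= ag x := sqrtr_ge0 _.
  have [hf|[hn hn2]] := far_or_near x xi.
    apply: le_trans (_ : 4 ^+ d * Y xi ^+ (d + j) * ag x <= _); last first.
      rewrite lerDl mulr_ge0 ?exprn_ge0 ?(ltW Yx0) // mulr_ge0 ?(ltW Yp0) //.
      by rewrite mulr_ge0 ?exprn_ge0 // mulr_ge0 ?sqr_ge0 // ltW.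
    rewrite mulrC ler_wpM2r //.
    apply: le_trans (_ : (2 * Y xi) ^+ (d + j) <= _).
      by rewrite lerXn2r ?nnegrE ?mulr_ge0 ?(ltW Yx0) ?(ltW Y0) // invn_near.
    rewrite exprMn ler_wpM2r ?(ltW Yp0) //.
    rewrite (_ : 4 = 2 ^+ 2); last by ring.
    by rewrite -exprM ler_weXn2l // ler1n.
  apply: le_trans (_ : M0 * Kc ^+ 2 * 4 ^+ d * Y xi ^+ (d + j) * Y (x - xi) ^+ (2 * d) <= _); last first.
    by rewrite lerDr mulr_ge0 // mulr_ge0 ?exprn_ge0 // ltW.
  have hx0 : (r0 <= nrm x)%N by move: hxi hn; clear; lia.
  have Yx : Y x <= 2 * Y xi by exact: invn_near.
  have hg : ag x <= M0 * Kc ^+ 2 * 4 ^+ d * Y xi ^+ (2 * d).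
    apply: le_trans (g_quadratic hx0) _; rewrite -2!mulrA ler_pM2l //.
    rewrite -[leLHS](@sqr_sqrtr R) ?nsq_ge0 //.
    apply: le_trans (_ : (Kc * Y x ^+ d) ^+ 2 <= _).
      by rewrite lerXn2r ?nnegrE ?sqrtr_ge0 ?mulr_ge0 ?exprn_ge0 ?(ltW Kc0) ?invn_ge0.
    rewrite exprMn ler_pM2l ?exprn_gt0 // -exprM mulnC.
    rewrite (_ : 4 = 2 ^+ 2); last by ring.
    rewrite -exprM -exprMn lerXn2r ?nnegrE ?mulr_ge0 ?(ltW Y0) ?invn_ge0 //.
  (* The surplus factor [Y xi ^+ (d - j)] is replaced by [Y (x - xi) ^+ (d - j)], which is larger
     because [x] is no farther from [xi] than the origin is. *)
  have hY : Y xi ^+ (2 * d) * Y (x - xi) ^+ (d + j) <= Y xi ^+ (d + j) * Y (x - xi) ^+ (2 * d).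
    have -> : (2 * d = (d + j) + (d - j))%N by move: jd; clear; lia.
    rewrite ![_ ^+ (d + j + _)]exprD -mulrA ler_pM2l // mulrC ler_pM2l ?exprn_gt0 //.
    rewrite lerXn2r ?nnegrE ?(ltW Y0) ?(ltW Yx0) //.
    by rewrite lef_pV2 ?posrE ?ltr0n // ler_nat leq_add2l.
  apply: le_trans (ler_wpM2r (exprn_ge0 _ (ltW Yx0)) hg) _.
  rewrite -[leLHS]mulrA -[leRHS]mulrA ler_wpM2l // mulr_ge0 ?exprn_ge0 //.
  by rewrite mulr_ge0 ?sqr_ge0 // ltW.
apply: le_trans (ler_sum _ (fun x _ => pointwise x)) _.
rewrite big_split /= -!mulr_sumr.
have h1 := hG1 s us; have h2 := summable_invn R xi us.
have p1 : 0 <= 4 ^+ d * Y xi ^+ (d + j) by rewrite mulr_ge0 ?exprn_ge0 // ltW.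
have p2 : 0 <= M0 * Kc ^+ 2 * 4 ^+ d * Y xi ^+ (d + j).
  by rewrite mulr_ge0 ?(ltW Yp0) // mulr_ge0 ?exprn_ge0 // mulr_ge0 ?sqr_ge0 // ltW.
have := ler_wpM2l p1 h1; have := ler_wpM2l p2 h2.
have -> : 4 ^+ d * Y xi ^+ (d + j) * G1 = C2 * Y xi ^+ (d + j) by rewrite /C2; ring.
have -> : M0 * Kc ^+ 2 * 4 ^+ d * Y xi ^+ (d + j) * 4 ^+ d = C3 * Y xi ^+ (d + j) by rewrite /C3; ring.
have := mulr_ge0 C10 (ltW Yp0); lra.
Qed.

End Bootstrap.

(** * Calculus on the potentials *)

Section DirectionalCalculus.
Variables (R : realType) (n m : nat).
Local Notation E := 'M[R]_(n, m).
Implicit Types (f : E -> R) (a x y z : E).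

Lemma derive_translate f b a x : 'D_x (fun g => f (b + g)) a = 'D_x f (b + a).
Proof.
rewrite /derive; set F := fun h => _; set G := fun h => _.
suff -> : F = G by [].
by apply/funext => h; rewrite /F /G /= addrCA.
Qed.

Lemma derivable_translate f b a x : derivable f (b + a) x -> derivable (fun g => f (b + g)) a x.
Proof.
rewrite /derivable; set F := fun h => _; set G := fun h => _.
suff -> : G = F by [].
by apply/funext => h; rewrite /F /G /= addrCA.
Qed.

Lemma derivable_line f a x t : derivable f (a + t *: x) x ->
  is_derive t 1 (fun s : R => f (a + s *: x)) ('D_x f (a + t *: x)).
Proof.
move=> df.
have e : (fun h : R => h^-1 *: (((fun s : R => f (a + s *: x)) \o shift t) (h *: (1 : R)) - f (a + t *: x))) =
    (fun h => h^-1 *: ((f \o shift (a + t *: x)) (h *: x) - f (a + t *: x))).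
  apply/funext => h /=; congr (_ *: (f _ - _)).
  by rewrite [h *: 1]mulr1 scalerDl addrCA.
by split; rewrite /derivable /derive e.
Qed.

Lemma mvt_line f a x t : 0 <= t -> (forall g, derivable f g x) ->
  exists2 c, 0 <= c <= t & f (a + t *: x) - f a = t * 'D_x f (a + c *: x).
Proof.
move=> t0 df; pose phi (s : R) := f (a + s *: x).
have hd (s : R) : is_derive s 1 phi ('D_x f (a + s *: x)) by exact: derivable_line.
have [|c hc] := @MVT_segment R phi (fun s => 'D_x f (a + s *: x)) 0 t t0 (fun s _ => hd s).
  apply: continuous_subspaceT => s; apply: differentiable_continuous.
  by apply/derivable1_diffP; exact: ex_derive.
rewrite /phi scale0r addr0 subr0 => h; exists c; first by move: hc; rewrite in_itv.
by rewrite h mulrC.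
Qed.

Lemma sqr_norm_le x : `|x| ^+ 2 <= nsq x.
Proof.
have [->|xn] := eqVneq `|x| 0; first by rewrite expr0n nsq_ge0.
have [i hi] := @mx_norm_neq0 R n m x xn.
have -> : `|x| = `|x i.1 i.2| by exact: hi.
by rewrite real_normK ?num_real // sqr_entry_le.
Qed.

Lemma norm_delta_le k i : `|delta_mx k i : E| <= 1.
Proof.
have [->|xn] := eqVneq `|delta_mx k i : E| 0; first exact: ler01.
have [j hj] := @mx_norm_neq0 R n m _ xn.
have -> : `|delta_mx k i : E| = `|(delta_mx k i : E) j.1 j.2| by exact: hj.
by rewrite mxE; case: (_ && _); rewrite ?normr1 ?normr0.
Qed.

Variables (f : E -> R) (M : R).
Hypothesis f_C4 : Ck 4 f.
Hypothesis f_bound : derivs_bounded_by M f.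

Local Notation D1 y := (fun g => 'D_y f g).
Local Notation D2 x y := (fun g => 'D_x (fun g => 'D_y f g) g).

Lemma diff0 g : differentiable f g.
Proof. exact: f_C4.1. Qed.

Lemma diff1 y g : differentiable (D1 y) g.
Proof. exact: (f_C4.2 y).1. Qed.

Lemma diff2 x y g : differentiable (D2 x y) g.
Proof. exact: ((f_C4.2 y).2 x).1. Qed.

Lemma derive_linear (h : E -> R) g x t y : differentiable h g ->
  'D_(x + t *: y) h g = 'D_x h g + t * 'D_y h g.
Proof. by move=> dh; rewrite !deriveE // linearD linearZ. Qed.

Lemma hessian_linear_l a x t y z :
  'D_(x + t *: y) (D1 z) a = 'D_x (D1 z) a + t * 'D_y (D1 z) a.
Proof. by rewrite derive_linear //; exact: diff1. Qed.

Lemma M_abs_bound hs g : (1 <= size hs <= 4)%N ->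
  `|iter_deriv hs f g| <= `|M| * \prod_(h <- hs) `|h|.
Proof.
move=> hsz; apply: le_trans (f_bound hsz g) _; rewrite ler_wpM2r ?ler_norm //.
by apply: prodr_ge0 => h _.
Qed.

Lemma hessian_bound a x y : `|'D_x (D1 y) a| <= `|M| * (nsq x + nsq y).
Proof.
have := @M_abs_bound [:: x; y] a isT; rewrite !big_cons big_nil mulr1 => /le_trans; apply.
rewrite ler_wpM2l //; have := sqr_norm_le x; have := sqr_norm_le y.
have := sqr_ge0 (`|x| - `|y|); have := sqr_ge0 `|x|; have := sqr_ge0 `|y|; nra.
Qed.

Lemma third_bound a x y z : `|'D_z (D2 x y) a| <= `|M| * (`|z| * `|x| * `|y|).
Proof.
by have := @M_abs_bound [:: z; x; y] a isT; rewrite !big_cons big_nil mulr1 !mulrA.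
Qed.

Lemma hessian_lipschitz a x y z :
  `|'D_x (D1 y) (a + z) - 'D_x (D1 y) a| <= `|M| * (`|z| * `|x| * `|y|).
Proof.
have [|c _] := @mvt_line (D2 x y) a z 1 ler01.
  by move=> g; exact/diff_derivable/diff2.
by rewrite scale1r mul1r => ->; exact: third_bound.
Qed.

Lemma second_difference a x y t : 0 <= t -> exists2 z : E, `|z| <= t * (`|x| + `|y|) &
  f (a + t *: x + t *: y) - f (a + t *: x) - (f (a + t *: y) - f a)
    = t * (t * 'D_y (D1 x) (a + z)).
Proof.
move=> t0.
pose F g := f (t *: y + g) - f g.
have dF g : derivable F g x.
  apply: derivableB; last exact/diff_derivable/diff0.
  by apply: derivable_translate; exact/diff_derivable/diff0.
have [c /andP[c0 ct] h] := mvt_line a t0 dF.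
have e : 'D_x F (a + c *: x) = 'D_x f (t *: y + (a + c *: x)) - 'D_x f (a + c *: x).
  rewrite deriveB ?derive_translate //; last exact/diff_derivable/diff0.
  by apply: derivable_translate; exact/diff_derivable/diff0.
have [|c' /andP[c'0 c't] h'] := @mvt_line (D1 x) (a + c *: x) y t t0.
  by move=> g; exact/diff_derivable/diff1.
exists (c *: x + c' *: y).
  apply: le_trans (ler_normD _ _) _; rewrite !normrZ !ger0_norm // mulrDr.
  by apply: lerD; rewrite ler_wpM2r.
move: h; rewrite e /F => h.
rewrite addrA -h' (addrC (a + c *: x)) -h !(addrC (t *: y)) //.
Qed.

Lemma close_le (p q r s b c : R) : `|r - p| <= b -> `|s - q| <= c -> r = s -> q <= p + (b + c).
Proof. by rewrite !ler_norml => /andP[_ h1] /andP[h2 _] e; lra. Qed.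

Lemma third_bound_mono (k : R) (p q r : E) : `|p| <= k ->
  `|M| * (`|p| * `|q| * `|r|) <= `|M| * (k * `|q| * `|r|).
Proof. by move=> hp; rewrite ler_wpM2l // ler_wpM2r // ler_wpM2r. Qed.

(** Iterated directional derivatives do not commute by definition. The second difference is
    symmetric in the two directions, and it is [t^2] times a mixed derivative at a point within
    order [t] of [a]; the third-derivative bound lets [t] tend to 0. *)
Lemma hessian_sym a x y : 'D_x (D1 y) a = 'D_y (D1 x) a.
Proof.
suff le u v : 'D_u (D1 v) a <= 'D_v (D1 u) a by apply: le_anti; apply/andP; split; exact: le.
pose b := 2 * (`|M| * ((`|u| + `|v|) * `|u| * `|v|)).
apply: (@le_of_eps R _ _ b) => [|t t0].
  by rewrite mulr_ge0 // mulr_ge0 // !mulr_ge0 // addr_ge0.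
have [z hz e1] := second_difference a u v (ltW t0).
have [z' hz' e2] := second_difference a v u (ltW t0).
have e : 'D_v (D1 u) (a + z) = 'D_u (D1 v) (a + z').
  have tn : t != 0 by rewrite gt_eqF.
  apply: (mulfI tn); apply: (mulfI tn); rewrite -e1 -e2.
  by rewrite (addrAC a (t *: u)); ring.
have h1 := hessian_lipschitz a v u z; have h2 := hessian_lipschitz a u v z'.
have {}h1 := le_trans h1 (third_bound_mono v u hz).
have {}h2 := le_trans h2 (third_bound_mono u v hz').
apply: le_trans (close_le h1 h2 e) _; rewrite lerD2l /b.
by rewrite le_eqVlt; apply/orP; left; apply/eqP; ring.
Qed.

Lemma hessian_linear_r a x y t z :
  'D_x (D1 (y + t *: z)) a = 'D_x (D1 y) a + t * 'D_x (D1 z) a.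
Proof. by rewrite hessian_sym hessian_linear_l !(hessian_sym a x). Qed.

Lemma gradient_taylor a x y :
  `|'D_y f (a + x) - 'D_y f a - 'D_x (D1 y) a| <= `|M| * (`|x| ^+ 2 * `|y|).
Proof.
have [|c /andP[c0 c1]] := @mvt_line (D1 y) a x 1 ler01.
  by move=> g; exact/diff_derivable/diff1.
rewrite scale1r mul1r => ->.
apply: le_trans (hessian_lipschitz _ _ _ _) _; rewrite ler_wpM2l // ler_wpM2r //.
by rewrite expr2 ler_wpM2r // normrZ ger0_norm // ler_piMl.
Qed.

End DirectionalCalculus.

(** * Geometry of the lattice and assembly *)

Section Geometry.
Variables (R : realType) (d : nat).
Implicit Types (F : 'M[R]_d) (x : Zsite d).

Lemma nsq_mulmx_le p q r (X : 'M[R]_(p, q)) (Z : 'M[R]_(q, r)) : nsq (X *m Z) <= nsq X * nsq Z.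
Proof.
have nsqE a b (W : 'M[R]_(a, b)) : nsq W = \sum_i \sum_j W i j ^+ 2.
  by rewrite /nsq -(pair_bigA _ (fun i j => W i j ^+ 2)).
rewrite (nsqE p q) (nsqE p r) mulr_suml; apply: ler_sum => i _.
rewrite (nsqE q r) exchange_big /= mulr_sumr; apply: ler_sum => j _.
by rewrite mxE; exact: cauchy_schwarz_sum.
Qed.

Lemma enormE n (y : 'cV[R]_n) : enorm y = Num.sqrt (nsq y).
Proof.
rewrite /enorm /nsq -(pair_bigA _ (fun i j => y i j ^+ 2)) /=; congr Num.sqrt.
by apply: eq_bigr => i _; rewrite big_ord1.
Qed.

Definition zvec x : 'cV[R]_d := map_mx (fun z : int => z%:~R) x.

Lemma nsq_zvec_le x : nsq (zvec x) <= d%:R * (nrm x)%:R ^+ 2.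
Proof.
rewrite /nsq -(pair_bigA _ (fun i j => zvec x i j ^+ 2)) /=.
apply: le_trans (_ : \sum_(i < d) (nrm x)%:R ^+ 2 <= _); last by rewrite sumr_const card_ord mulr_natl.
apply: ler_sum => i _; rewrite big_ord1 mxE -(real_normK (num_real _)) -intr_norm -abszE -pmulrn.
by rewrite lerXn2r ?nnegrE ?ler0n // ler_nat; exact: absz_le_nrm.
Qed.

Lemma nrm_le_zvec x : (nrm x)%:R <= Num.sqrt (nsq (zvec x)).
Proof.
have h i : (absz (x i 0%R))%:R <= Num.sqrt (nsq (zvec x)) :> R.
  apply: le_trans (_ : Num.sqrt (zvec x i 0 ^+ 2) <= _).
    by rewrite sqrtr_sqr mxE -intr_norm -abszE -pmulrn.
  by rewrite ler_sqrt ?nsq_ge0 // sqr_entry_le.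
rewrite /nrm; elim/big_ind: _ => [|a b ha hb|i _]; [exact: sqrtr_ge0| |exact: h].
by rewrite /maxn; case: ifP.
Qed.

Lemma enorm_site_le F x : enorm (site F x) <= Num.sqrt (nsq F * d%:R) * (nrm x)%:R.
Proof.
rewrite enormE -(ger0_norm (ler0n R (nrm x))) -sqrtr_sqr -sqrtrM; last first.
  by rewrite mulr_ge0 ?nsq_ge0.
rewrite ler_sqrt; last by rewrite !mulr_ge0 ?nsq_ge0 // sqr_ge0.
apply: le_trans (nsq_mulmx_le _ _) _; rewrite -mulrA ler_wpM2l ?nsq_ge0 //.
exact: nsq_zvec_le.
Qed.

Lemma nrm_le_enorm_site F x : F \in unitmx ->
  (nrm x)%:R <= Num.sqrt (nsq (invmx F)) * enorm (site F x).
Proof.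
move=> uF; apply: le_trans (nrm_le_zvec x) _.
rewrite enormE -sqrtrM ?nsq_ge0 // ler_sqrt; last by rewrite mulr_ge0 ?nsq_ge0.
have {1}-> : zvec x = invmx F *m site F x by rewrite /site mulKmx.
exact: nsq_mulmx_le.
Qed.

Lemma siteE F x : site F x = F *m zvec x.
Proof. by []. Qed.

(* The midpoint of the cube edge from 0 to e_j lies in some simplex; all
   vertices of the simplex that carry weight are on that edge, and both ends
   are needed. *)
Lemma basis_in_R1 (N m : nat) F (T : {fset {fset Zsite d}}) (rng : 'I_m -> triple d N) :
  F \in unitmx -> cell_triangulation F T ->
  (forall s, s \in T -> forall v w, v \in s -> w \in s -> v != w -> in_R1 rng (w - v)) ->
  forall j : 'I_d, in_R1 rng (delta_mx j 0).
Proof.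
move=> uF [hs hcov _] hR j.
pose t : 'cV[R]_d := 2^-1 *: delta_mx j 0.
have : unit_cell F (F *m t).
  exists t => // i; rewrite !mxE eqxx andbT; case: (i == j); rewrite /= ?mulr1 ?mulr0 ?lexx ?ler01 //.
  by rewrite invr_ge0 ler0n invf_le1 // ler1n.
rewrite hcov => -[s /= sT [w [w0 w1 ht]]].
have {}ht i : t i 0 = \sum_(v <- s) w v * (v i 0)%:~R.
  have : t = \sum_(v <- s) w v *: zvec v.
    rewrite -[LHS](mulKmx uF) ht mulmx_sumr; apply: eq_bigr => v _.
    by rewrite -scalemxAr siteE mulKmx.
  by move=> /matrixP /(_ i 0) ->; rewrite summxE; apply: eq_bigr => v _; rewrite !mxE.
have [_ _ h01] := hs s sT.
have off v i : v \in s -> w v != 0 -> i != j -> v i 0 = 0.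
  move=> vs wv ij; have := ht i; rewrite !mxE (negbTE ij) /= mulr0 => /esym/eqP.
  rewrite big_seq psumr_eq0 => [/allP /(_ v vs)|z zs].
    by rewrite vs /= mulf_eq0 (negbTE wv) /= intr_eq0 => /eqP.
  by rewrite mulr_ge0 ?w0 // ler0z; case: (h01 z zs i) => ->.
have hj := ht j; rewrite !mxE !eqxx mulr1 in hj.
(* The [j]-th coordinate of the midpoint is one half, which is no average of zeros alone or of ones
   alone. *)
have [v1 [v1s w1n v1j]] : exists v, [/\ v \in s, w v != 0 & v j 0 = 1].
  apply: contrapT => hn.
  have : \sum_(v <- s) w v * (v j 0)%:~R = 0.
    rewrite big_seq big1 // => v vs; have [->|wn] := eqVneq (w v) 0; first by rewrite mul0r.
    case: (h01 v vs j) => [->|hv]; first by rewrite mulr0.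
    by case: hn; exists v.
  by rewrite -hj => /eqP; rewrite invr_eq0 pnatr_eq0.
have [v0 [v0s w0n v0j]] : exists v, [/\ v \in s, w v != 0 & v j 0 = 0].
  apply: contrapT => hn.
  have : \sum_(v <- s) w v * (v j 0)%:~R = \sum_(v <- s) w v.
    rewrite big_seq [RHS]big_seq; apply: eq_bigr => v vs.
    have [->|wn] := eqVneq (w v) 0; first by rewrite mul0r.
    case: (h01 v vs j) => [hv|->]; last by rewrite mulr1.
    by case: hn; exists v.
  by rewrite -hj w1; lra.
have e0 : v0 = 0.
  by apply/matrixP => i k; rewrite ord1 mxE; have [->|ij] := eqVneq i j; [|exact: off].
have e1 : v1 = delta_mx j 0.
  by apply/matrixP => i k; rewrite ord1 mxE eqxx andbT; have [->|ij] := eqVneq i j; [|exact: off].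
have := hR s sT v0 v1 v0s v1s; rewrite e0 e1 subr0 => h; apply: h.
apply/eqP => /matrixP /(_ j 0); rewrite !mxE !eqxx //.
Qed.

End Geometry.

(** * The function spaces and the first variation in terms of finite sums *)

Section Spaces.
Variables (R : realType) (d n N m : nat) (rng : 'I_m -> triple d N) (R0 : nat).
Hypothesis HR0 : forall i, (nrm (rng i).1.1 <= R0)%N.
Implicit Types (u v : displacement R d n N) (x xi : Zsite d).
Local Notation D := (@Dstencil R d n N m rng).

Lemma sum_enorm_Dtriple u x : \sum_(i < m) enorm (Dtriple (rng i) u x) ^+ 2 = nsq (D u x).
Proof.
rewrite /nsq -(pair_bigA _ (fun k i => D u x k i ^+ 2)) exchange_big /=.
apply: eq_bigr => i _; rewrite enormE sqr_sqrtr ?nsq_ge0 //.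
rewrite /nsq -(pair_bigA _ (fun k i' => Dtriple (rng i) u x k i' ^+ 2)) /=.
by apply: eq_bigr => k _; rewrite big_ord1 [in RHS]mxE.
Qed.

Lemma sum_le_a1 u (s : seq (Zsite d)) : uniq s ->
  ((\sum_(x <- s) nsq (D u x))%:E <= a1_normsq rng u)%E.
Proof.
move=> us; apply: esum_ge; exists [set` s]; first by split; [exact: finite_seq|].
rewrite -fsbig_seq // -sumEFin; apply: lee_sum => x _.
by rewrite sum_enorm_Dtriple.
Qed.

Lemma in_U_summable u : in_U rng u -> exists B, summable_by (fun x => nsq (D u x)) B.
Proof.
rewrite /in_U => hu; exists (fine (a1_normsq rng u)) => s us.
rewrite -lee_fin fineK; first exact: sum_le_a1.
rewrite ge0_fin_numE //; apply: le_trans (sum_le_a1 u (s := [::]) isT).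
by rewrite big_nil.
Qed.

Lemma fsd_in_U0 v : fsd v -> in_U0 rng v.
Proof.
move=> hv; split.
- apply: le_lt_trans (ltry (energy rng v)).
  apply: ge_ereal_sup => _ [A [fA _] <-].
  rewrite fsbig_finite //= sumEFin lee_fin.
  under eq_bigr do rewrite sum_enorm_Dtriple.
  apply: sum_le_tot; [exact: fset_uniq|exact: (fsupp_en HR0)|by move=> x; exact: nsq_ge0].
- have [r hr] := hv; apply: (@sub_finite_set _ _ [set` zball 0 (r + R0)]); last exact: finite_seq.
  move=> x /= [rho [a [b [i hi]]]]; apply: contraNT; rewrite mem_zball subr0 -ltnNge => hx.
  have hrho : (nrm rho <= R0)%N by have := HR0 i; rewrite hi.
  have h1 : v ord0 x = 0 by apply: hr; rewrite subr0; move: hx; clear; lia.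
  have h2 : v ord0 (x + rho) = 0.
    by apply: hr; rewrite subr0; move: hx hrho (nrm_leD x rho); clear; lia.
  by rewrite /Dsite h1 h2 subrr.
- move=> a; have [r hr] := hv; apply: (@sub_finite_set _ _ [set` zball 0 r]); last exact: finite_seq.
  by move=> x /=; apply: contraNT; rewrite mem_zball subr0 -ltnNge => hx; rewrite !hr ?subrr ?subr0.
Qed.

Lemma energy_le_a1 v : fsd v -> ((energy rng v)%:E <= a1_normsq rng v)%E.
Proof.
move=> hv; have [r hr] := fsupp_en HR0 hv; rewrite /energy (totE hr).
by apply: sum_le_a1; exact: zball_uniq.
Qed.

Definition gradient (W : 'M[R]_(n, m) -> R) (g : 'M[R]_(n, m)) : 'M[R]_(n, m) :=
  \matrix_(k, i) 'D_(delta_mx k i) W g.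

Lemma first_variationE (W_ : Zsite d -> 'M[R]_(n, m) -> R) u v :
  first_variation rng W_ u v = load rng (fun x => gradient (W_ x) (D u x)) v.
Proof.
apply: eq_fsbigr => x _.
rewrite /mdot -(pair_bigA _ (fun k i => gradient (W_ x) (D u x) k i * D v x k i)) exchange_big /=.
by apply: eq_bigr => i _; apply: eq_bigr => k _; rewrite !mxE.
Qed.

End Spaces.

(** * Linearisation of the potential at the reference state *)

Section HessianForm.
Variables (R : realType) (n m : nat) (f : 'M[R]_(n, m) -> R) (M : R) (Dy : 'M[R]_(n, m)).
Hypothesis f_C4 : Ck 4 f.
Hypothesis f_bound : derivs_bounded_by M f.

Definition hessian (x y : 'M[R]_(n, m)) : R := 'D_x (fun g => 'D_y f g) Dy.

(** The matrix representing [hessian x] for the product [mdot]; through it the linearised equation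
    becomes a statement about loads. *)
Definition hessian_row (x : 'M[R]_(n, m)) : 'M[R]_(n, m) :=
  \matrix_(k, i) hessian x (delta_mx k i).

Lemma hessian_mdot x y : hessian x y = mdot (hessian_row x) y.
Proof.
have h0 : hessian x 0 = 0.
  have := hessian_linear_r f_C4 f_bound Dy x 0 1 0.
  by rewrite -/(hessian x _) -/(hessian x 0) scale1r addr0 mul1r; lra.
have hD u v : hessian x (u + v) = hessian x u + hessian x v.
  have := hessian_linear_r f_C4 f_bound Dy x u 1 v.
  by rewrite scale1r mul1r.
have hZ t v : hessian x (t *: v) = t * hessian x v.
  have := hessian_linear_r f_C4 f_bound Dy x 0 t v.
  by rewrite add0r -/(hessian x _) -/(hessian x 0) -/(hessian x v) h0 add0r.
rewrite {1}(matrix_sum_delta y) pair_bigA (big_morph (hessian x) hD h0) /mdot.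
by apply: eq_bigr => e _; rewrite hZ mxE mulrC.
Qed.

(** The first-order Taylor remainder of the gradient. The gradient at the reference state need not
    vanish; only its load on test functions does, so it has to be kept here. *)
Lemma gradient_residual x :
  Num.sqrt (nsq (hessian_row x - gradient f (Dy + x) + gradient f Dy)) <= ((n * m)%:R * `|M|) * nsq x.
Proof.
set z := _ + _.
have hz k i : `|z k i| <= `|M| * nsq x.
  have -> : z k i = - ('D_(delta_mx k i) f (Dy + x) - 'D_(delta_mx k i) f Dy - hessian x (delta_mx k i)).
    by rewrite /z !mxE; ring.
  rewrite normrN; apply: le_trans (gradient_taylor f_C4 f_bound Dy x (delta_mx k i)) _.
  rewrite ler_wpM2l //; apply: le_trans (_ : `|x| ^+ 2 * 1 <= _).
    by rewrite ler_wpM2l ?sqr_ge0 // norm_delta_le.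
  by rewrite mulr1 sqr_norm_le.
have b0 : 0 <= `|M| * nsq x by rewrite mulr_ge0 ?nsq_ge0.
apply: ler_of_sqr; first by rewrite -mulrA mulr_ge0.
rewrite sqr_sqrtr ?nsq_ge0 // -mulrA exprMn.
apply: le_trans (_ : (n * m)%:R * (`|M| * nsq x) ^+ 2 <= _).
  apply: le_trans (_ : \sum_(e : 'I_n * 'I_m) (`|M| * nsq x) ^+ 2 <= _).
    apply: ler_sum => e _; rewrite -(real_normK (num_real _)).
    by rewrite lerXn2r ?nnegrE.
  by rewrite sumr_const card_prod !card_ord [leRHS]mulr_natl.
rewrite ler_wpM2r ?sqr_ge0 // -natrX ler_nat.
by case: (n * m)%N => // k; rewrite expnS leq_pmulr // expn_gt0.
Qed.

End HessianForm.

(** * From stencils to single displacements *)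

Section Decay.
Variables (R : realType) (d n N m : nat) (rng : 'I_m -> triple d N).
Variables (A : 'M[R]_(n, m) -> 'M[R]_(n, m) -> R) (K gamma : R) (R0 : nat).
Hypothesis d_gt0 : (0 < d)%N.
Hypothesis HR0 : forall i, (nrm (rng i).1.1 <= R0)%N.
Hypothesis R0_gt0 : (0 < R0)%N.
Hypothesis rng_basis : forall j : 'I_d, in_R1 rng (delta_mx j 0).
Hypothesis rng_species : forall a b : 'I_N.+1, a != b -> exists i, rng i = (0, a, b).
Hypothesis A_linear : forall x t y z, A (x + t *: y) z = A x z + t * A y z.
Hypothesis A_sym : forall x y, A x y = A y x.
Hypothesis A_bound : forall x y, `|A x y| <= K * (nsq x + nsq y).
Hypothesis K_gt0 : 0 < K.
Local Notation D := (@Dstencil R d n N m rng).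
Implicit Types (x xi rho : Zsite d) (J : seq (Zsite d)).
Hypothesis gamma_gt0 : 0 < gamma.
Hypothesis coercive : forall v, fsd v -> gamma * energy rng v <= eform rng A v v.

Variables (u : displacement R d n N) (g : Zsite d -> 'M[R]_(n, m)) (B M0 : R) (r0 : nat).
Hypothesis u_sum : summable_by (fun x => nsq (D u x)) B.
Hypothesis u_eq : forall psi, fsd psi -> eform rng A u psi = load rng g psi.
Hypothesis M0_gt0 : 0 < M0.
Hypothesis g_quadratic : forall x, (r0 <= nrm x)%N -> Num.sqrt (nsq (g x)) <= M0 * nsq (D u x).

Lemma stencil_decay : exists2 C : R, 0 < C & forall J xi, short R0 J -> (size J <= d)%N ->
  Num.sqrt (nsq (diffs J (D u) xi)) <= C * invn R xi ^+ (d + size J).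
Proof.
have [C0 C00 rep] := decay_representation d_gt0 HR0 R0_gt0 rng_basis rng_species A_linear A_sym
  A_bound K_gt0 gamma_gt0 coercive.
have [G1 G10 hG1] := load_summable M0_gt0 u_sum g_quadratic.
have hG := load_sq_summable hG1.
have rep' J xi Bd : short R0 J -> (size J <= d)%N ->
    summable_by (fun x => Num.sqrt (nsq (g x)) * invn R (x - xi) ^+ (d + size J)) Bd ->
    Num.sqrt (nsq (diffs J (D u) xi)) <= Num.sqrt C0 * Bd.
  move=> sJ lJ hBd; have Bd0 : 0 <= Bd by have := hBd [::] isT; rewrite big_nil.
  rewrite -[X in _ * X](ger0_norm Bd0) -sqrtr_sqr -sqrtrM ?(ltW C00) // ler_sqrt; last first.
    by rewrite mulr_ge0 ?sqr_ge0 // ltW.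
  exact: (rep u g B _ G1 u_sum hG hG1 u_eq J xi Bd sJ lJ hBd).
have sC0 : 0 < Num.sqrt C0 by rewrite sqrtr_gt0.
have [|Kc Kc0 hKc] := bootstrap_decay sC0 M0_gt0 u_sum g_quadratic.
  by move=> xi Bd hBd; apply: (rep' [::] xi Bd isT isT); rewrite addn0.
have [C' C'0 hC'] := bootstrap_derivatives M0_gt0 g_quadratic G10 hG1 Kc0 hKc.
exists (Num.sqrt C0 * C') => [|J xi sJ lJ]; first by rewrite mulr_gt0.
by rewrite -mulrA; apply: rep' => //; exact: hC'.
Qed.

Lemma invn_shift x rho : (nrm rho <= R0)%N -> invn R (x + rho) <= (1 + R0)%:R * invn R x.
Proof.
move=> h; rewrite /invn ler_pdivlMr ?ltr0n // mulrC ler_pdivrMr ?ltr0n // -natrM ler_nat.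
have := nrm_leD x rho; move: h; move: (nrm x) (nrm rho) (nrm (x + rho)) => a b c; clear.
by move=> h1 h2; nia.
Qed.

Lemma species_difference_decay J (a b : 'I_N.+1) xi C : short R0 J -> (size J <= d)%N -> 0 < C ->
  (forall J xi, short R0 J -> (size J <= d)%N ->
    Num.sqrt (nsq (diffs J (D u) xi)) <= C * invn R xi ^+ (d + size J)) ->
  enorm (diffs J (fun x => u b x - u a x) xi) <= C * invn R xi ^+ (d + size J).
Proof.
move=> sJ lJ C0 h; rewrite enormE; apply: le_trans (h J xi sJ lJ).
rewrite ler_sqrt ?nsq_ge0 //; have [->|ab] := eqVneq a b.
  have -> : diffs J (fun x => u b x - u b x) xi = 0.
    rewrite (_ : (fun x => _) = fun=> 0); last by apply/funext => x; rewrite subrr.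
    by elim: (J) xi => //= rho J' IH xi; rewrite /df !IH subrr.
  by rewrite nsq0 nsq_ge0.
have [i hi] := rng_species ab.
rewrite /nsq -(pair_bigA _ (fun k j => diffs J (fun x => u b x - u a x) xi k j ^+ 2)) /=.
rewrite -(pair_bigA _ (fun k j => diffs J (D u) xi k j ^+ 2)) /=.
apply: ler_sum => k _; rewrite big_ord1 (bigD1 i) //=.
have -> : diffs J (fun x => u b x - u a x) xi k 0 = diffs J (D u) xi k i.
  rewrite -(@diffs_morph d _ _ (fun X : 'M[R]_(n, m) => X k i)); last by move=> X Z; rewrite !mxE.
  rewrite -(@diffs_morph d _ _ (fun X : 'cV[R]_n => X k 0)); last by move=> X Z; rewrite !mxE.
  congr (diffs J _ xi); apply/funext => x; by rewrite DE hi /= addr0 !mxE.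
by rewrite lerDl; apply: sumr_ge0 => j _; exact: sqr_ge0.
Qed.

Lemma enormD p (x y : 'cV[R]_p) : enorm (x + y) <= 2 * enorm x + 2 * enorm y.
Proof.
apply: ler_of_sqr; first by rewrite addr_ge0 // mulr_ge0 // sqrtr_ge0.
rewrite !enormE sqr_sqrtr ?nsq_ge0 //; apply: le_trans (nsqD _ _) _.
have := sqr_sqrtr (nsq_ge0 x); have := sqr_sqrtr (nsq_ge0 y).
have := sqrtr_ge0 (nsq x); have := sqrtr_ge0 (nsq y).
move: (Num.sqrt (nsq x)) (Num.sqrt (nsq y)) => p1 q1 p0 q0 <- <-; nra.
Qed.

(** A bond of offset [rho] may join species [a] and [b] other than species 0. The difference of
    [u ord0] is then the bond difference plus the shift of [a] at [xi] minus the shift of [b] at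
    [xi + rho]. All three have the decay of a stencil entry. *)
Lemma displacement_decay : exists2 C : R, 0 < C & forall J xi, short R0 J -> (size J <= d)%N ->
  (forall a : 'I_N.+1, enorm (diffs J (fun x => u a x - u ord0 x) xi) <= C * invn R xi ^+ (d + size J)) /\
  (forall rho, in_R1 rng rho ->
    enorm (diffs (rho :: J) (u ord0) xi) <= C * invn R xi ^+ (d + size J)).
Proof.
have [C C0 hC] := stencil_decay.
pose Q : R := (1 + R0)%:R ^+ (2 * d).
have Q1 : 1 <= Q by rewrite exprn_ege1 // ler1n.
have Q0 : 0 < Q by exact: lt_le_trans Q1.
(* Each of two splittings by [enormD] doubles: 2 for the bond, 4 for the shift at [xi], and [4 * Q]
   for the shift at [xi + rho]. *)
exists (C * (6 + 4 * Q)); first by rewrite mulr_gt0 // addr_gt0 // mulr_gt0.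
move=> J xi sJ lJ.
have Y0 : 0 <= invn R xi ^+ (d + size J) by rewrite exprn_ge0 // invn_ge0.
have CY0 := mulr_ge0 (ltW C0) Y0.
split=> [a|rho [a [b [i hi]]]].
  apply: le_trans (species_difference_decay ord0 a xi sJ lJ C0 hC) _.
  by rewrite mulrAC; nra.
have hrho : (nrm rho <= R0)%N by have := HR0 i; rewrite hi.
rewrite /= -diffs_df.
pose P a b := (fun x => u b x - u a x : 'cV[R]_n).
pose T0 := fun x => Dtriple (rng i) u x.
have e : df rho (u ord0) = (fun x => T0 x + (P ord0 a x - P ord0 b (x + rho))).
  apply/funext => x; rewrite /df /T0 DtripleE hi /P /=.
  by apply/matrixP => k l; rewrite !mxE; ring.
have dD (h1 h2 : Zsite d -> 'cV[R]_n) y : diffs J (fun x => h1 x + h2 x) y = diffs J h1 y + diffs J h2 y.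
  by elim: (J) y => //= r J' IH y; rewrite /df !IH opprD addrACA.
have dN (h1 : Zsite d -> 'cV[R]_n) y : diffs J (fun x => - h1 x) y = - diffs J h1 y.
  by elim: (J) y => //= r J' IH y; rewrite /df !IH opprD.
rewrite e dD dD dN.
have hT : enorm (diffs J T0 xi) <= C * invn R xi ^+ (d + size J).
  rewrite enormE; apply: le_trans (hC J xi sJ lJ); rewrite ler_sqrt ?nsq_ge0 //.
  rewrite /nsq -(pair_bigA _ (fun k j => diffs J T0 xi k j ^+ 2)) /=.
  rewrite -(pair_bigA _ (fun k j => diffs J (D u) xi k j ^+ 2)) /=.
  apply: ler_sum => k _; rewrite big_ord1 (bigD1 i) //=.
  have -> : diffs J T0 xi k 0 = diffs J (D u) xi k i.
    rewrite -(@diffs_morph d _ _ (fun X : 'M[R]_(n, m) => X k i)); last by move=> X Z; rewrite !mxE.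
    rewrite -(@diffs_morph d _ _ (fun X : 'cV[R]_n => X k 0)); last by move=> X Z; rewrite !mxE.
    by congr (diffs J _ xi); apply/funext => x; rewrite mxE.
  by rewrite lerDl; apply: sumr_ge0 => j _; exact: sqr_ge0.
have hPa := species_difference_decay ord0 a xi sJ lJ C0 hC.
have hPb := species_difference_decay ord0 b (xi + rho) sJ lJ C0 hC.
rewrite (diffs_shift J (P ord0 b)).
have hY : invn R (xi + rho) ^+ (d + size J) <= Q * invn R xi ^+ (d + size J).
  apply: le_trans (_ : ((1 + R0)%:R * invn R xi) ^+ (d + size J) <= _).
    by rewrite lerXn2r ?nnegrE ?mulr_ge0 ?invn_ge0 // invn_shift.
  rewrite exprMn ler_wpM2r // ler_weXn2l // ?ler1n //.
  by move: lJ; clear; lia.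
have {}hPb := le_trans hPb (ler_wpM2l (ltW C0) hY).
apply: le_trans (enormD _ _) _.
have := enormD (diffs J (P ord0 a) xi) (- diffs J (P ord0 b) (xi + rho)).
rewrite [enorm (- _)]enormE nsqN -enormE.
move: hT hPa hPb; rewrite -/(P ord0 a) -/(P ord0 b).
move: (enorm (diffs J T0 xi)) (enorm (diffs J (P ord0 a) xi)) (enorm (diffs J (P ord0 b) (xi + rho)))
  (enorm (_ - _)) => t1 t2 t3 t4.
move: CY0 Q1; rewrite mulrCA (mulrAC C); move: (C * invn R xi ^+ _) => Z Z0 Q1 h1 h2 h3 h4.
have := ler_wpM2r Z0 Q1; lra.
Qed.

End Decay.

(** * Translation of the hypotheses and comparison of weights *)

Section Assembly.
Variables (R : realType) (d n N m : nat) (rng : 'I_m -> triple d N).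
Implicit Types (x : Zsite d).

Lemma derive_translate_sub (f : 'M[R]_(n, m) -> R) b c a h :
  'D_h (fun g => f (b + g) - c) a = 'D_h f (b + a).
Proof.
rewrite /derive; set F1 := fun t => _; set G1 := fun t => _.
suff -> : F1 = G1 by [].
by apply/funext => t; rewrite /F1 /G1 /= addrCA; congr (_ *: _); ring.
Qed.

Lemma gradient_Vdef (Dy g : 'M[R]_(n, m)) W W0 : gradient (Vdef Dy W W0) g = gradient W (Dy + g).
Proof. by apply/matrixP => k i; rewrite !mxE derive_translate_sub. Qed.

Lemma second_variation0E (Dy : 'M[R]_(n, m)) f (v : displacement R d n N) :
  second_variation0 rng (Vhom Dy f) v v = eform rng (hessian f Dy) v v.
Proof.
apply: eq_fsbigr => x _; rewrite /hessian.
rewrite (_ : (fun g => 'D_(Dstencil rng v x) (Vhom Dy f) g) =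
  (fun g => (fun g' => 'D_(Dstencil rng v x) f g') (Dy + g))).
  by rewrite (derive_translate (fun g => 'D_(Dstencil rng v x) f g)) addr0.
by apply/funext => g; exact: derive_translate_sub.
Qed.

Lemma load_addl (R0 : nat) (a b : Zsite d -> 'M[R]_(n, m)) t (v : displacement R d n N) :
  (forall i, (nrm (rng i).1.1 <= R0)%N) -> fsd v ->
  load rng (fun x => a x + t *: b x) v = load rng a v + t * load rng b v.
Proof.
move=> h hv; rewrite /load -totZ; last exact: (fsupp_pr h).
rewrite -totD; [|exact: (fsupp_pr h)|exact/fsuppZ/(fsupp_pr h)].
by apply: eq_fsbigr => x _; rewrite mdotC mdotDr mdotZr ![mdot (Dstencil _ _ _) _]mdotC.
Qed.

Lemma far_sites (F : 'M[R]_d) (Rdef : R) : F \in unitmx -> 0 < Rdef ->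
  exists r0 : nat, forall x, (r0 <= nrm x)%N -> Rdef <= enorm (site F x).
Proof.
move=> uF R0; set c := Num.sqrt (nsq (invmx F)).
exists (Num.truncn (c * Rdef)).+1 => x hx; rewrite leNgt; apply/negP => hlt.
have h1 := nrm_le_enorm_site x uF.
have h2 : c * Rdef < (nrm x)%:R by apply: lt_le_trans (truncnS_gt _) _; rewrite ler_nat.
have := lt_le_trans h2 h1; rewrite -/c; apply/negP; rewrite -leNgt.
by rewrite ler_wpM2l ?sqrtr_ge0 // ltW.
Qed.

Lemma invn_le_enorm (F : 'M[R]_d) x :
  invn R x <= (1 + Num.sqrt (nsq F * d%:R)) * (1 + enorm (site F x))^-1.
Proof.
have e0 : 0 <= enorm (site F x) := sqrtr_ge0 _.
have h := enorm_site_le F x; have s0 := sqrtr_ge0 (nsq F * d%:R).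
rewrite /invn ler_pdivlMr ?ltr_wpDr // mulrC ler_pdivrMr ?ltr0n // natrD mulrDr mulr1.
have := ler0n R (nrm x); move: h s0; move: (Num.sqrt _) (enorm _) (nrm x)%:R => a b c; lra.
Qed.

End Assembly.

Theorem theorem2p4 (R : realType) (d n N m : nat)
  (hd : d = 2%N \/ d = 3%N) (hn : n = d \/ d = 2%N /\ n = 3%N)
  (F : 'M[R]_d) (hF : \det F = 1)
  (p : 'I_N.+1 -> 'cV[R]_d) (hp : p ord0 = 0)
  (rng : 'I_m -> triple d N) (T : {fset {fset Zsite d}})
  (hT : cell_triangulation F T) (hrng : admissible_range F rng T)
  (Rdef : R) (hRdef : 0 < Rdef)
  (Vhat_ : Zsite d -> 'M[R]_(n, m) -> R) (Vhat : 'M[R]_(n, m) -> R)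
  (hV : site_potentials F Rdef Vhat_ Vhat)
  (h1a : forall v : displacement R d n N, in_U0 rng v ->
     first_variation rng (fun=> Vhat) (ref_config n F p) v = 0)
  (gamma : R) (hgamma : 0 < gamma)
  (h1b : forall v : displacement R d n N, in_U0 rng v ->
     (gamma%:E * a1_normsq rng v
       <= (second_variation0 rng (Vhom (Dref n F p rng) Vhat) v v)%:E)%E)
  (u : displacement R d n N) (hu : in_U rng u)
  (h2 : forall v : displacement R d n N, in_U0 rng v ->
     first_variation rng (fun xi => Vdef (Dref n F p rng) (Vhat_ xi) Vhat) u v = 0) :
  exists2 C : R, 0 < C &
    forall (xi : Zsite d) (alpha : 'I_N.+1),
      (forall rhos : seq (Zsite d), (forall rho, rho \in rhos -> in_R1 rng rho) ->
         (1 <= size rhos <= 3)%N ->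
         enorm (Dsites rhos (u ord0) xi)
           <= C * (1 + enorm (site F xi)) ^ (1 - d%:Z - (size rhos)%:Z)) /\
      (forall rhos : seq (Zsite d), (forall rho, rho \in rhos -> in_R1 rng rho) ->
         (size rhos <= 2)%N ->
         enorm (Dsites rhos (fun eta => u alpha eta - u ord0 eta) xi)
           <= C * (1 + enorm (site F xi)) ^ (- d%:Z - (size rhos)%:Z)).
Proof.
have d_gt0 : (0 < d)%N by case: hd => ->.
have uF : F \in unitmx by rewrite unitmxE hF unitr1.
have [[rng_inj rng_nz] _ rng_species edges] := hrng.
have rng_basis := basis_in_R1 uF hT edges.
set Dy := Dref n F p rng in h1b h2.
have [[Vk Vhk] [M [VM VhM]] Vfar] := hV.
(* The successor makes [R0] positive, so that the unit vectors used in the Sobolev inequality count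
   as short. *)
pose R0 := (\max_(i < m) nrm (rng i).1.1).+1.
have HR0 i : (nrm (rng i).1.1 <= R0)%N by apply: leqW; exact: (leq_bigmax (F := fun i => nrm (rng i).1.1)).
pose A := hessian Vhat Dy.
pose K := `|M| + 1.
have K_gt0 : 0 < K by rewrite ltr_wpDl.
have A_linear x t y z : A (x + t *: y) z = A x z + t * A y z by exact: (hessian_linear_l Vhk).
have A_sym x y : A x y = A y x by exact: (hessian_sym Vhk VhM).
have A_bound x y : `|A x y| <= K * (nsq x + nsq y).
  apply: le_trans (hessian_bound VhM Dy x y) _.
  by rewrite ler_wpM2r ?addr_ge0 ?nsq_ge0 // lerDl.
have coercive v : fsd v -> gamma * energy rng v <= eform rng A v v.
  move=> hv; have := h1b v (fsd_in_U0 HR0 hv); rewrite second_variation0E => h.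
  rewrite -lee_fin; apply: le_trans h; rewrite EFinM.
  by apply: lee_wpmul2l; [rewrite lee_fin ltW|exact: (energy_le_a1 HR0)].
have [B hB] := in_U_summable hu.
(* The last two terms have zero load on every test function, by the equilibrium of [u] and of the
   reference state. They turn the linearised stress into a Taylor remainder away from the defect. *)
pose g x := (hessian_row Vhat Dy (Dstencil rng u x) + (-1) *: gradient (Vhat_ x) (Dy + Dstencil rng u x))
  + 1 *: gradient Vhat Dy.
have u_eq psi : fsd psi -> eform rng A u psi = load rng g psi.
  move=> hpsi; have hU0 := fsd_in_U0 HR0 hpsi.
  have defect : load rng (fun x => gradient (Vhat_ x) (Dy + Dstencil rng u x)) psi = 0.
    rewrite -[RHS](h2 psi hU0) first_variationE.
    by apply: eq_fsbigr => x _; rewrite gradient_Vdef.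
  have reference : load rng (fun=> gradient Vhat Dy) psi = 0.
    rewrite -[RHS](h1a psi hU0) first_variationE.
    by apply: eq_fsbigr => x _; rewrite Dref_const.
  rewrite /g (load_addl _ _ _ HR0 hpsi) (load_addl _ _ _ HR0 hpsi).
  rewrite [X in _ + _ * X]reference [X in _ + _ * X + _]defect !mulr0 !addr0.
  by apply: eq_fsbigr => x _; exact: (hessian_mdot Dy Vhk VhM).
pose M0 := (n * m)%:R * `|M| + 1.
have M0_gt0 : 0 < M0 by rewrite ltr_wpDl // mulr_ge0.
have [r0 hr0] := far_sites uF hRdef.
have g_quadratic x : (r0 <= nrm x)%N -> Num.sqrt (nsq (g x)) <= M0 * nsq (Dstencil rng u x).
  move=> /hr0 /Vfar e; rewrite /g e scale1r scaleN1r.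
  apply: le_trans (gradient_residual Dy Vhk VhM (Dstencil rng u x)) _.
  by rewrite ler_wpM2r ?nsq_ge0 // lerDl.
have [C C0 hC] := displacement_decay d_gt0 HR0 isT rng_basis rng_species A_linear A_sym A_bound
  K_gt0 hgamma coercive hB u_eq M0_gt0 g_quadratic.
pose Cf := 1 + Num.sqrt (nsq F * d%:R).
have Cf1 : 1 <= Cf by rewrite lerDl sqrtr_ge0.
have Cf0 : 0 < Cf by exact: lt_le_trans Cf1.
(* Passing from [nrm] to the Euclidean length costs one factor [Cf] per power, at most [d + 2] of
   them, and [Cf] is at least 1. *)
exists (C * Cf ^+ (d + 2)); first by rewrite mulr_gt0 // exprn_gt0.
have weight x j : (j <= 2)%N -> C * invn R x ^+ (d + j) <=
    C * Cf ^+ (d + 2) * (1 + enorm (site F x)) ^- (d + j).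
  move=> j2; rewrite -mulrA ler_pM2l //.
  have e0 : 0 <= (1 + enorm (site F x))^-1 by rewrite invr_ge0 addr_ge0 // sqrtr_ge0.
  apply: le_trans (_ : (Cf * (1 + enorm (site F x))^-1) ^+ (d + j) <= _).
    by rewrite lerXn2r ?nnegrE ?invn_ge0 ?mulr_ge0 ?(ltW Cf0) // invn_le_enorm.
  rewrite exprMn -exprVn ler_wpM2r ?exprn_ge0 // ler_weXn2l //.
  by rewrite leq_add2l.
have R1_short rhos : (forall rho, rho \in rhos -> in_R1 rng rho) -> short R0 rhos.
  by move=> h; apply/allP => rho /h [a [b [i hi]]]; have := HR0 i; rewrite hi.
have d2 : (2 <= d)%N by case: hd => ->.
move=> xi alpha; split=> rhos hrhos.
  (* One difference is part of the bond estimate, so order [j] uses only [j - 1 <= 2 <= d] further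
     differences, and the exponent is [1 - d - j]. *)
  case: rhos hrhos => [//|rho J] hrhos /= hsz; have hJ : (size J <= 2)%N := hsz.
  have sJ : short R0 J by apply: R1_short => r hr; apply: hrhos; rewrite inE hr orbT.
  have [_ h] := hC J xi sJ (leq_trans hJ d2).
  apply: le_trans (h rho (hrhos rho (mem_head _ _))) _.
  apply: le_trans (weight xi (size J) hJ) _.
  rewrite (_ : 1 - d%:Z - (size J).+1%:Z = - (d + size J)%:Z) ?exprnN //.
  by rewrite PoszD -addn1 PoszD; ring.
move=> hJ; have [h _] := hC rhos xi (R1_short _ hrhos) (leq_trans hJ d2).
apply: le_trans (h alpha) _; apply: le_trans (weight xi (size rhos) hJ) _.
by rewrite (_ : - d%:Z - (size rhos)%:Z = - (d + size rhos)%:Z) ?exprnN // PoszD opprD.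
Qed.
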